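(* Let $\mathcal{C}$ be a semi-abelian category satisfying condition (UA), let $B$ be an object of $\mathcal{C}$, and let $$g\colon X\to Z,\quad f\colon X\to Y,\quad h\colon Z\to W,\quad j\colon Y\to W,\qquad hg=jf,$$ be a double extension in the category $\mathbf{PXMod}_B(\mathcal{C})$, between precrossed $B$-modules $(\partial_X\colon X\to B,\xi_X)$, $(\partial_Y\colon Y\to B,\xi_Y)$, $(\partial_Z\colon Z\to B,\xi_Z)$, $(\partial_W\colon W\to B,\xi_W)$. Then it is a double central extension if and only if $$\langle K[f]\wedge K[g],X\rangle=0=\langle K[f],K[g]\rangle ,$$ where the Peiffer commutators are taken in $X$.
   Context: Internal actions. Let $\mathcal{C}$ be a semi-abelian category. For objects $B,X$, $B\flat X$ denotes the kernel of $[1,0]\colon B+X\to B$; $B\flat(-)$ is the functor part of a monad on $\mathcal{C}$, and an internal $B$-action on $X$ is an algebra $\xi\colon B\flat X\to X$ of this monad. For $u\colon A\to B$, $v\colon X\to Y$, $u\flat v\colon A\flat X\to B\flat Y$ is the restriction of $u+v$. Internal $B$-actions are equivalent to points over $B$ (split epimorphisms onto $B$ with a chosen section): $\xi$ corresponds to $p_B\colon X\rtimes_\xi B\to B$ with section $i_B$ and kernel $j_X\colon X\to X\rtimes_\xi B$, where $j_X\xi=[i_B,j_X]\ker[1,0]$. The pullback action of $\xi$ along $u\colon A\to B$ is $u^*(\xi)=\xi\cdot(u\flat 1_X)$. The conjugation action $\chi\colon B\flat B\to B$ is the restriction of $[1,1]\colon B+B\to B$ to $B\flat B$ (similarly for $X$).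 Condition (UA): for every cospan $f\colon A\to B$, $g\colon C\to B$ in $\mathcal{C}$ that is jointly extremal epimorphic, and for all internal actions $\xi_1\colon A\flat X\to X$, $\xi_2\colon C\flat X\to X$, $\xi_3,\xi_4\colon B\flat X\to X$ on a same object $X$ with $\xi_3(f\flat 1)=\xi_1=\xi_4(f\flat 1)$ and $\xi_3(g\flat 1)=\xi_2=\xi_4(g\flat 1)$, one has $\xi_3=\xi_4$. It is known that (UA) implies the ''Smith is Huq'' condition (SH) (two equivalence relations on an object centralize each other in the Smith–Pedicchio sense if and only if the corresponding normal subobjects commute in the sense of Huq). Precrossed and crossed modules. A precrossed $B$-module in $\mathcal{C}$ is a pair $(\partial\colon X\to B,\xi)$ with $\xi\colon B\flat X\to X$ an internal action and $\partial\xi=\chi(1\flat\partial)$. A morphism $(\partial,\xi)\to(\partial',\xi')$ is a morphism $f\colon X\to Y$ with $\partial'f=\partial$ and $f\xi=\xi'(1\flat f)$. These form the category $\mathbf{PXMod}_B(\mathcal{C})$, equivalent to the category $\mathbf{RG}_B(\mathcal{C})$ of internal reflexive graphs $(d,c\colon X_1\to B, e\colon B\to X_1)$, $de=1=ce$, over the fixed object $B$: a reflexive graph is sent to $X=K[d]$, $\partial=c\cdot\ker(d)$, with the action corresponding to the point $(d,e)$; so $X_1=X\rtimes_\xi B$. Under (SH), $(\partial,\xi)$ is a crossed module if and only if $\xi(\partial\flat 1)=\chi\colon X\flat X\to X$; equivalently, if and only if the corresponding reflexive graph is an internal groupoid. Crossed modules over $B$ form a full reflective (Birkhoff) subcategory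 $\mathbf{XMod}_B(\mathcal{C})$, with reflector $G\colon\mathbf{PXMod}_B(\mathcal{C})\to\mathbf{XMod}_B(\mathcal{C})$ and unit $\eta$. The category $\mathbf{PXMod}_B(\mathcal{C})$ is quasi-pointed with initial object $0\to B$; regular epimorphisms are those morphisms whose underlying morphism in $\mathcal{C}$ is a regular epimorphism; the kernel $K[f]$ of $f\colon X\to Y$ (the pullback of the initial object along $f$) has as underlying object the kernel of $f$ in $\mathcal{C}$, with structure morphism $0\colon K[f]\to B$. Peiffer commutator. Let $(\partial\colon X\to B,\xi)$, $(\partial'\colon Y\to B,\xi')$ be precrossed $B$-modules with corresponding reflexive graphs $X_1,Y_1$. Put $X\rtimes Y=X\rtimes_{\partial'^*\xi}Y$, with $j_X\colon X\to X\rtimes Y$, $i_Y\colon Y\to X\rtimes Y$, and the precrossed $B$-module structure that is the normalization of the reflexive graph $X_1\times_BY_1$ (pullback of $d_X$ and $c_Y$, with domain $d_Yp_2$, codomain $c_Xp_1$ and unit $(e_X,e_Y)$); symmetrically $Y\rtimes X=Y\rtimes_{\partial^*\xi'}X$ with $j_Y$, $i_X$. Then $j_X,i_Y,i_X,j_Y$ are morphisms of precrossed modules. Let $X+_{\mathsf{PX}}Y$ be the coproduct in $\mathbf{PXMod}_B(\mathcal{C})$. The Peiffer product $X\bowtie Y$ is the pushout in $\mathbf{PXMod}_B(\mathcal{C})$ of $[j_X,i_Y]\colon X+_{\mathsf{PX}}Y\to X\rtimes Y$ and $[i_X,j_Y]\colon X+_{\mathsf{PX}}Y\to Y\rtimes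 X$, and $\Sigma\colon X+_{\mathsf{PX}}Y\to X\bowtie Y$ is the diagonal of this pushout. If $m\colon X\to A$, $n\colon Y\to A$ are precrossed $B$-submodules (monomorphisms in $\mathbf{PXMod}_B(\mathcal{C})$) of $A$, the Peiffer commutator $\langle X,Y\rangle$ is the subobject of $A$ given by the regular image of the kernel of $\Sigma$ along $[m,n]\colon X+_{\mathsf{PX}}Y\to A$. Central extensions. An extension (regular epimorphism) $f\colon X\to Y$ in $\mathbf{PXMod}_B(\mathcal{C})$ is trivial if the naturality square $\eta_Y f=G(f)\eta_X$ is a pullback. It is $\mathbf{XMod}_B(\mathcal{C})$-central if there is a regular epimorphism $p\colon Z\to Y$ such that the pullback of $f$ along $p$ is a trivial extension. $\mathbf{Ext}(\mathbf{PXMod}_B(\mathcal{C}))$ is the full subcategory of the arrow category of $\mathbf{PXMod}_B(\mathcal{C})$ on the regular epimorphisms, and $\mathbf{CExt}(\mathbf{PXMod}_B(\mathcal{C}))$ its full subcategory on the central extensions; the latter is reflective, with reflector $G^1$ and unit $\eta^1$, where $G^1$ sends $f\colon X\to Y$ to the induced $X/\langle X,K[f]\rangle\to Y$. Double extensions. A commutative square of regular epimorphisms $hg=jf$ as in the claim is a double extension if the induced morphism $X\to Y\times_WZ$ is also a regular epimorphism; it is also viewed as the morphism $(g,j)\colon f\to h$ of $\mathbf{Ext}(\mathbf{PXMod}_B(\mathcal{C}))$. It is a trivial double extension if the naturality square $\eta^1_h\cdot(g,j)=G^1(g,j)\cdot\eta^1_f$ is a pullback in $\mathbf{Ext}(\mathbf{PXMod}_B(\mathcal{C}))$;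 equivalently, if the square with horizontal arrows $g\colon X\to Z$, $\overline g\colon X/\langle X,K[f]\rangle\to Z/\langle Z,K[h]\rangle$ and vertical arrows the canonical quotients is a pullback. It is a double central extension if there is a double extension $(p,q)\colon r\to h$ such that the pullback of $(g,j)$ along $(p,q)$ (computed componentwise) is a trivial double extension. *)

(* Defs.v *)
(* Stdlib only.  Equality of morphisms is Leibniz equality; by proof irrelevance,
   structure-preserving morphisms are equal as soon as their underlying morphisms
   are. *)
From Stdlib Require Import ProofIrrelevance.

Set Implicit Arguments.
Unset Strict Implicit.
Unset Printing Implicit Defensive.

Declare Scope cat_scope.
Delimit Scope cat_scope with cat.
Open Scope cat_scope.

Record Category := MkCategory {
  Ob :> Type;
  Hom : Ob -> Ob -> Type;
  idm : forall X, Hom X X;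
  comp : forall X Y Z, Hom Y Z -> Hom X Y -> Hom X Z;
  comp_idl : forall X Y (f : Hom X Y), comp (idm Y) f = f;
  comp_idr : forall X Y (f : Hom X Y), comp f (idm X) = f;
  comp_assoc : forall X Y Z W (h : Hom Z W) (g : Hom Y Z) (f : Hom X Y),
    comp h (comp g f) = comp (comp h g) f
}.

Arguments Hom {c} _ _.
Arguments idm {c} X.
Arguments comp {c X Y Z} _ _.

Notation "g ∘ f" := (comp g f) (at level 40, left associativity) : cat_scope.

(** * Morphisms and universal properties in an arbitrary category *)

Section Basics.
Context {C : Category}.

Definition IsIso {X Y : C} (f : Hom X Y) : Prop :=
  exists g : Hom Y X, g ∘ f = idm X /\ f ∘ g = idm Y.

Definition IsMono {X Y : C} (f : Hom X Y) : Prop :=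
  forall (T : C) (a b : Hom T X), f ∘ a = f ∘ b -> a = b.

Definition IsInitial (I : C) : Prop :=
  forall X : C, exists! f : Hom I X, True.

Definition IsCoequalizer {R X Q : C} (a b : Hom R X) (q : Hom X Q) : Prop :=
  q ∘ a = q ∘ b /\
  forall (T : C) (t : Hom X T), t ∘ a = t ∘ b -> exists! u : Hom Q T, u ∘ q = t.

Definition IsRegularEpi {X Q : C} (q : Hom X Q) : Prop :=
  exists (R : C) (a b : Hom R X), IsCoequalizer a b q.

Definition IsPullback {X Y Z P : C} (f : Hom X Z) (g : Hom Y Z)
    (p1 : Hom P X) (p2 : Hom P Y) : Prop :=
  f ∘ p1 = g ∘ p2 /\
  forall (T : C) (a : Hom T X) (b : Hom T Y), f ∘ a = g ∘ b ->
    exists! u : Hom T P, p1 ∘ u = a /\ p2 ∘ u = b.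

Definition IsPushout {S X Y Q : C} (a : Hom S X) (b : Hom S Y)
    (q1 : Hom X Q) (q2 : Hom Y Q) : Prop :=
  q1 ∘ a = q2 ∘ b /\
  forall (T : C) (s : Hom X T) (t : Hom Y T), s ∘ a = t ∘ b ->
    exists! u : Hom Q T, u ∘ q1 = s /\ u ∘ q2 = t.

(* The kernel of f is the pullback of the initial object along f; this is the
   notion that makes sense in a category that is only quasi-pointed. *)
Definition IsKernel {X Y K : C} (f : Hom X Y) (k : Hom K X) : Prop :=
  exists (I : C) (i : Hom I Y) (t : Hom K I),
    IsInitial I /\ IsPullback f i k t.

Definition IsImage {X Y P : C} (f : Hom X Y) (k : Hom P Y) : Prop :=
  exists e : Hom X P, IsRegularEpi e /\ IsMono k /\ k ∘ e = f.

(* The subobject l represents the intersection of the subobjects m and n. *)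
Definition IsMeet {M N L A : C} (m : Hom M A) (n : Hom N A) (l : Hom L A) : Prop :=
  exists (p1 : Hom L M) (p2 : Hom L N), IsPullback m n p1 p2 /\ l = m ∘ p1.

Definition JointlyExtremalEpi {X Y Z : C} (f : Hom X Z) (g : Hom Y Z) : Prop :=
  forall (M : C) (m : Hom M Z) (f' : Hom X M) (g' : Hom Y M),
    IsMono m -> m ∘ f' = f -> m ∘ g' = g -> IsIso m.

Record IsEquivalenceRelation {R X : C} (r1 r2 : Hom R X) : Prop := {
  er_mono : forall (T : C) (a b : Hom T R),
    r1 ∘ a = r1 ∘ b -> r2 ∘ a = r2 ∘ b -> a = b;
  er_refl : exists s : Hom X R, r1 ∘ s = idm X /\ r2 ∘ s = idm X;
  er_sym : exists t : Hom R R, r1 ∘ t = r2 /\ r2 ∘ t = r1;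
  er_trans : forall (T : C) (a b : Hom T R), r2 ∘ a = r1 ∘ b ->
    exists c : Hom T R, r1 ∘ c = r1 ∘ a /\ r2 ∘ c = r2 ∘ b
}.

Record Pullback {X Y Z : C} (f : Hom X Z) (g : Hom Y Z) := MkPullback {
  pb_ob :> C;
  pb1 : Hom pb_ob X;
  pb2 : Hom pb_ob Y;
  pb_comm : f ∘ pb1 = g ∘ pb2;
  pb_lift : forall (T : C) (a : Hom T X) (b : Hom T Y),
    f ∘ a = g ∘ b -> Hom T pb_ob;
  pb_lift1 : forall (T : C) (a : Hom T X) (b : Hom T Y) (e : f ∘ a = g ∘ b),
    pb1 ∘ pb_lift e = a;
  pb_lift2 : forall (T : C) (a : Hom T X) (b : Hom T Y) (e : f ∘ a = g ∘ b),
    pb2 ∘ pb_lift e = b;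
  pb_ext : forall (T : C) (u v : Hom T pb_ob),
    pb1 ∘ u = pb1 ∘ v -> pb2 ∘ u = pb2 ∘ v -> u = v
}.

Record Coproduct (X Y : C) := MkCoproduct {
  cp_ob :> C;
  cp_inl : Hom X cp_ob;
  cp_inr : Hom Y cp_ob;
  cp_copair : forall T : C, Hom X T -> Hom Y T -> Hom cp_ob T;
  cp_copair_inl : forall (T : C) (a : Hom X T) (b : Hom Y T),
    cp_copair a b ∘ cp_inl = a;
  cp_copair_inr : forall (T : C) (a : Hom X T) (b : Hom Y T),
    cp_copair a b ∘ cp_inr = b;
  cp_ext : forall (T : C) (u v : Hom cp_ob T),
    u ∘ cp_inl = v ∘ cp_inl -> u ∘ cp_inr = v ∘ cp_inr -> u = v
}.

End Basics.

(* Bourn protomodularity: the change-of-base functors between categories of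
   points reflect isomorphisms. *)
Definition IsProtomodular (C : Category) : Prop :=
  forall (A B : C) (u : Hom A B)
    (E : C) (p : Hom E B) (s : Hom B E)
    (E' : C) (p' : Hom E' B) (s' : Hom B E')
    (h : Hom E E')
    (P : C) (a : Hom P A) (b : Hom P E)
    (P' : C) (a' : Hom P' A) (b' : Hom P' E')
    (k : Hom P P'),
    p ∘ s = idm B -> p' ∘ s' = idm B -> p' ∘ h = p -> h ∘ s = s' ->
    IsPullback u p a b -> IsPullback u p' a' b' ->
    a' ∘ k = a -> b' ∘ k = h ∘ b ->
    IsIso k -> IsIso h.

(** * Semi-abelian categories *)

(* Pointed, Barr exact, Bourn protomodular, with binary coproducts.  The zero
   object, pullbacks and binary coproducts are chosen. *)
Record SemiAbelian := MkSemiAbelian {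
  sa_cat :> Category;
  zero_ob : sa_cat;
  zero_initial : forall X : sa_cat, Hom zero_ob X;
  zero_initial_unique : forall (X : sa_cat) (f g : Hom zero_ob X), f = g;
  zero_terminal : forall X : sa_cat, Hom X zero_ob;
  zero_terminal_unique : forall (X : sa_cat) (f g : Hom X zero_ob), f = g;
  pullback : forall (X Y Z : sa_cat) (f : Hom X Z) (g : Hom Y Z), Pullback f g;
  coproduct : forall X Y : sa_cat, Coproduct X Y;
  kernel_pair_coequalizer :
    forall (X Y R : sa_cat) (f : Hom X Y) (r1 r2 : Hom R X),
      IsPullback f f r1 r2 ->
      exists (Q : sa_cat) (q : Hom X Q), IsCoequalizer r1 r2 q;
  regular_epi_stable :
    forall (X Y Z P : sa_cat) (f : Hom X Z) (g : Hom Y Z)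
      (p1 : Hom P X) (p2 : Hom P Y),
      IsPullback f g p1 p2 -> IsRegularEpi f -> IsRegularEpi p2;
  equivalence_relation_effective :
    forall (R X : sa_cat) (r1 r2 : Hom R X), IsEquivalenceRelation r1 r2 ->
      exists (Q : sa_cat) (q : Hom X Q), IsPullback q q r1 r2;
  protomodular : IsProtomodular sa_cat
}.

Arguments zero_initial {s} X.
Arguments zero_terminal {s} X.
Arguments pullback {s X Y Z} f g.
Arguments coproduct {s} X Y.

Section InternalActions.
Context {C : SemiAbelian}.

Definition zero (X Y : C) : Hom X Y := zero_initial Y ∘ zero_terminal X.

Lemma zero_comp (X Y Z : C) (f : Hom X Y) : zero Y Z ∘ f = zero X Z.
Proof.
unfold zero; rewrite <- comp_assoc; f_equal; apply zero_terminal_unique.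
Qed.

Lemma comp_zero (X Y Z : C) (f : Hom Y Z) : f ∘ zero X Y = zero X Z.
Proof.
unfold zero; rewrite comp_assoc; f_equal; apply zero_initial_unique.
Qed.

Definition ker {X Y : C} (f : Hom X Y) : Pullback f (zero_initial Y) :=
  pullback f (zero_initial Y).

Definition ker_in {X Y : C} (f : Hom X Y) : Hom (ker f) X := pb1 (ker f).

Lemma ker_in_zero (X Y : C) (f : Hom X Y) : f ∘ ker_in f = zero (ker f) Y.
Proof.
unfold ker_in, zero; rewrite pb_comm; f_equal; apply zero_terminal_unique.
Qed.

Definition ker_lift {X Y T : C} (f : Hom X Y) (a : Hom T X)
  (e : f ∘ a = zero T Y) : Hom T (ker f) := pb_lift (ker f) e.

Lemma ker_in_lift (X Y T : C) (f : Hom X Y) (a : Hom T X) (e : f ∘ a = zero T Y) :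
  ker_in f ∘ ker_lift e = a.
Proof. apply pb_lift1. Qed.

Lemma ker_in_mono (X Y : C) (f : Hom X Y) : IsMono (ker_in f).
Proof.
intros T a b e; apply (pb_ext (p := ker f)); [exact e | apply zero_terminal_unique].
Qed.

Definition inl {X Y : C} : Hom X (coproduct X Y) := cp_inl _.
Definition inr {X Y : C} : Hom Y (coproduct X Y) := cp_inr _.
Definition copair {X Y T : C} (a : Hom X T) (b : Hom Y T) :
  Hom (coproduct X Y) T := cp_copair (coproduct X Y) a b.

Lemma copair_inl (X Y T : C) (a : Hom X T) (b : Hom Y T) : copair a b ∘ inl = a.
Proof. apply cp_copair_inl. Qed.

Lemma copair_inr (X Y T : C) (a : Hom X T) (b : Hom Y T) : copair a b ∘ inr = b.
Proof. apply cp_copair_inr. Qed.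

Lemma copair_ext (X Y T : C) (u v : Hom (coproduct X Y) T) :
  u ∘ inl = v ∘ inl -> u ∘ inr = v ∘ inr -> u = v.
Proof. apply cp_ext. Qed.

Lemma comp_copair (X Y T U : C) (h : Hom T U) (a : Hom X T) (b : Hom Y T) :
  h ∘ copair a b = copair (h ∘ a) (h ∘ b).
Proof.
apply copair_ext; rewrite <- comp_assoc;
  rewrite ?copair_inl, ?copair_inr; reflexivity.
Qed.

(* u + v : A + X -> B + Y *)
Definition cop_map {A B X Y : C} (u : Hom A B) (v : Hom X Y) :
  Hom (coproduct A X) (coproduct B Y) := copair (inl ∘ u) (inr ∘ v).

Definition proj (B X : C) : Hom (coproduct B X) B := copair (idm B) (zero X B).

(* B♭X *)
Definition flat (B X : C) : C := ker (proj B X).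

Definition flat_in (B X : C) : Hom (flat B X) (coproduct B X) := ker_in (proj B X).

Lemma proj_flat_in (B X : C) : proj B X ∘ flat_in B X = zero (flat B X) B.
Proof. apply ker_in_zero. Qed.

Lemma flat_map_subproof (A B X Y : C) (u : Hom A B) (v : Hom X Y) :
  proj B Y ∘ (cop_map u v ∘ flat_in A X) = zero (flat A X) B.
Proof.
assert (e : proj B Y ∘ cop_map u v = u ∘ proj A X).
{ unfold proj, cop_map; rewrite !comp_copair, !comp_assoc,
    copair_inl, copair_inr, comp_idl, comp_idr, zero_comp, comp_zero.
  reflexivity. }
rewrite comp_assoc, e, <- comp_assoc, proj_flat_in; apply comp_zero.
Qed.

(* u♭v : A♭X -> B♭Y *)
Definition flat_map {A B X Y : C} (u : Hom A B) (v : Hom X Y) :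
  Hom (flat A X) (flat B Y) := ker_lift (flat_map_subproof u v).

Lemma flat_in_map (A B X Y : C) (u : Hom A B) (v : Hom X Y) :
  flat_in B Y ∘ flat_map u v = cop_map u v ∘ flat_in A X.
Proof. apply ker_in_lift. Qed.

Lemma flat_map_id (A X : C) : flat_map (idm A) (idm X) = idm (flat A X).
Proof.
apply (ker_in_mono (f := proj A X)).
change (flat_in A X ∘ flat_map (idm A) (idm X) = flat_in A X ∘ idm (flat A X)).
rewrite flat_in_map, comp_idr.
replace (cop_map (idm A) (idm X)) with (idm (coproduct A X)).
- apply comp_idl.
- unfold cop_map; apply copair_ext;
    rewrite ?copair_inl, ?copair_inr, comp_idl, comp_idr; reflexivity.
Qed.

Lemma flat_map_comp (A A' A'' X X' X'' : C) (u' : Hom A' A'') (u : Hom A A')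
    (v' : Hom X' X'') (v : Hom X X') :
  flat_map (u' ∘ u) (v' ∘ v) = flat_map u' v' ∘ flat_map u v.
Proof.
apply (ker_in_mono (f := proj A'' X'')).
change (flat_in A'' X'' ∘ flat_map (u' ∘ u) (v' ∘ v)
        = flat_in A'' X'' ∘ (flat_map u' v' ∘ flat_map u v)).
rewrite comp_assoc, !flat_in_map, <- comp_assoc, flat_in_map, comp_assoc.
f_equal; unfold cop_map.
rewrite comp_copair, !comp_assoc, copair_inl, copair_inr; reflexivity.
Qed.

(** ** The monad B♭(-) *)

Definition flat_unit (B X : C) : Hom X (flat B X) :=
  ker_lift (copair_inr (idm B) (zero X B)).

Lemma flat_mult_subproof (B X : C) :
  proj B X ∘ (copair inl (flat_in B X) ∘ flat_in B (flat B X))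
  = zero (flat B (flat B X)) B.
Proof.
rewrite comp_assoc, comp_copair, proj_flat_in.
unfold proj at 1; rewrite copair_inl; apply proj_flat_in.
Qed.

Definition flat_mult (B X : C) : Hom (flat B (flat B X)) (flat B X) :=
  ker_lift (flat_mult_subproof B X).

(* An internal B-action on X: an algebra of the monad B♭(-). *)
Definition IsAction {B X : C} (xi : Hom (flat B X) X) : Prop :=
  xi ∘ flat_unit B X = idm X /\
  xi ∘ flat_mult B X = xi ∘ flat_map (idm B) xi.

Definition act_pullback {A B X : C} (u : Hom A B) (xi : Hom (flat B X) X) :
  Hom (flat A X) X := xi ∘ flat_map u (idm X).

Definition conj_act (B : C) : Hom (flat B B) B :=
  copair (idm B) (idm B) ∘ flat_in B B.

(* The point (p, i) over B, with kernel j, corresponds to the action xi, that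
   is, S is the semidirect product of X and B along xi. *)
Definition IsSemidirect {B X S : C} (xi : Hom (flat B X) X)
    (p : Hom S B) (i : Hom B S) (j : Hom X S) : Prop :=
  p ∘ i = idm B /\ IsKernel p j /\ j ∘ xi = copair i j ∘ flat_in B X.

End InternalActions.

Definition ConditionUA (C : SemiAbelian) : Prop :=
  forall (A B D : C) (f : Hom A B) (g : Hom D B), JointlyExtremalEpi f g ->
  forall (X : C) (xi1 : Hom (flat A X) X) (xi2 : Hom (flat D X) X)
    (xi3 xi4 : Hom (flat B X) X),
    IsAction xi1 -> IsAction xi2 -> IsAction xi3 -> IsAction xi4 ->
    act_pullback f xi3 = xi1 -> xi1 = act_pullback f xi4 ->
    act_pullback g xi3 = xi2 -> xi2 = act_pullback g xi4 ->
    xi3 = xi4.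

(** * Precrossed modules, crossed modules, reflexive graphs *)

Record PrecrossedModule (C : SemiAbelian) (B : C) := MkPX {
  px_ob : C;
  px_bd : Hom px_ob B;
  px_act : Hom (flat B px_ob) px_ob;
  px_action : IsAction px_act;
  px_precrossed : px_bd ∘ px_act = conj_act B ∘ flat_map (idm B) px_bd
}.

Record PXHom (C : SemiAbelian) (B : C) (X Y : PrecrossedModule B) := MkPXHom {
  px_hom : Hom (px_ob X) (px_ob Y);
  px_hom_bd : px_bd Y ∘ px_hom = px_bd X;
  px_hom_act : px_hom ∘ px_act X = px_act Y ∘ flat_map (idm B) px_hom
}.

Section PXCategory.
Variables (C : SemiAbelian) (B : C).

Lemma px_hom_ext (X Y : PrecrossedModule B) (f g : PXHom X Y) :
  px_hom f = px_hom g -> f = g.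
Proof.
destruct f as [f bf af], g as [g bg ag]; simpl; intro e; subst g.
f_equal; apply proof_irrelevance.
Qed.

Definition px_id (X : PrecrossedModule B) : PXHom X X.
Proof.
refine {| px_hom := idm (px_ob X) |}.
- apply comp_idr.
- rewrite flat_map_id, comp_idl, comp_idr; reflexivity.
Defined.

Definition px_comp (X Y Z : PrecrossedModule B) (g : PXHom Y Z) (f : PXHom X Y) :
  PXHom X Z.
Proof.
refine {| px_hom := px_hom g ∘ px_hom f |}.
- rewrite comp_assoc, px_hom_bd; apply px_hom_bd.
- rewrite <- comp_assoc, px_hom_act, comp_assoc, px_hom_act.
  rewrite <- comp_assoc, <- flat_map_comp, comp_idl; reflexivity.
Defined.

Definition PXMod : Category.
Proof.
refine {| Ob := PrecrossedModule B; Hom := @PXHom C B;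
          idm := px_id; comp := px_comp |}.
- intros; apply px_hom_ext, comp_idl.
- intros; apply px_hom_ext, comp_idr.
- intros; apply px_hom_ext, comp_assoc.
Defined.

(* The Peiffer condition.  Under "Smith is Huq", hence under ConditionUA, it
   says that the corresponding reflexive graph is an internal groupoid. *)
Definition IsCrossedModule (X : PXMod) : Prop :=
  act_pullback (px_bd X) (px_act X) = conj_act (px_ob X).

Record ReflexiveGraph := MkRG {
  rg_ob : C;
  rg_dom : Hom rg_ob B;
  rg_cod : Hom rg_ob B;
  rg_unit : Hom B rg_ob;
  rg_dom_unit : rg_dom ∘ rg_unit = idm B;
  rg_cod_unit : rg_cod ∘ rg_unit = idm B
}.

(* X is the precrossed module that corresponds to the reflexive graph G, with
   k the kernel of the domain morphism. *)
Definition IsNormalization (G : ReflexiveGraph) (X : PXMod)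
    (k : Hom (px_ob X) (rg_ob G)) : Prop :=
  IsSemidirect (px_act X) (rg_dom G) (rg_unit G) k /\ px_bd X = rg_cod G ∘ k.

(* The reflexive graph of composable pairs, on the pullback of dom G and cod H. *)
Lemma rg_composite_subproof (G H : ReflexiveGraph) :
  rg_dom G ∘ rg_unit G = rg_cod H ∘ rg_unit H.
Proof. rewrite rg_dom_unit, rg_cod_unit; reflexivity. Qed.

Definition rg_composite (G H : ReflexiveGraph) : ReflexiveGraph.
Proof.
pose (P := pullback (rg_dom G) (rg_cod H)).
refine {| rg_ob := P;
          rg_dom := rg_dom H ∘ pb2 P;
          rg_cod := rg_cod G ∘ pb1 P;
          rg_unit := pb_lift P (rg_composite_subproof G H) |}.
- rewrite <- comp_assoc, pb_lift2; apply rg_dom_unit.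
- rewrite <- comp_assoc, pb_lift1; apply rg_cod_unit.
Defined.

Definition rg_pr1 (G H : ReflexiveGraph) :
  Hom (rg_ob (rg_composite G H)) (rg_ob G) := pb1 (pullback (rg_dom G) (rg_cod H)).

Definition rg_pr2 (G H : ReflexiveGraph) :
  Hom (rg_ob (rg_composite G H)) (rg_ob H) := pb2 (pullback (rg_dom G) (rg_cod H)).

(** * The Peiffer product and the Peiffer commutator *)

(* S is the precrossed module X ⋊ Y with its canonical morphisms jX and iY: on
   the one hand the semidirect product along the pullback action of px_act X
   along px_bd Y, on the other hand, via kS, the normalization of the composite
   graph.  In terms of elements of the composite graph, the identification kS
   sends jX x to (kX x, 0) and iY y to (e (∂ y), kY y). *)
Definition IsPXSemidirect (X Y S : PXMod) (jX : Hom X S) (iY : Hom Y S) : Prop :=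
  exists (G H : ReflexiveGraph)
    (kX : Hom (px_ob X) (rg_ob G)) (kY : Hom (px_ob Y) (rg_ob H))
    (kS : Hom (px_ob S) (rg_ob (rg_composite G H)))
    (p : Hom (px_ob S) (px_ob Y)),
    IsNormalization kX /\ IsNormalization kY /\ IsNormalization kS /\
    IsSemidirect (act_pullback (px_bd Y) (px_act X)) p (px_hom iY) (px_hom jX) /\
    rg_pr2 G H ∘ kS = kY ∘ p /\
    rg_pr1 G H ∘ kS ∘ px_hom jX = kX /\
    rg_pr1 G H ∘ kS ∘ px_hom iY = rg_unit G ∘ px_bd Y.

Record PeifferProduct (X Y : PXMod) := MkPeifferProduct {
  pp_coprod : Coproduct X Y;
  pp_XY : PXMod;
  pp_jX : Hom X pp_XY;
  pp_iY : Hom Y pp_XY;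
  pp_XY_semidirect : IsPXSemidirect pp_jX pp_iY;
  pp_YX : PXMod;
  pp_jY : Hom Y pp_YX;
  pp_iX : Hom X pp_YX;
  pp_YX_semidirect : IsPXSemidirect pp_jY pp_iX;
  pp_ob : PXMod;
  pp_q1 : Hom pp_XY pp_ob;
  pp_q2 : Hom pp_YX pp_ob;
  pp_pushout :
    IsPushout (cp_copair pp_coprod pp_jX pp_iY) (cp_copair pp_coprod pp_iX pp_jY)
      pp_q1 pp_q2
}.

(* The canonical morphism from the coproduct to the Peiffer product. *)
Definition pp_sigma (X Y : PXMod) (D : PeifferProduct X Y) :
  Hom (pp_coprod D : PXMod) (pp_ob D) :=
  pp_q1 D ∘ cp_copair (pp_coprod D) (pp_jX D) (pp_iY D).

(* The subobject k of A is the Peiffer commutator of the subobjects m and n. *)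
Definition IsPeifferCommutator (M N A P : PXMod)
    (m : Hom M A) (n : Hom N A) (k : Hom P A) : Prop :=
  exists (D : PeifferProduct M N) (K : PXMod) (kappa : Hom K (pp_coprod D)),
    IsKernel (pp_sigma D) kappa /\
    IsImage (cp_copair (pp_coprod D) m n ∘ kappa) k.

(* The Peiffer commutator of m and n is the zero subobject, i.e. is the initial
   precrossed module. *)
Definition PeifferCommutatorZero (M N A : PXMod) (m : Hom M A) (n : Hom N A) : Prop :=
  exists (P : PXMod) (k : Hom P A), IsPeifferCommutator m n k /\ IsInitial P.

End PXCategory.

Arguments PXMod {C} B.
Arguments IsCrossedModule {C B} X.

(** * Extensions and central extensions *)

Section Reflections.
Context {A : Category}.

Definition IsReflection (S : A -> Prop) {X X' : A} (eta : Hom X X') : Prop :=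
  S X' /\
  forall (T : A) (t : Hom X T), S T -> exists! u : Hom X' T, u ∘ eta = t.

Definition NaturalitySquareIsPullback (S : A -> Prop) {X Y : A} (f : Hom X Y) : Prop :=
  exists (X' Y' : A) (etaX : Hom X X') (etaY : Hom Y Y') (f' : Hom X' Y'),
    IsReflection S etaX /\ IsReflection S etaY /\
    IsPullback etaY f' f etaX.

Definition IsTrivialExtension (S : A -> Prop) {X Y : A} (f : Hom X Y) : Prop :=
  IsRegularEpi f /\ NaturalitySquareIsPullback S f.

Definition IsCentralExtension (S : A -> Prop) {X Y : A} (f : Hom X Y) : Prop :=
  IsRegularEpi f /\
  exists (Z : A) (p : Hom Z Y), IsRegularEpi p /\
    exists (P : A) (f' : Hom P Z) (p' : Hom P X),
      IsPullback f p p' f' /\ IsTrivialExtension S f'.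

End Reflections.

Record Extension (A : Category) := MkExt {
  ext_dom : A;
  ext_cod : A;
  ext_arr : Hom ext_dom ext_cod;
  ext_reg : IsRegularEpi ext_arr
}.

Record ExtHom (A : Category) (f h : Extension A) := MkExtHom {
  ext_top : Hom (ext_dom f) (ext_dom h);
  ext_bot : Hom (ext_cod f) (ext_cod h);
  ext_comm : ext_arr h ∘ ext_top = ext_bot ∘ ext_arr f
}.

Section ExtCategory.
Variable A : Category.

Lemma ext_hom_ext (f h : Extension A) (a b : ExtHom f h) :
  ext_top a = ext_top b -> ext_bot a = ext_bot b -> a = b.
Proof.
destruct a as [a1 a2 ea], b as [b1 b2 eb]; simpl; intros e1 e2; subst b1 b2.
f_equal; apply proof_irrelevance.
Qed.

Definition ext_id (f : Extension A) : ExtHom f f.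
Proof.
refine {| ext_top := idm (ext_dom f); ext_bot := idm (ext_cod f) |}.
rewrite comp_idl, comp_idr; reflexivity.
Defined.

Definition ext_comp (f g h : Extension A) (b : ExtHom g h) (a : ExtHom f g) :
  ExtHom f h.
Proof.
refine {| ext_top := ext_top b ∘ ext_top a; ext_bot := ext_bot b ∘ ext_bot a |}.
rewrite comp_assoc, ext_comm, <- comp_assoc, ext_comm; apply comp_assoc.
Defined.

Definition Ext : Category.
Proof.
refine {| Ob := Extension A; Hom := @ExtHom A; idm := ext_id; comp := ext_comp |}.
- intros; apply ext_hom_ext; apply comp_idl.
- intros; apply ext_hom_ext; apply comp_idr.
- intros; apply ext_hom_ext; apply comp_assoc.
Defined.

(** * Double extensions *)

Definition IsDoubleExtension (f h : Ext) (s : Hom f h) : Prop :=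
  IsRegularEpi (ext_top s) /\ IsRegularEpi (ext_bot s) /\
  exists (P : A) (p1 : Hom P (ext_cod f)) (p2 : Hom P (ext_dom h))
    (k : Hom (ext_dom f) P),
    IsPullback (ext_bot s) (ext_arr h) p1 p2 /\
    p1 ∘ k = ext_arr f /\ p2 ∘ k = ext_top s /\ IsRegularEpi k.

(* S is the subcategory of A with respect to which extensions are central. *)
Definition IsTrivialDoubleExtension (S : A -> Prop) (f h : Ext) (s : Hom f h) : Prop :=
  IsDoubleExtension s /\
  NaturalitySquareIsPullback (fun e : Ext => IsCentralExtension S (ext_arr e)) s.

Definition IsDoubleCentralExtension (S : A -> Prop) (f h : Ext) (s : Hom f h) : Prop :=
  IsDoubleExtension s /\
  exists (r : Ext) (p : Hom r h), IsDoubleExtension p /\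
    exists (f' : Ext) (s' : Hom f' r) (p' : Hom f' f),
      IsPullback (ext_top s) (ext_top p) (ext_top p') (ext_top s') /\
      IsPullback (ext_bot s) (ext_bot p) (ext_bot p') (ext_bot s') /\
      IsTrivialDoubleExtension S s'.

End ExtCategory.

(* The square h ∘ g = j ∘ f, viewed as the morphism (g, j) from f to h. *)
Definition ext_square (A : Category) (X Y Z W : A)
    (g : Hom X Z) (f : Hom X Y) (h : Hom Z W) (j : Hom Y W)
    (hf : IsRegularEpi f) (hh : IsRegularEpi h) (e : h ∘ g = j ∘ f) :
    @Hom (Ext A) (MkExt hf) (MkExt hh) :=
  @MkExtHom A (MkExt hf) (MkExt hh) g j e.

(* Main.v *)
From Stdlib Require Import ssreflect.
From Stdlib Require Import ClassicalEpsilon.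
Require Import Defs.

(** Let X_1 = X ⋊ B be the total object of the reflexive graph of a precrossed module X.
    Everything takes place in the objects X_1, through one relation: two morphisms
    u, v : A -> X_1 conjugate a morphism k into X_1 in the same way, written
    SameAct u v k.  Condition (UA) says that, for k normal, SameAct u v k may be tested
    on a jointly extremal epic pair of morphisms into A, for instance on X and B when
    A = X_1 (ua_same).

    The Peiffer commutator of two normal precrossed submodules vanishes if and only if
    each of them conjugates the other in the same way as it acts on it through its
    boundary (peiffer_zero_same, same_peiffer_zero): such an agreement is what is needed
    to extend the two inclusions to the semidirect products.  A kernel has boundary zero,
    so the commutator of K[f] and K[g] vanishes when these two subobjects commute, and
    that of their intersection with X vanishes when X acts trivially on the intersection,
    both by conjugation and through the boundary (CentralIn).  The latter condition on
    K[f] also characterizes the central extensions f: it holds for kernels of morphisms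
    between crossed modules, is reflected by jointly monic pairs of morphisms and passes to
    quotients (central_extension_central); conversely, it makes the kernel pair of f a
    pullback of the reflection of X into crossed modules (central_central_extension).

    Necessity.  If (g, j) is double central, then some pullback of it along a double
    extension from r to h has its domain jointly embedded into the domain R of r and the
    domain of a central extension.  In the latter both conditions hold by centrality; in
    R they hold because the subobjects over K[g] become zero.  They descend to X, since
    K[f] is covered by its counterpart (double_central_conditions).

    Sufficiency.  The square (g, j) is pulled back along itself, giving the extension
    F : R[g] -> R[j].  Let q : X -> X' be the quotient of X by the commutator of X and
    K[f].  Its kernel lies in K[f], hence acts trivially on K[g], and so the point R[g]
    over X, which has kernel K[g], descends to a point T over X' with
    R[g] = X ×_X' T (kernel_pair_descent).  It remains to see that T -> R[j] is the
    reflection of F into central extensions.  Universality holds because the kernel of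
    R[g] -> T lies on the diagonal.  For centrality, (UA) leaves the conjugation by K[g]
    and that by X' to be examined.  The first is trivial because K[f] and K[g] commute.
    For the second, the kernel of F lies in the kernel pair of X -> Y ×_W Z, which is
    X_1 ×_B M_1 with M the intersection of K[f] and K[g]; in its quotient X'_1 ×_B M_1
    the two projections reduce the question to the centrality of X' -> Y and to that of M
    (double_reflection_central). *)
Set Implicit Arguments.
Unset Strict Implicit.
Unset Printing Implicit Defensive.
Set Bullet Behavior "None".

(** * Composition, pullbacks and regular epimorphisms in any category *)

Section Reassociation.
Context {C : Category}.

Lemma reassoc2 {X1 X2 X3 : C} {a : Hom X2 X3} {b : Hom X1 X2} {k : Hom X1 X3} :
  a ∘ b = k -> forall T (x : Hom T X1), a ∘ (b ∘ x) = k ∘ x.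
Proof. by move=> e T x; rewrite comp_assoc e. Qed.

Lemma reassoc3 {X1 X2 X3 X4 : C} {a : Hom X3 X4} {b : Hom X2 X3} {c : Hom X1 X2}
    {k : Hom X1 X4} :
  a ∘ (b ∘ c) = k -> forall T (x : Hom T X1), a ∘ (b ∘ (c ∘ x)) = k ∘ x.
Proof. by move=> e T x; rewrite -e -!comp_assoc. Qed.

Lemma reassoc4 {X1 X2 X3 X4 X5 : C} {a : Hom X4 X5} {b : Hom X3 X4} {c : Hom X2 X3}
    {d : Hom X1 X2} {k : Hom X1 X5} :
  a ∘ (b ∘ (c ∘ d)) = k -> forall T (x : Hom T X1), a ∘ (b ∘ (c ∘ (d ∘ x))) = k ∘ x.
Proof. by move=> e T x; rewrite -e -!comp_assoc. Qed.

End Reassociation.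

(* Composites are kept associated to the right; rw e rewrites with e also where further
   factors follow its left-hand side. *)
#[global] Hint Rewrite <- @comp_assoc : assoc.
#[global] Hint Rewrite @comp_idl @comp_idr : assoc.

Ltac rw1 E :=
  let H := fresh "H" in
  pose proof E as H;
  autorewrite with assoc in H;
  autorewrite with assoc;
  first [ rewrite !H; try rewrite !(reassoc2 H); try rewrite !(reassoc3 H);
            try rewrite !(reassoc4 H) | rewrite !(reassoc2 H) | rewrite !(reassoc3 H)
        | rewrite !(reassoc4 H) ];
  autorewrite with assoc;
  clear H.

Tactic Notation "rw" constr(a) := rw1 a.
Tactic Notation "rw" constr(a) "," constr(b) := rw1 a; rw1 b.
Tactic Notation "rw" constr(a) "," constr(b) "," constr(c) := rw1 a; rw1 b; rw1 c.
Tactic Notation "rw" constr(a) "," constr(b) "," constr(c) "," constr(d) :=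
  rw1 a; rw1 b; rw1 c; rw1 d.
Tactic Notation "rw" constr(a) "," constr(b) "," constr(c) "," constr(d) ","
  constr(e) := rw1 a; rw1 b; rw1 c; rw1 d; rw1 e.
Tactic Notation "rw" constr(a) "," constr(b) "," constr(c) "," constr(d) ","
  constr(e) "," constr(f) := rw1 a; rw1 b; rw1 c; rw1 d; rw1 e; rw1 f.

Section General.
Context {C : Category}.

Definition IsEpi {X Y : C} (f : Hom X Y) : Prop :=
  forall (T : C) (a b : Hom Y T), a ∘ f = b ∘ f -> a = b.

Lemma iso_id (X : C) : IsIso (idm X).
Proof. by exists (idm X); rewrite comp_idl. Qed.

Lemma iso_comp (X Y Z : C) (g : Hom Y Z) (f : Hom X Y) :
  IsIso g -> IsIso f -> IsIso (g ∘ f).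
Proof.
move=> [g' [g1 g2]] [f' [f1 f2]]; exists (f' ∘ g'); split.
- by rw g1, f1.
- by rw f2, g2.
Qed.

Lemma iso_mono (X Y : C) (f : Hom X Y) : IsIso f -> IsMono f.
Proof.
move=> [g [e _]] T a b eab.
by rewrite -(comp_idl a) -(comp_idl b) -e -!comp_assoc eab.
Qed.

Lemma iso_epi (X Y : C) (f : Hom X Y) : IsIso f -> IsEpi f.
Proof.
move=> [g [_ e]] T a b eab.
by rewrite -(comp_idr a) -(comp_idr b) -e !comp_assoc eab.
Qed.

Lemma mono_comp (X Y Z : C) (g : Hom Y Z) (f : Hom X Y) :
  IsMono g -> IsMono f -> IsMono (g ∘ f).
Proof. by move=> mg mf T a b e; apply/mf/mg; rewrite !comp_assoc. Qed.

Lemma mono_cancel (X Y Z : C) (g : Hom Y Z) (f : Hom X Y) :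
  IsMono (g ∘ f) -> IsMono f.
Proof. by move=> m T a b e; apply: m; rewrite -!comp_assoc e. Qed.

Lemma section_mono (X Y : C) (r : Hom Y X) (s : Hom X Y) : r ∘ s = idm X -> IsMono s.
Proof.
by move=> e T a b eab; rewrite -(comp_idl a) -(comp_idl b) -e -!comp_assoc eab.
Qed.

Lemma mono_retraction_iso (X Y : C) (m : Hom X Y) (s : Hom Y X) :
  IsMono m -> m ∘ s = idm Y -> IsIso m.
Proof. by move=> mm e; exists s; split=> //; apply: mm; rw e. Qed.

Lemma regepi_epi (X Y : C) (f : Hom X Y) : IsRegularEpi f -> IsEpi f.
Proof.
move=> [R [a [b [e u]]]] T s t est.
have [|w [_ uw]] := u T (s ∘ f); first by rw e.
by rewrite -(uw s eq_refl) -(uw t (eq_sym est)).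
Qed.

Lemma regepi_lift (X Y M Z : C) (f : Hom X Y) (m : Hom M Z) (x : Hom X M) (y : Hom Y Z) :
  IsRegularEpi f -> IsMono m -> m ∘ x = y ∘ f -> exists w, m ∘ w = y /\ w ∘ f = x.
Proof.
move=> rf mm e; have ef := regepi_epi rf.
case: rf => [R [a [b [eab u]]]].
have [|w [ew _]] := u M x; first by apply: mm; rw e, eab, (eq_sym e).
by exists w; split=> //; apply: ef; rw ew, e.
Qed.

Lemma regepi_mono_iso (X Y : C) (f : Hom X Y) : IsRegularEpi f -> IsMono f -> IsIso f.
Proof.
move=> rf mf.
have [w [e1 e2]] := regepi_lift (x := idm X) (y := idm Y) rf mf (eq_trans (comp_idr _) (eq_sym (comp_idl _))).
by exists w.
Qed.

Lemma regepi_iso_left (X Y Z : C) (f : Hom X Y) (i : Hom Y Z) :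
  IsRegularEpi f -> IsIso i -> IsRegularEpi (i ∘ f).
Proof.
move=> [R [a [b [e u]]]] [i' [i1 i2]]; exists R, a, b; split; first by rw e.
move=> T t et; have [w [ew uw]] := u T t et.
exists (w ∘ i'); split; first by rw i1, ew.
move=> v ev; rewrite (uw (v ∘ i)); first by rw ev.
by rw i2.
Qed.

Lemma splitepi_regepi (X Y : C) (p : Hom X Y) (s : Hom Y X) :
  p ∘ s = idm Y -> IsRegularEpi p.
Proof.
move=> e; exists X, (idm X), (s ∘ p); split; first by rw e.
move=> T t; rewrite comp_idr => et.
exists (t ∘ s); split; first by rewrite -comp_assoc -et.
by move=> v ev; rewrite -ev; rw e.
Qed.

Section Pullbacks.
Variables (X Y Z P : C) (f : Hom X Z) (g : Hom Y Z) (p1 : Hom P X) (p2 : Hom P Y).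

Lemma ispb_comm : IsPullback f g p1 p2 -> f ∘ p1 = g ∘ p2.
Proof. by case. Qed.

Lemma ispb_lift (pb : IsPullback f g p1 p2) (T : C) (a : Hom T X) (b : Hom T Y) :
  f ∘ a = g ∘ b -> exists u, p1 ∘ u = a /\ p2 ∘ u = b.
Proof. by case: pb => _ h /h [u [e _]]; exists u. Qed.

Lemma ispb_ext (pb : IsPullback f g p1 p2) (T : C) (u v : Hom T P) :
  p1 ∘ u = p1 ∘ v -> p2 ∘ u = p2 ∘ v -> u = v.
Proof.
case: pb => c h e1 e2.
have [|w [_ uw]] := h T (p1 ∘ u) (p2 ∘ u); first by rw c.
by rewrite -(uw u) // (uw v).
Qed.

Lemma ispb_intro : f ∘ p1 = g ∘ p2 ->
  (forall (T : C) (u v : Hom T P), p1 ∘ u = p1 ∘ v -> p2 ∘ u = p2 ∘ v -> u = v) ->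
  (forall (T : C) (a : Hom T X) (b : Hom T Y), f ∘ a = g ∘ b ->
     exists u, p1 ∘ u = a /\ p2 ∘ u = b) ->
  IsPullback f g p1 p2.
Proof.
move=> c ext lift; split=> // T a b /lift [u [e1 e2]]; exists u; split=> //.
by move=> v [e1' e2']; apply: ext; rewrite ?e1 ?e2.
Qed.

End Pullbacks.

Lemma ispb_sym (X Y Z P : C) (f : Hom X Z) (g : Hom Y Z) (p1 : Hom P X) (p2 : Hom P Y) :
  IsPullback f g p1 p2 -> IsPullback g f p2 p1.
Proof.
move=> pb; apply: ispb_intro; first by rewrite (ispb_comm pb).
- by move=> T u v e1 e2; apply: (ispb_ext pb).
- by move=> T a b e; have [u [e1 e2]] := ispb_lift pb (eq_sym e); exists u.
Qed.


Lemma ispb_mono (X Y Z P : C) (f : Hom X Z) (g : Hom Y Z) (p1 : Hom P X) (p2 : Hom P Y) :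
  IsPullback f g p1 p2 -> IsMono f -> IsMono p2.
Proof.
move=> pb mf T a b e; apply: (ispb_ext pb) => //.
by apply: mf; rw (ispb_comm pb), e.
Qed.

Lemma ispb_iso (X Y Z P Q : C) (f : Hom X Z) (g : Hom Y Z) (p1 : Hom P X) (p2 : Hom P Y)
    (i : Hom Q P) :
  IsPullback f g p1 p2 -> IsIso i -> IsPullback f g (p1 ∘ i) (p2 ∘ i).
Proof.
move=> pb [i' [i1 i2]]; apply: ispb_intro.
- by rw (ispb_comm pb).
- move=> T u v; rewrite -!comp_assoc => e1 e2.
  apply: (iso_mono (f := i)); first by exists i'.
  exact: (ispb_ext pb).
- move=> T a b e; have [u [e1 e2]] := ispb_lift pb e.
  by exists (i' ∘ u); split; rw i2.
Qed.

Lemma ispb_iso_corner (X X' Y Z P : C) (f : Hom X Z) (g : Hom Y Z) (p1 : Hom P X)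
    (p2 : Hom P Y) (i : Hom X X') (i' : Hom X' X) :
  IsPullback f g p1 p2 -> i' ∘ i = idm X -> i ∘ i' = idm X' ->
  IsPullback (f ∘ i') g (i ∘ p1) p2.
Proof.
move=> pb e1 e2; apply: ispb_intro.
- by rw e1, (ispb_comm pb).
- move=> T u v; rewrite -!comp_assoc => eu; apply: (ispb_ext pb).
  by apply: (iso_mono (f := i)) => //; exists i'.
- move=> T a b; rewrite -comp_assoc => e.
  have [u [u1 u2]] := ispb_lift pb e.
  by exists u; split=> //; rw u1, e2.
Qed.

Lemma ispb_unique (X Y Z P Q : C) (f : Hom X Z) (g : Hom Y Z)
    (p1 : Hom P X) (p2 : Hom P Y) (q1 : Hom Q X) (q2 : Hom Q Y) :
  IsPullback f g p1 p2 -> IsPullback f g q1 q2 ->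
  exists i : Hom Q P, IsIso i /\ p1 ∘ i = q1 /\ p2 ∘ i = q2.
Proof.
move=> pb qb.
have [i [i1 i2]] := ispb_lift pb (ispb_comm qb).
have [k [k1 k2]] := ispb_lift qb (ispb_comm pb).
exists i; split=> //; exists k; split.
- by apply: (ispb_ext qb); [rw k1, i1 | rw k2, i2].
- by apply: (ispb_ext pb); [rw i1, k1 | rw i2, k2].
Qed.

Lemma ispb_of_pullback (X Y Z : C) (f : Hom X Z) (g : Hom Y Z) (P : Pullback f g) :
  IsPullback f g (pb1 P) (pb2 P).
Proof.
apply: ispb_intro; first exact: pb_comm.
- by move=> T u v; apply: pb_ext.
- by move=> T a b e; exists (pb_lift P e); rewrite pb_lift1 pb_lift2.
Qed.

Lemma ispb_cancel (X Y Z U P Q : C) (f : Hom X Z) (g : Hom Y Z) (p1 : Hom P X) (p2 : Hom P Y)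
    (u : Hom U X) (q1 : Hom Q U) (q2 : Hom Q P) :
  IsPullback f g p1 p2 -> u ∘ q1 = p1 ∘ q2 -> IsPullback (f ∘ u) g q1 (p2 ∘ q2) ->
  IsPullback u p1 q1 q2.
Proof.
move=> pb c qb; apply: ispb_intro => //.
- by move=> T a b e1 e2; apply: (ispb_ext qb) => //; rw e2.
- move=> T a b e.
  have [|v [v1 v2]] := ispb_lift qb (a := a) (b := p2 ∘ b).
    by rw e, (ispb_comm pb).
  exists v; split=> //; apply: (ispb_ext pb); last by rewrite comp_assoc.
  by rw (eq_sym c), v1, e.
Qed.

End General.

Lemma zeroE (C : SemiAbelian) (X Y : C) : zero X Y = zero_initial Y ∘ zero_terminal X.
Proof. by []. Qed.

(* Otherwise associativity also rewrites inside zero morphisms. *)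
Opaque zero.

(** * Regular epimorphisms, images, products and equalizers *)

Section Regular.
Context {C : SemiAbelian}.

Definition StrongEpi {X Y : C} (f : Hom X Y) : Prop :=
  forall (M : C) (m : Hom M Y) (f' : Hom X M), IsMono m -> m ∘ f' = f -> IsIso m.

Lemma regepi_strong (X Y : C) (f : Hom X Y) : IsRegularEpi f -> StrongEpi f.
Proof.
move=> rf M m f' mm e.
have [|w [w1 _]] := regepi_lift (x := f') (y := idm Y) rf mm; first by rw e.
exact: mono_retraction_iso w1.
Qed.

Lemma regepi_pullback_sym (X Y Z P : C) (f : Hom X Z) (g : Hom Y Z)
    (p1 : Hom P X) (p2 : Hom P Y) :
  IsPullback f g p1 p2 -> IsRegularEpi g -> IsRegularEpi p1.
Proof. by move=> /ispb_sym; apply: regular_epi_stable. Qed.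

Lemma pullback_exists (X Y Z : C) (f : Hom X Z) (g : Hom Y Z) :
  exists (P : C) (p1 : Hom P X) (p2 : Hom P Y), IsPullback f g p1 p2.
Proof. by do 3 eexists; exact: (ispb_of_pullback (pullback f g)). Qed.

(** Stands in for the choice of preimages: the elements of an image or of a quotient
    are reached from the domain on a cover. *)
Lemma regepi_cover (X Y T : C) (f : Hom X Y) (b : Hom T Y) : IsRegularEpi f ->
  exists (S : C) (t : Hom S T) (x : Hom S X), IsRegularEpi t /\ f ∘ x = b ∘ t.
Proof.
move=> rf; have pb := ispb_of_pullback (pullback f b).
exists (pullback f b), (pb2 (pullback f b)), (pb1 (pullback f b)); split.
- exact: (regular_epi_stable pb).
- exact: pb_comm.
Qed.

(** Two elements with the same image under m lift, on a cover, to a pair in the kernel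
    pair of f, and are therefore equal. *)
Lemma kernel_pair_quotient (X Y R : C) (f : Hom X Y) (r1 r2 : Hom R X) :
  IsPullback f f r1 r2 ->
  exists (Q : C) (q : Hom X Q) (m : Hom Q Y),
    IsCoequalizer r1 r2 q /\ m ∘ q = f /\ IsMono m.
Proof.
move=> pb; have [Q [q cq]] := kernel_pair_coequalizer pb.
case: (cq) => eq uq; have [m [em _]] := uq _ f (ispb_comm pb).
have rq : IsRegularEpi q by exists R, r1, r2.
exists Q, q, m; split=> //; split=> // T a b e.
have [S [s [x [rs ex]]]] := regepi_cover a rq.
have [S' [s' [y [rs' ey]]]] := regepi_cover (b ∘ s) rq.
have [|u [u1 u2]] := ispb_lift pb (a := x ∘ s') (b := y).
  by rewrite -em; rw ex, e, ey.
apply: (regepi_epi rs); apply: (regepi_epi rs').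
by rewrite -ex -ey -u2 -comp_assoc -u1; rw eq.
Qed.

Lemma image_factorization (X Y : C) (f : Hom X Y) :
  exists (I : C) (q : Hom X I) (m : Hom I Y), IsRegularEpi q /\ IsMono m /\ m ∘ q = f.
Proof.
have [Q [q [m [cq [e mm]]]]] := kernel_pair_quotient (ispb_of_pullback (pullback f f)).
exists Q, q, m; split=> //.
by do 3 eexists; exact: cq.
Qed.

Lemma strong_regepi (X Y : C) (f : Hom X Y) : StrongEpi f -> IsRegularEpi f.
Proof.
move=> sf; have [I [q [m [rq [mm e]]]]] := image_factorization f.
by rewrite -e; apply: regepi_iso_left rq (sf _ _ _ mm e).
Qed.

Lemma regepi_coequalizes_kernel_pair (X Y R : C) (f : Hom X Y) (r1 r2 : Hom R X) :
  IsRegularEpi f -> IsPullback f f r1 r2 -> IsCoequalizer r1 r2 f.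
Proof.
move=> rf pb; case: (rf) => [S [a [b [e u]]]]; split; first exact: ispb_comm pb.
move=> T t et; have [w [w1 w2]] := ispb_lift pb e.
by apply: u; rewrite -w1 -w2 !comp_assoc et.
Qed.

Lemma regepi_comp (X Y Z : C) (g : Hom Y Z) (f : Hom X Y) :
  IsRegularEpi g -> IsRegularEpi f -> IsRegularEpi (g ∘ f).
Proof.
move=> rg rf; apply: strong_regepi => M m h mm e.
have [w [w1 w2]] := regepi_lift rf mm e.
exact: (regepi_strong rg mm w1).
Qed.

Lemma regepi_cancel (X Y Z : C) (g : Hom Y Z) (f : Hom X Y) :
  IsRegularEpi (g ∘ f) -> IsRegularEpi g.
Proof.
move=> r; apply: strong_regepi => M m h mm e.
by apply: (regepi_strong r mm (f' := h ∘ f)); rw e.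
Qed.

Lemma pair_subproof (X Y T : C) (a : Hom T X) (b : Hom T Y) :
  zero_terminal X ∘ a = zero_terminal Y ∘ b.
Proof. exact: zero_terminal_unique. Qed.

Definition prod (X Y : C) : C := pullback (zero_terminal X) (zero_terminal Y).
Definition fst {X Y : C} : Hom (prod X Y) X := pb1 _.
Definition snd {X Y : C} : Hom (prod X Y) Y := pb2 _.
Definition pair {X Y T : C} (a : Hom T X) (b : Hom T Y) : Hom T (prod X Y) :=
  pb_lift _ (pair_subproof a b).

Lemma fst_pair (X Y T : C) (a : Hom T X) (b : Hom T Y) : fst ∘ pair a b = a.
Proof. exact: pb_lift1. Qed.

Lemma snd_pair (X Y T : C) (a : Hom T X) (b : Hom T Y) : snd ∘ pair a b = b.
Proof. exact: pb_lift2. Qed.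

Lemma prod_ext (X Y T : C) (u v : Hom T (prod X Y)) :
  fst ∘ u = fst ∘ v -> snd ∘ u = snd ∘ v -> u = v.
Proof. exact: pb_ext. Qed.

Lemma pair_comp (X Y T S : C) (a : Hom T X) (b : Hom T Y) (x : Hom S T) :
  pair a b ∘ x = pair (a ∘ x) (b ∘ x).
Proof. by apply: prod_ext; rewrite comp_assoc ?fst_pair ?snd_pair. Qed.

Lemma pair_inj (X Y T : C) (a a' : Hom T X) (b b' : Hom T Y) :
  pair a b = pair a' b' -> a = a' /\ b = b'.
Proof.
by move=> e; rewrite -(fst_pair a b) -{2}(snd_pair a b) e fst_pair snd_pair.
Qed.

Lemma equalizer_exists (X Y : C) (u v : Hom X Y) :
  exists (E : C) (m : Hom E X), IsMono m /\ u ∘ m = v ∘ m /\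
    forall (T : C) (t : Hom T X), u ∘ t = v ∘ t -> exists w, m ∘ w = t.
Proof.
have [E [m [n pb]]] := pullback_exists (pair u v) (pair (idm Y) (idm Y)).
have c := ispb_comm pb.
have c1 : u ∘ m = n by rewrite -(fst_pair u v); rw c, (fst_pair (idm Y) (idm Y)).
have c2 : v ∘ m = n by rewrite -(snd_pair u v); rw c, (snd_pair (idm Y) (idm Y)).
exists E, m; split; [|split].
- move=> T a b e; apply: (ispb_ext pb) => //; rewrite -c1.
  by rw e.
- by rewrite c1.
- move=> T t e.
  have [|w [w1 _]] := ispb_lift pb (a := t) (b := u ∘ t); last by exists w.
  apply: prod_ext; first by rw (fst_pair u v), (fst_pair (idm Y) (idm Y)).
  by rw (snd_pair u v), (snd_pair (idm Y) (idm Y)).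
Qed.

Lemma jointly_extremal_epi (X Y Z T : C) (f : Hom X Z) (g : Hom Y Z) (u v : Hom Z T) :
  JointlyExtremalEpi f g -> u ∘ f = v ∘ f -> u ∘ g = v ∘ g -> u = v.
Proof.
move=> ex ef eg; have [E [m [mm [e lift]]]] := equalizer_exists u v.
have [f' e1] := lift _ _ ef; have [g' e2] := lift _ _ eg.
exact: (iso_epi (ex _ _ _ _ mm e1 e2) e).
Qed.

Lemma jointly_extremal_copair (X Y Z : C) (f : Hom X Z) (g : Hom Y Z) :
  JointlyExtremalEpi f g -> IsRegularEpi (copair f g).
Proof.
move=> ex; apply: strong_regepi => M m h mm e.
by apply: (ex _ m (h ∘ inl) (h ∘ inr)) => //; rw e; rewrite ?copair_inl ?copair_inr.
Qed.

End Regular.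

#[global] Hint Rewrite @comp_idl @comp_idr @zero_comp @comp_zero @fst_pair @snd_pair
  @pair_comp @copair_inl @copair_inr @comp_copair : cat.
#[global] Hint Rewrite <- @comp_assoc : cat.
#[global] Hint Rewrite (fun C X Y T a b => reassoc2 (@copair_inl C X Y T a b))
  (fun C X Y T U h a b => reassoc2 (@comp_copair C X Y T U h a b))
  (fun C X Y T a b => reassoc2 (@copair_inr C X Y T a b)) 
  (fun C X Y T a b => reassoc2 (@fst_pair C X Y T a b)) 
  (fun C X Y T a b => reassoc2 (@snd_pair C X Y T a b)) : cat.


(** * Kernels and protomodularity *)

Section Protomodular.
Context {C : SemiAbelian}.

(** IsKernel freed of the choice of an initial object. *)
Definition IsKer {X Y K : C} (f : Hom X Y) (k : Hom K X) : Prop :=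
  f ∘ k = zero K Y /\ IsMono k /\
  forall (T : C) (t : Hom T X), f ∘ t = zero T Y -> exists u, k ∘ u = t.

Lemma iskernel_isker (X Y K : C) (f : Hom X Y) (k : Hom K X) :
  IsKernel f k <-> IsKer f k.
Proof.
split.
- move=> [I [i [t [hI pb]]]].
  have uniqI T (a b : Hom I T) : a = b.
    by have [w [_ h]] := hI T; rewrite -(h a) // (h b).
  have zt T (a b : Hom T I) : a = b.
    rewrite -(comp_idl a) -(comp_idl b).
    have -> : idm I = zero I I by apply: uniqI.
    by rewrite !zero_comp.
  have ei : i = zero I Y by apply: uniqI.
  split; [|split].
  + by rewrite (ispb_comm pb) ei zero_comp.
  + by move=> T a b e; apply: (ispb_ext pb) => //; apply: zt.
  + move=> T x e; have [|u [u1 _]] := ispb_lift pb (a := x) (b := zero T I).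
      by rewrite comp_zero.
    by exists u.
- move=> [e [mk lift]]; exists (zero_ob C), (zero_initial Y), (zero_terminal K); split.
  + move=> T; exists (zero_initial T); split=> // *; exact: zero_initial_unique.
  + apply: ispb_intro => //.
    * by move=> T u v e1 _; apply: mk.
    * move=> T a b e1; have [|u e2] := lift _ a.
        rewrite e1 zeroE; f_equal; exact: zero_terminal_unique.
      by exists u; split=> //; apply: zero_terminal_unique.
Qed.

Lemma isker_ker (X Y : C) (f : Hom X Y) : IsKer f (ker_in f).
Proof.
split; first exact: ker_in_zero.
split; first exact: ker_in_mono.
by move=> T t e; exists (ker_lift e); apply: ker_in_lift.
Qed.

Lemma isker_mono (X Y K : C) (f : Hom X Y) (k : Hom K X) : IsKer f k -> IsMono k.
Proof. by case=> _ []. Qed.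

Lemma isker_zero (X Y K : C) (f : Hom X Y) (k : Hom K X) : IsKer f k -> f ∘ k = zero K Y.
Proof. by case. Qed.

Lemma isker_lift (X Y K T : C) (f : Hom X Y) (k : Hom K X) (t : Hom T X) :
  IsKer f k -> f ∘ t = zero T Y -> exists u, k ∘ u = t.
Proof. by case=> _ [_]; apply. Qed.

Lemma isker_pullback (X Y Z P K : C) (f : Hom X Z) (g : Hom Y Z)
    (p1 : Hom P X) (p2 : Hom P Y) (k : Hom K P) :
  IsPullback f g p1 p2 -> IsKer p2 k -> IsKer f (p1 ∘ k).
Proof.
move=> pb hk; split; [|split].
- by rw (ispb_comm pb), (isker_zero hk); rewrite comp_zero.
- move=> T a b; rewrite -!comp_assoc => e; apply: (isker_mono hk).
  by apply: (ispb_ext pb) => //; rw (isker_zero hk); rewrite !zero_comp.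
- move=> T t e; have [|u [u1 u2]] := ispb_lift pb (a := t) (b := zero T Y).
    by rewrite comp_zero.
  have [v ev] := isker_lift hk u2.
  by exists v; rw ev.
Qed.

Lemma isker_pullback_inv (X Y Z P K : C) (f : Hom X Z) (g : Hom Y Z)
    (p1 : Hom P X) (p2 : Hom P Y) (k : Hom K P) :
  IsPullback f g p1 p2 -> IsKer f (p1 ∘ k) -> p2 ∘ k = zero K Y -> IsKer p2 k.
Proof.
move=> pb hk e2; split=> //; split; first exact: (mono_cancel (isker_mono hk)).
move=> T t e; have [|v ev] := isker_lift (t := p1 ∘ t) hk.
  by rw (ispb_comm pb), e; rewrite comp_zero.
exists v; apply: (ispb_ext pb); first by rewrite comp_assoc.
by rw e2; rewrite zero_comp.
Qed.

Lemma isker_iso (X Y K L : C) (f : Hom X Y) (k : Hom K X) (i : Hom L K) :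
  IsKer f k -> IsIso i -> IsKer f (k ∘ i).
Proof.
move=> hk [i' [i1 i2]]; split; [|split].
- by rw (isker_zero hk); rewrite zero_comp.
- by apply: mono_comp (isker_mono hk) (iso_mono _); exists i'.
- move=> T t /(isker_lift hk) [u eu]; exists (i' ∘ u).
  by rw i2, eu.
Qed.

Lemma isker_unique (X Y K L : C) (f : Hom X Y) (k : Hom K X) (l : Hom L X) :
  IsKer f k -> IsKer f l -> exists i : Hom L K, IsIso i /\ k ∘ i = l.
Proof.
move=> hk hl; have [i ei] := isker_lift hk (isker_zero hl).
have [i' ei'] := isker_lift hl (isker_zero hk).
exists i; split=> //; exists i'; split.
- by apply: (isker_mono hl); rw ei', ei.
- by apply: (isker_mono hk); rw ei, ei'.
Qed.

(** The restriction of t to the kernels is the pullback of t along l. *)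
Lemma isker_cover (X Y Z K L : C) (t : Hom X Y) (w : Hom Y Z) (k : Hom K X) (l : Hom L Y) :
  IsRegularEpi t -> IsKer (w ∘ t) k -> IsKer w l ->
  exists e : Hom K L, IsRegularEpi e /\ l ∘ e = t ∘ k.
Proof.
move=> rt hk hl; have [|e ee] := isker_lift (t := t ∘ k) hl.
  by rewrite comp_assoc (isker_zero hk).
exists e; split=> //; apply: (regular_epi_stable (f := t) (g := l) (p1 := k)) rt.
apply: ispb_intro => //.
- by move=> T u v eu _; apply: (isker_mono hk).
- move=> T a b eab; have [|u eu] := isker_lift (t := a) hk.
    by rw eab, (isker_zero hl); rewrite zero_comp.
  exists u; split=> //; apply: (isker_mono hl).
  by rw ee, eu, eab.
Qed.

(** A subobject containing the section and the pullback of E has the same pullback along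
    u as E itself, so that protomodularity makes it all of E. *)
Lemma point_jointly_extremal (A B E P : C) (u : Hom A B) (p : Hom E B) (s : Hom B E)
    (a : Hom P A) (b : Hom P E) :
  p ∘ s = idm B -> IsPullback u p a b -> JointlyExtremalEpi s b.
Proof.
move=> ps pb M m s' b' mm es eb.
have qb : IsPullback u (p ∘ m) a b'.
  apply: ispb_intro.
  - by rw eb, (ispb_comm pb).
  - by move=> T x y e1 e2; apply: (ispb_ext pb) => //; rewrite -eb; rw e2.
  - move=> T x y e; have [|v [v1 v2]] := ispb_lift pb (a := x) (b := m ∘ y).
      by rw e.
    by exists v; split=> //; apply: mm; rw eb, v2.
apply: (@protomodular C A B u M (p ∘ m) s' E p s m P a b' P a b (idm P)); rewrite ?comp_idr //;
  last exact: iso_id.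
by rw es, ps.
Qed.

Lemma isker_ispb (X Y K : C) (f : Hom X Y) (k : Hom K X) :
  IsKer f k -> IsPullback (zero_initial Y) f (zero_terminal K) k.
Proof.
move=> [e [mk lift]]; apply: ispb_intro => //.
- by move=> T u v _; apply: mk.
- move=> T a b e1; have [|u e2] := lift _ b.
    rewrite -e1 zeroE; f_equal; exact: zero_terminal_unique.
  by exists u; split=> //; apply: zero_terminal_unique.
Qed.

Lemma ker_jointly_extremal (B E K : C) (p : Hom E B) (s : Hom B E) (j : Hom K E) :
  p ∘ s = idm B -> IsKer p j -> JointlyExtremalEpi s j.
Proof. by move=> ps /isker_ispb; apply: point_jointly_extremal. Qed.

Lemma point_ext (B E K T : C) (p : Hom E B) (s : Hom B E) (j : Hom K E) (u v : Hom E T) :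
  p ∘ s = idm B -> IsKer p j -> u ∘ s = v ∘ s -> u ∘ j = v ∘ j -> u = v.
Proof. by move=> ps hj; apply: jointly_extremal_epi; apply: ker_jointly_extremal hj. Qed.

Lemma split_short_five (B E E' K : C) (p : Hom E B) (s : Hom B E) (j : Hom K E)
    (p' : Hom E' B) (s' : Hom B E') (j' : Hom K E') (h : Hom E E') :
  p ∘ s = idm B -> IsKer p j -> p' ∘ s' = idm B -> IsKer p' j' ->
  p' ∘ h = p -> h ∘ s = s' -> h ∘ j = j' -> IsIso h.
Proof.
move=> ps kj ps' kj' e1 e2 e3.
apply: (@protomodular C _ _ (zero_initial B) E p s E' p' s' h
  K (zero_terminal K) j K (zero_terminal K) j' (idm K)); rewrite ?comp_idr //; try exact: isker_ispb.
exact: iso_id.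
Qed.

(** A morphism of points that is an isomorphism on kernels compares E with the pullback
    of E', as points over B with the same kernel. *)
Lemma point_pullback (B B' E E' K : C) (b : Hom B B') (h : Hom E E')
    (p : Hom E B) (s : Hom B E) (j : Hom K E)
    (p' : Hom E' B') (s' : Hom B' E') :
  p ∘ s = idm B -> IsKer p j -> p' ∘ s' = idm B' -> IsKer p' (h ∘ j) ->
  p' ∘ h = b ∘ p -> h ∘ s = s' ∘ b -> IsPullback p' b h p.
Proof.
move=> ps kj ps' kj' e1 e2.
have pb := ispb_of_pullback (pullback p' b).
have [c [c1 c2]] := ispb_lift pb e1.
have [|t [t1 t2]] := ispb_lift pb (a := s' ∘ b) (b := idm B); first by rw ps'.
suff ic : IsIso c by have := ispb_iso pb ic; rewrite c1 c2.
apply: (split_short_five (p := p) (s := s) (j := j) (p' := pb2 (pullback p' b)) (s' := t)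
  (j' := c ∘ j)) => //.
- apply: (isker_pullback_inv pb); first by rw c1.
  by rw c2, (isker_zero kj).
- by apply: (ispb_ext pb); [rw c1, t1, e2 | rw c2, t2, ps].
Qed.

(** The kernel pair of f is a point over X, with section the diagonal and the same kernel
    as f; two morphisms out of it agree when they agree on these two. *)
Lemma regepi_cokernel (X Y K T : C) (f : Hom X Y) (k : Hom K X) (t : Hom X T) :
  IsRegularEpi f -> IsKer f k -> t ∘ k = zero K T -> exists w, w ∘ f = t.
Proof.
move=> rf hk e; have [R [r1 [r2 pb]]] := pullback_exists f f.
have [d [d1 d2]] := ispb_lift pb (a := idm X) (b := idm X) eq_refl.
have [|l [l1 l2]] := ispb_lift pb (a := zero K X) (b := k).
  by rewrite comp_zero (isker_zero hk).
have hl : IsKer r1 l.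
  by apply: (isker_pullback_inv (ispb_sym pb)); rewrite ?l2.
have [_ /(_ T t)] := regepi_coequalizes_kernel_pair rf pb.
case; last by move=> w [ew _]; exists w.
apply: (point_ext d1 hl); first by rw d1, d2.
by rw l1, l2; rewrite comp_zero e.
Qed.

(** The projection q is a point with section a, and b is the pullback of s along q. *)
Lemma points_product_extremal (B E E' P : C) (p : Hom E B) (s : Hom B E)
    (p' : Hom E' B) (s' : Hom B E') (q : Hom P E) (q' : Hom P E')
    (a : Hom E P) (b : Hom E' P) :
  p ∘ s = idm B -> p' ∘ s' = idm B -> IsPullback p p' q q' ->
  q ∘ a = idm E -> q' ∘ a = s' ∘ p -> q ∘ b = s ∘ p' -> q' ∘ b = idm E' ->
  JointlyExtremalEpi a b.
Proof.
move=> ps ps' pb a1 a2 b1 b2.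
apply: (point_jointly_extremal (u := s) (p := q) (a := p')) => //.
apply: ispb_intro.
- by rewrite b1.
- by move=> T u v _ /(f_equal (fun x => q' ∘ x)); rw b2.
- move=> T x y e; exists (q' ∘ y).
  have ex : p' ∘ (q' ∘ y) = x by rw (eq_sym (ispb_comm pb)), (eq_sym e), ps.
  split=> //; apply: (ispb_ext pb); last by rw b2.
  by rw b1, ex, e.
Qed.

End Protomodular.

(** * The Mal'tsev property and colimits *)

Section Maltsev.
Context {C : SemiAbelian}.

(** Reflexive relations are difunctional: the quadruples (a, b, c, d) with aRb, cRb, cRd
    form a pullback of points over the pairs cRb, the sections of which (d = b and
    a = c) satisfy aRd. *)
Lemma reflexive_relation_difunctional (X R : C) (r1 r2 : Hom R X) (s : Hom X R) :
  (forall (T : C) (a b : Hom T R), r1 ∘ a = r1 ∘ b -> r2 ∘ a = r2 ∘ b -> a = b) ->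
  forall (T : C) (x y z : Hom T R), r2 ∘ x = r2 ∘ y -> r1 ∘ y = r1 ∘ z ->
  exists w, r1 ∘ w = r1 ∘ x /\ r2 ∘ w = r2 ∘ z.
Proof.
move=> mono T x y z exy eyz.
have [P [p1 [p2 pb]]] := pullback_exists r2 r2.
have [Q [q1 [q2 qb]]] := pullback_exists r1 r1.
have [D [d1 [d2 db]]] := pullback_exists p2 q1.
have [dp [dp1 dp2]] := ispb_lift pb (a := idm R) (b := idm R) eq_refl.
have [dq [dq1 dq2]] := ispb_lift qb (a := idm R) (b := idm R) eq_refl.
have [|sp [sp1 sp2]] := ispb_lift db (a := idm P) (b := dq ∘ p2).
  by rw dq1.
have [|sq [sq1 sq2]] := ispb_lift db (a := dp ∘ q1) (b := idm Q).
  by rw dp2.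
have ex := points_product_extremal dp2 dq1 db sp1 sp2 sq1 sq2.
have [E [e1 [e2 eb]]] := pullback_exists (pair r1 r2) (pair (r1 ∘ (p1 ∘ d1)) (r2 ∘ (q2 ∘ d2))).
have me2 : IsMono e2.
  apply: (ispb_mono eb) => S a b e; apply: mono.
  - by rewrite -(fst_pair r1 r2) -!comp_assoc e.
  - by rewrite -(snd_pair r1 r2) -!comp_assoc e.
have [|u [_ u2]] := ispb_lift eb (a := p1) (b := sp).
  autorewrite with cat; f_equal; first by rw sp1.
  by rw sp2, dq2, (ispb_comm pb).
have [|v [_ v2]] := ispb_lift eb (a := q2) (b := sq).
  autorewrite with cat; f_equal; last by rw sq2.
  by rw sq1, dp1, (ispb_comm qb).
have [i [_ ei]] := ex _ _ _ _ me2 u2 v2.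
have [p [pp1 pp2]] := ispb_lift pb exy.
have [q [qq1 qq2]] := ispb_lift qb eyz.
have [|t [t1 t2]] := ispb_lift db (a := p) (b := q); first by rewrite pp2.
exists (e1 ∘ (i ∘ t)).
have := f_equal (fun h => h ∘ (i ∘ t)) (ispb_comm eb).
autorewrite with cat => /pair_inj [-> ->].
by split; [rw ei, t1, pp1 | rw ei, t2, qq2].
Qed.

Lemma reflexive_relation_equivalence (X R : C) (r1 r2 : Hom R X) (s : Hom X R) :
  (forall (T : C) (a b : Hom T R), r1 ∘ a = r1 ∘ b -> r2 ∘ a = r2 ∘ b -> a = b) ->
  r1 ∘ s = idm X -> r2 ∘ s = idm X -> IsEquivalenceRelation r1 r2.
Proof.
move=> mono s1 s2; split=> //; first by exists s.
- have [||w [w1 w2]] := reflexive_relation_difunctional s mono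
    (x := s ∘ r2) (y := idm R) (z := s ∘ r1); [by rw s2 | by rw s1 |].
  by exists w; rewrite w1 w2 !comp_assoc s1 s2 !comp_idl.
- move=> T a b e.
  have [||w [w1 w2]] := reflexive_relation_difunctional s mono
    (x := a) (y := s ∘ (r1 ∘ b)) (z := b); [by rw s2 | by rw s1 |].
  by exists w.
Qed.

(** The image of (a, b) in X × X is a reflexive relation, hence an effective equivalence
    relation; a pair of elements identified by q lies in it, and comes from S on a cover. *)
Lemma reflexive_coequalizer (X S : C) (a b : Hom S X) (s : Hom X S) :
  a ∘ s = idm X -> b ∘ s = idm X ->
  exists (Q : C) (q : Hom X Q), IsCoequalizer a b q /\
    forall (T : C) (x y : Hom T X), q ∘ x = q ∘ y ->
      exists (T' : C) (t : Hom T' T) (w : Hom T' S),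
        IsRegularEpi t /\ a ∘ w = x ∘ t /\ b ∘ w = y ∘ t.
Proof.
move=> sa sb; have [R [e [m [re [mm em]]]]] := image_factorization (pair a b).
have ea : (fst ∘ m) ∘ e = a by rewrite -comp_assoc em fst_pair.
have eb : (snd ∘ m) ∘ e = b by rewrite -comp_assoc em snd_pair.
have eq : IsEquivalenceRelation (fst ∘ m) (snd ∘ m).
  apply: (reflexive_relation_equivalence (s := e ∘ s)).
  - by move=> T x y; rewrite -!comp_assoc => e1 e2; apply: mm; apply: prod_ext.
  - by rewrite comp_assoc ea.
  - by rewrite comp_assoc eb.
have [Q' [q' pb]] := equivalence_relation_effective eq.
have [Q [q [n [cq [en mn]]]]] := kernel_pair_quotient pb.
exists Q, q; split.
- split; first by rewrite -ea -eb; rw (proj1 cq).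
  move=> T t et; apply: (proj2 cq); apply: (regepi_epi re).
  by rw ea, eb.
- move=> T x y exy.
  have [|u [u1 u2]] := ispb_lift pb (a := x) (b := y); first by rewrite -en; rw exy.
  have [T' [t [w [rt ew]]]] := regepi_cover u re.
  by exists T', t, w; split=> //; rewrite -u1 -u2 -ea -eb; split; rw ew.
Qed.

(** The pair becomes reflexive once a copy of X is added to its domain. *)
Lemma coequalizer_exists (X S : C) (a b : Hom S X) :
  exists (Q : C) (q : Hom X Q), IsCoequalizer a b q.
Proof.
have [||Q [q [[e u] _]]] := reflexive_coequalizer
  (a := copair (idm X) a) (b := copair (idm X) b) (s := inl).
- exact: copair_inl.
- exact: copair_inl.
exists Q, q; split.
- by have := f_equal (fun h => h ∘ inr) e; autorewrite with cat.
- by move=> T t et; apply: u; autorewrite with cat; rewrite et.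
Qed.

Lemma coequalizer_regepi (X S Q : C) (a b : Hom S X) (q : Hom X Q) :
  IsCoequalizer a b q -> IsRegularEpi q.
Proof. by exists S, a, b. Qed.

Lemma pushout_exists (S X Y : C) (a : Hom S X) (b : Hom S Y) :
  exists (Q : C) (q1 : Hom X Q) (q2 : Hom Y Q), IsPushout a b q1 q2.
Proof.
have [Q [q [e u]]] := coequalizer_exists
  (inl ∘ a : Hom S (coproduct X Y)) (inr ∘ b : Hom S (coproduct X Y)).
exists Q, (q ∘ inl), (q ∘ inr); split; first by rewrite -!comp_assoc.
move=> T s t est; have [|w [ew uw]] := u T (copair s t).
  by autorewrite with cat.
exists w; split.
- by split; rewrite comp_assoc ew ?copair_inl ?copair_inr.
- move=> v [e1 e2]; apply: uw.
  by apply: copair_ext; autorewrite with cat.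
Qed.

(** For a morphism of points with both components regular epimorphisms, the comparison
    with the pullback is again one: the pullback is covered by the pairs (e, b') with
    p e and b' equivalent, and those are generated by the pairs (e, p e) and (s b, b'). *)
Lemma point_regepi_comparison (B B' E E' P : C) (b : Hom B B') (h : Hom E E')
    (p : Hom E B) (s : Hom B E) (p' : Hom E' B') (s' : Hom B' E')
    (q : Hom P E') (q' : Hom P B) (c : Hom E P) :
  IsRegularEpi b -> IsRegularEpi h -> p ∘ s = idm B -> p' ∘ s' = idm B' ->
  p' ∘ h = b ∘ p -> h ∘ s = s' ∘ b ->
  IsPullback p' b q q' -> q ∘ c = h -> q' ∘ c = p -> IsRegularEpi c.
Proof.
move=> rb rh ps ps' ep es pb qc q'c.
have [R [r1 [r2 rp]]] := pullback_exists b b.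
have [d [d1 d2]] := ispb_lift rp (a := idm B) (b := idm B) eq_refl.
have [D [d_E [d_R db]]] := pullback_exists p r1.
have [|u [u1 u2]] := ispb_lift db (a := idm E) (b := d ∘ p); first by rw d1.
have [|v [v1 v2]] := ispb_lift db (a := s ∘ r1) (b := idm R); first by rw ps.
have ex := points_product_extremal ps d1 db u1 u2 v1 v2.
have [|t [t1 t2]] := ispb_lift pb (a := h ∘ d_E) (b := r2 ∘ d_R).
  by rw ep, (ispb_comm db), (ispb_comm rp).
have rt : IsRegularEpi t.
  apply: (regepi_pullback_sym (f := q) (g := h) (p2 := d_E)) => //.
  apply: ispb_intro => //.
  - move=> T x y e1 e2; apply: (ispb_ext db) => //; apply: (ispb_ext rp).
    + by rw (eq_sym (ispb_comm db)), e2.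
    + by rw (eq_sym t2), e1.
  - move=> T x y exy.
    have [|z [z1 z2]] := ispb_lift rp (a := p ∘ y) (b := q' ∘ x).
      by rw (eq_sym (ispb_comm pb)), exy, ep.
    have [|w [w1 w2]] := ispb_lift db (a := y) (b := z); first by rewrite z1.
    exists w; split=> //; apply: (ispb_ext pb).
    + by rw t1, w1, exy.
    + by rw t2, w2, z2.
apply: strong_regepi => M m f' mm em.
have [F [f1 [f2 fb]]] := pullback_exists t m.
have [|x [x1 _]] := ispb_lift fb (a := u) (b := f').
  rewrite em; apply: (ispb_ext pb); first by rw t1, u1, qc.
  by rw t2, u2, d2, q'c.
have [|y [y1 _]] := ispb_lift fb (a := v) (b := f' ∘ (s ∘ r2)).
  rw em; apply: (ispb_ext pb); first by rw t1, v1, qc, es, (ispb_comm rp).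
  by rw t2, v2, q'c, ps.
have [i [_ ei]] := ex _ _ _ _ (ispb_mono (ispb_sym fb) mm) x1 y1.
apply: (regepi_strong rt mm (f' := f2 ∘ i)).
by rw (eq_sym (ispb_comm fb)), ei.
Qed.

Lemma point_regepi_kernels (B B' E E' K K' : C) (b : Hom B B') (h : Hom E E')
    (p : Hom E B) (s : Hom B E) (p' : Hom E' B') (s' : Hom B' E')
    (k : Hom K E) (k' : Hom K' E') (l : Hom K K') :
  IsRegularEpi b -> IsRegularEpi h -> p ∘ s = idm B -> p' ∘ s' = idm B' ->
  p' ∘ h = b ∘ p -> h ∘ s = s' ∘ b ->
  IsKer p k -> IsKer p' k' -> k' ∘ l = h ∘ k -> IsRegularEpi l.
Proof.
move=> rb rh ps ps' ep es hk hk' el.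
have [P [q [q' pb]]] := pullback_exists p' b.
have [c [c1 c2]] := ispb_lift pb ep.
have rc := point_regepi_comparison rb rh ps ps' ep es pb c1 c2.
have [|n [n1 n2]] := ispb_lift pb (a := k') (b := zero K' B).
  by rewrite (isker_zero hk') comp_zero.
apply: (regular_epi_stable (f := c) (g := n) (p1 := k)) rc.
apply: ispb_intro.
- apply: (ispb_ext pb); first by rw c1, n1, el.
  by rw c2, n2, (isker_zero hk); rewrite zero_comp.
- by move=> T x y e _; apply: (isker_mono hk).
- move=> T x y e.
  have [|z ez] := isker_lift (t := x) hk.
    by rewrite -c2; rw e, n2; rewrite zero_comp.
  exists z; split=> //; apply: (isker_mono hk').
  by rw el, ez; rewrite -n1; rw (eq_sym e), c1.
Qed.

Lemma cop_map_regepi (A B X Y : C) (u : Hom A B) (v : Hom X Y) :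
  IsRegularEpi u -> IsRegularEpi v -> IsRegularEpi (cop_map u v).
Proof.
move=> ru rv; apply: strong_regepi => M m f mm e.
have el : m ∘ (f ∘ inl) = inl ∘ u by rw e; rewrite /cop_map copair_inl.
have er : m ∘ (f ∘ inr) = inr ∘ v by rw e; rewrite /cop_map copair_inr.
have [l [l1 _]] := regepi_lift ru mm el.
have [r [r1 _]] := regepi_lift rv mm er.
apply: (mono_retraction_iso (s := copair l r)) => //.
by rewrite comp_copair l1 r1; apply: copair_ext; autorewrite with cat.
Qed.

Lemma proj_inl (B X : C) : proj B X ∘ inl = idm B.
Proof. exact: copair_inl. Qed.

Lemma isker_flat_in (B X : C) : IsKer (proj B X) (flat_in B X).
Proof. exact: isker_ker. Qed.

(** A♭X and B♭Y are the kernels of the points A + X and B + Y, compared by u + v. *)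
Lemma flat_map_regepi (A B X Y : C) (u : Hom A B) (v : Hom X Y) :
  IsRegularEpi u -> IsRegularEpi v -> IsRegularEpi (flat_map u v).
Proof.
move=> ru rv.
apply: (point_regepi_kernels (b := u) (h := cop_map u v) (p := proj A X) (s := inl)
  (p' := proj B Y) (s' := inl) (k := flat_in A X) (k' := flat_in B Y)) => //.
- exact: cop_map_regepi.
- exact: proj_inl.
- exact: proj_inl.
- by rewrite /proj /cop_map; autorewrite with cat.
- exact: copair_inl.
- exact: isker_flat_in.
- exact: isker_flat_in.
- exact: flat_in_map.
Qed.

End Maltsev.

(** * Conjugation, actions and semidirect products *)

Section Actions.
Context {C : SemiAbelian}.

(** Conjugation of k by u; when k is normal it is an action of A on K, composed with k. *)
Definition act {A K X : C} (u : Hom A X) (k : Hom K X) : Hom (flat A K) X :=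
  copair u k ∘ flat_in A K.

Lemma actE (A K X : C) (u : Hom A X) (k : Hom K X) : act u k = copair u k ∘ flat_in A K.
Proof. by []. Qed.

(* Otherwise associativity also rewrites inside conjugations. *)
Opaque act.

Lemma comp_act (A K X Y : C) (h : Hom X Y) (u : Hom A X) (k : Hom K X) :
  h ∘ act u k = act (h ∘ u) (h ∘ k).
Proof. by rewrite !actE comp_assoc comp_copair. Qed.

Lemma act_flat_map (A A' K K' X : C) (u : Hom A X) (k : Hom K X)
    (a : Hom A' A) (b : Hom K' K) :
  act u k ∘ flat_map a b = act (u ∘ a) (k ∘ b).
Proof.
by rewrite !actE -comp_assoc flat_in_map /cop_map; autorewrite with cat.
Qed.

Lemma act_zero_r (A K X : C) (u : Hom A X) : act u (zero K X) = zero _ _.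
Proof.
rewrite actE.
have -> : copair u (zero K X) = u ∘ proj A K.
  by rewrite /proj; autorewrite with cat.
by rewrite -comp_assoc proj_flat_in comp_zero.
Qed.

Lemma flat_in_unit (B X : C) : flat_in B X ∘ flat_unit B X = inr.
Proof. exact: ker_in_lift. Qed.

Lemma flat_in_mult (B X : C) : flat_in B X ∘ flat_mult B X = act inl (flat_in B X).
Proof. exact: ker_in_lift. Qed.

Lemma flat_in_mono (B X : C) : IsMono (flat_in B X).
Proof. exact: ker_in_mono. Qed.

Lemma act_unit (A K X : C) (u : Hom A X) (k : Hom K X) : act u k ∘ flat_unit A K = k.
Proof. by rewrite actE -comp_assoc flat_in_unit copair_inr. Qed.

Lemma act_mult (A K X : C) (u : Hom A X) (k : Hom K X) :
  act u k ∘ flat_mult A K = act u (act u k).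
Proof.
by rewrite {1}actE -comp_assoc flat_in_mult comp_act copair_inl actE.
Qed.

Lemma flat_map_unit (A A' K K' : C) (a : Hom A A') (b : Hom K K') :
  flat_map a b ∘ flat_unit A K = flat_unit A' K' ∘ b.
Proof.
apply: flat_in_mono; rw (flat_in_map a b), (flat_in_unit A K), (flat_in_unit A' K').
exact: copair_inr.
Qed.

Lemma flat_map_mult (A A' K K' : C) (a : Hom A A') (b : Hom K K') :
  flat_map a b ∘ flat_mult A K = flat_mult A' K' ∘ flat_map a (flat_map a b).
Proof.
apply: flat_in_mono; rw (flat_in_map a b), (flat_in_mult A K), (flat_in_mult A' K').
rewrite comp_act act_flat_map flat_in_map; congr act.
exact: copair_inl.
Qed.

(** Comparing the conjugations as morphisms into X, not into K, makes sense for all k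
    and is compatible with composition on every side. *)
Definition SameAct {A K X : C} (u v : Hom A X) (k : Hom K X) : Prop := act u k = act v k.

Lemma same_post (A K X Y : C) (h : Hom X Y) (u v : Hom A X) (k : Hom K X) :
  SameAct u v k -> SameAct (h ∘ u) (h ∘ v) (h ∘ k).
Proof. by rewrite /SameAct -!comp_act => ->. Qed.

Lemma same_pre (A K X A' K' : C) (a : Hom A' A) (b : Hom K' K) (u v : Hom A X)
    (k : Hom K X) :
  SameAct u v k -> SameAct (u ∘ a) (v ∘ a) (k ∘ b).
Proof. by rewrite /SameAct -!act_flat_map => ->. Qed.

Lemma same_pre_acting (A K X A' : C) (a : Hom A' A) (u v : Hom A X) (k : Hom K X) :
  SameAct u v k -> SameAct (u ∘ a) (v ∘ a) k.
Proof. by move=> h; rewrite -(comp_idr k); apply: same_pre. Qed.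

Lemma same_pre_acted (A K X K' : C) (b : Hom K' K) (u v : Hom A X) (k : Hom K X) :
  SameAct u v k -> SameAct u v (k ∘ b).
Proof. by move=> h; rewrite -(comp_idr u) -(comp_idr v); apply: same_pre. Qed.

Lemma same_descend (A K X A' K' : C) (a : Hom A' A) (b : Hom K' K) (u v : Hom A X)
    (k : Hom K X) :
  IsRegularEpi a -> IsRegularEpi b -> SameAct (u ∘ a) (v ∘ a) (k ∘ b) -> SameAct u v k.
Proof.
by move=> ra rb; rewrite /SameAct -!act_flat_map; apply: regepi_epi; apply: flat_map_regepi.
Qed.

Lemma same_zero (A K X : C) (u v : Hom A X) : SameAct u v (zero K X).
Proof. by rewrite /SameAct !act_zero_r. Qed.

Lemma same_mono (A K X Y : C) (h : Hom X Y) (u v : Hom A X) (k : Hom K X) :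
  IsMono h -> SameAct (h ∘ u) (h ∘ v) (h ∘ k) -> SameAct u v k.
Proof. by move=> mh; rewrite /SameAct -!comp_act; apply: mh. Qed.

Lemma same_sym (A K X : C) (u v : Hom A X) (k : Hom K X) : SameAct u v k -> SameAct v u k.
Proof. exact: eq_sym. Qed.

Lemma same_trans (A K X : C) (u v w : Hom A X) (k : Hom K X) :
  SameAct u v k -> SameAct v w k -> SameAct u w k.
Proof. exact: eq_trans. Qed.

Lemma same_jointly (A K P X Y Z : C) (f : Hom X Z) (g : Hom Y Z)
    (p1 : Hom P X) (p2 : Hom P Y) (u v : Hom A P) (k : Hom K P) :
  IsPullback f g p1 p2 -> SameAct (p1 ∘ u) (p1 ∘ v) (p1 ∘ k) ->
  SameAct (p2 ∘ u) (p2 ∘ v) (p2 ∘ k) -> SameAct u v k.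
Proof. by move=> pb; rewrite /SameAct -!comp_act => e1 e2; apply: (ispb_ext pb). Qed.

Section Semidirect.
Variables (B X S : C) (xi : Hom (flat B X) X) (p : Hom S B) (i : Hom B S) (j : Hom X S).
Hypothesis sd : IsSemidirect xi p i j.

Lemma semidirect_section : p ∘ i = idm B. Proof. by case: sd. Qed.
Lemma semidirect_ker : IsKer p j. Proof. by apply/iskernel_isker; case: sd => _ []. Qed.
Lemma semidirect_act : j ∘ xi = act i j. Proof. by case: sd => _ []. Qed.

Lemma semidirect_ext (T : C) (u v : Hom S T) : u ∘ i = v ∘ i -> u ∘ j = v ∘ j -> u = v.
Proof. exact: point_ext semidirect_section semidirect_ker. Qed.

(** The kernel of [i, j] lies in B♭X and is there the kernel of xi. *)
Lemma semidirect_universal (T : C) (u : Hom B T) (v : Hom X T) :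
  v ∘ xi = act u v -> exists f, f ∘ i = u /\ f ∘ j = v.
Proof.
move=> e; have ex := ker_jointly_extremal semidirect_section semidirect_ker.
have rij := jointly_extremal_copair ex.
have pij : p ∘ copair i j = proj B X.
  by rewrite comp_copair semidirect_section (isker_zero semidirect_ker).
have hk := isker_ker (copair i j).
move: (ker_in _) hk => n hn.
have [|n' en] := isker_lift (t := n) (isker_flat_in B X).
  by rewrite -pij; rw (isker_zero hn); rewrite comp_zero.
have z : xi ∘ n' = zero _ _.
  apply: (isker_mono semidirect_ker).
  rewrite comp_assoc semidirect_act actE comp_zero -(isker_zero hn) -en.
  by rewrite comp_assoc.
have [|f ef] := regepi_cokernel (t := copair u v) rij hn.
  by rewrite -en comp_assoc -actE -e -comp_assoc z comp_zero.
exists f; split.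
- by rewrite -(copair_inl u v) -ef -comp_assoc copair_inl.
- by rewrite -(copair_inr u v) -ef -comp_assoc copair_inr.
Qed.

End Semidirect.

Lemma semidirect_intro (B X S : C) (xi : Hom (flat B X) X) (p : Hom S B) (i : Hom B S)
    (j : Hom X S) :
  p ∘ i = idm B -> IsKer p j -> j ∘ xi = act i j -> IsSemidirect xi p i j.
Proof. by move=> e /iskernel_isker hk ea. Qed.

(** Conjugates of k vanish in Q, so that conjugation factors through k; the laws of an
    action hold because they hold for conjugation in X. *)
Lemma conjugation_action (A K X Q : C) (q : Hom X Q) (k : Hom K X) (u : Hom A X) :
  IsKer q k -> exists xi : Hom (flat A K) K, IsAction xi /\ k ∘ xi = act u k.
Proof.
move=> hk; have [|xi e] := isker_lift (t := act u k) hk.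
  by rewrite comp_act (isker_zero hk) act_zero_r.
exists xi; split=> //; split; apply: (isker_mono hk); rewrite comp_assoc e.
- by rewrite act_unit comp_idr.
- by rewrite act_mult comp_assoc e act_flat_map comp_idr e.
Qed.

Lemma point_action (B E K : C) (p : Hom E B) (s : Hom B E) (j : Hom K E) :
  p ∘ s = idm B -> IsKer p j ->
  exists xi : Hom (flat B K) K, IsAction xi /\ IsSemidirect xi p s j.
Proof.
move=> ps hj; have [xi [ax e]] := conjugation_action s hj.
by exists xi; split=> //; apply: semidirect_intro.
Qed.

(** The semidirect product is the coequalizer of the reflexive pair [inl, flat_in] and
    1 + xi from B + B♭X to B + X.  An element of B + B♭X which identifies two elements
    of B♭X lies in B♭(B♭X), where the pair restricts to the multiplication and B♭xi;
    these are coequalized by xi, and therefore X embeds into the quotient. *)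
Lemma semidirect_exists (B X : C) (xi : Hom (flat B X) X) : IsAction xi ->
  exists (S : C) (p : Hom S B) (i : Hom B S) (j : Hom X S), IsSemidirect xi p i j.
Proof.
move=> [xi_unit xi_mult].
pose a : Hom (coproduct B (flat B X)) (coproduct B X) := copair inl (flat_in B X).
pose b := cop_map (idm B) xi.
have [||Q [q [[eq uq] cover]]] := reflexive_coequalizer (a := a) (b := b)
  (s := cop_map (idm B) (flat_unit B X)).
- apply: copair_ext; rewrite /a /cop_map; autorewrite with cat => //.
  exact: flat_in_unit.
- apply: copair_ext; rewrite /b /cop_map; autorewrite with cat => //.
  by rewrite xi_unit comp_idr.
have rq : IsRegularEpi q by exists _, a, b; split.
have pa : proj B X ∘ a = proj B (flat B X).
  by rewrite /a comp_copair proj_inl proj_flat_in.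
have pb : proj B X ∘ b = proj B (flat B X).
  by rewrite /b /cop_map /proj; autorewrite with cat.
have [|p [ep _]] := uq _ (proj B X); first by rewrite pa pb.
have eflat : q ∘ flat_in B X = (q ∘ inr) ∘ xi.
  have := f_equal (fun h => h ∘ inr) eq; rewrite /a /b /cop_map.
  by autorewrite with cat.
have qij : q = copair (q ∘ inl) (q ∘ inr).
  by apply: copair_ext; autorewrite with cat.
have ps : p ∘ (q ∘ inl) = idm B by rw ep; rewrite proj_inl.
have pz : p ∘ (q ∘ inr) = zero X B by rw ep; rewrite /proj copair_inr.
exists Q, p, (q ∘ inl), (q ∘ inr); apply: semidirect_intro => //; last first.
  by rewrite -eflat {1}qij -actE.
have hk := isker_ker p; move: (ker_in p) hk; set K := pb_ob _ => k hk.
have [j' ej] := isker_lift hk pz.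
have [|q' eq'] := isker_lift (t := q ∘ flat_in B X) hk.
  by rw ep; exact: proj_flat_in.
have rq' : IsRegularEpi q'.
  apply: (regular_epi_stable (f := q) (g := k) (p1 := flat_in B X)) rq.
  apply: ispb_intro => //.
  - by move=> T x y e _; apply: flat_in_mono.
  - move=> T x y e; have [|z ez] := isker_lift (t := x) (isker_flat_in B X).
      by rewrite -ep; rw e, (isker_zero hk); rewrite zero_comp.
    exists z; split=> //; apply: (isker_mono hk).
    by rw eq', ez.
have jq : j' ∘ xi = q'.
  by apply: (isker_mono hk); rewrite comp_assoc ej eq' eflat.
have [R [r1 [r2 rp]]] := pullback_exists q' q'.
have [_ /(_ _ xi)] := regepi_coequalizes_kernel_pair rq' rp.
case.
  have [|T' [t [w [rt [wa wb]]]]] := cover _ (flat_in B X ∘ r1) (flat_in B X ∘ r2).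
    by rw (eq_sym eq'), (ispb_comm rp).
  have [|w' ew] := isker_lift (t := w) (isker_flat_in B (flat B X)).
    by rewrite -pa; rw wa, (proj_flat_in B X); rewrite zero_comp.
  have e1 : r1 ∘ t = flat_mult B X ∘ w'.
    apply: flat_in_mono; rw (flat_in_mult B X).
    by rewrite actE -/a; rw ew, wa.
  have e2 : r2 ∘ t = flat_map (idm B) xi ∘ w'.
    apply: flat_in_mono; rw (flat_in_map (idm B) xi).
    by rewrite -/b; rw ew, wb.
  by apply: (regepi_epi rt); rw e1, e2, xi_mult.
move=> v [ev _].
have ij : IsIso j'.
  apply: regepi_mono_iso.
    by apply: (regepi_cancel (f := xi)); rewrite jq.
  apply: (section_mono (r := v)).
  have exi : IsEpi xi.
    move=> T x y e; rewrite -(comp_idr x) -(comp_idr y) -xi_unit !comp_assoc.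
    by rewrite e.
  by apply: exi; rw jq, ev.
by rewrite -ej; apply: isker_iso.
Qed.

(** The normal subobject k turns both conjugations into actions on the same object, as
    condition (UA) requires. *)
Lemma ua_same (UA : ConditionUA C) (A A1 A2 K X Q : C) (a1 : Hom A1 A) (a2 : Hom A2 A)
    (u v : Hom A X) (q : Hom X Q) (k : Hom K X) :
  JointlyExtremalEpi a1 a2 -> IsKer q k ->
  SameAct (u ∘ a1) (v ∘ a1) k -> SameAct (u ∘ a2) (v ∘ a2) k -> SameAct u v k.
Proof.
move=> ex hk s1 s2.
have [x3 [h3 e3]] := conjugation_action u hk.
have [x4 [h4 e4]] := conjugation_action v hk.
have [x1 [h1 e1]] := conjugation_action (u ∘ a1) hk.
have [x2 [h2 e2]] := conjugation_action (u ∘ a2) hk.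
rewrite /SameAct -e3 -e4; congr (_ ∘ _).
apply: (UA _ _ _ _ _ ex _ x1 x2) => //; apply: (isker_mono hk);
  rewrite /act_pullback comp_assoc ?e1 ?e2 ?e3 ?e4 act_flat_map comp_idr //.
Qed.

(** If u acts trivially on k, then u and k extend to A × K, which is the semidirect
    product for the trivial action; and this condition is symmetric in u and k. *)
Lemma same_commute (A K X : C) (u : Hom A X) (k : Hom K X) :
  SameAct u (zero _ _) k -> SameAct k (zero _ _) u.
Proof.
move=> h.
pose a := pair (idm A) (zero A K); pose b := pair (zero K A) (idm K).
have hb : IsKer fst b.
  split; first exact: fst_pair.
  split; first by apply: (section_mono (r := snd)); exact: snd_pair.
  move=> T t e; exists (snd ∘ t); rewrite /b pair_comp; autorewrite with cat.
  by apply: prod_ext; autorewrite with cat.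
have [tau [_ sd]] := point_action (fst_pair (idm A) (zero A K)) hb.
have etau : tau = act (zero _ _) (idm K).
  have := f_equal (fun x => snd ∘ x) (semidirect_act sd).
  rewrite comp_assoc snd_pair comp_idl comp_act !snd_pair.
  by [].
have [|f [fa fb]] := semidirect_universal sd (u := u) (v := k).
  by rewrite etau comp_act comp_zero comp_idr.
rewrite -fa -fb -(comp_zero _ f); apply: same_post.
rewrite /SameAct; apply: prod_ext; rewrite !comp_act /a /b ?fst_pair ?snd_pair !comp_zero //.
by rewrite !act_zero_r.
Qed.

Lemma cop_map_kernel_pair (A A' K R : C) (q : Hom A A') (r1 r2 : Hom R A) (T : C)
    (x y : Hom T (coproduct A K)) :
  IsRegularEpi q -> IsPullback q q r1 r2 ->
  cop_map q (idm K) ∘ x = cop_map q (idm K) ∘ y ->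
  exists (T' : C) (t : Hom T' T) (w : Hom T' (coproduct R K)), IsRegularEpi t /\
    cop_map r1 (idm K) ∘ w = x ∘ t /\ cop_map r2 (idm K) ∘ w = y ∘ t.
Proof.
move=> rq rp exy; have [d [d1 d2]] := ispb_lift rp (a := idm A) (b := idm A) eq_refl.
have [||Q [q0 [[eq0 _] cover]]] := reflexive_coequalizer
  (a := cop_map r1 (idm K)) (b := cop_map r2 (idm K)) (s := cop_map d (idm K)).
- by apply: copair_ext; rewrite /cop_map; autorewrite with cat; rewrite ?d1 ?comp_idr.
- by apply: copair_ext; rewrite /cop_map; autorewrite with cat; rewrite ?d2 ?comp_idr.
apply: cover; have [_ /(_ _ (q0 ∘ inl))] := regepi_coequalizes_kernel_pair rq rp.
case.
  have := f_equal (fun h => h ∘ inl) eq0; rewrite /cop_map.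
  by autorewrite with cat.
move=> z [ez _]; have -> : q0 = copair z (q0 ∘ inr) ∘ cop_map q (idm K).
  by apply: copair_ext; rewrite /cop_map; autorewrite with cat.
by rw exy.
Qed.

(** If the two images of w in A + K lie in A♭K, both legs of the kernel pair vanish on the
    R-component of w, so that w lies in R♭K. *)
Lemma flat_map_kernel_pair (A A' K R : C) (q : Hom A A') (r1 r2 : Hom R A) (T : C)
    (x y : Hom T (flat A K)) :
  IsRegularEpi q -> IsPullback q q r1 r2 ->
  flat_map q (idm K) ∘ x = flat_map q (idm K) ∘ y ->
  exists (T' : C) (t : Hom T' T) (w : Hom T' (flat R K)), IsRegularEpi t /\
    flat_map r1 (idm K) ∘ w = x ∘ t /\ flat_map r2 (idm K) ∘ w = y ∘ t.
Proof.
move=> rq rp exy.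
have [|T' [t [w [rt [e1 e2]]]]] := cop_map_kernel_pair (x := flat_in A K ∘ x)
  (y := flat_in A K ∘ y) rq rp.
  by rw (eq_sym (flat_in_map q (idm K))), exy.
have pr (r : Hom R A) : proj A K ∘ cop_map r (idm K) = r ∘ proj R K.
  by rewrite /proj /cop_map; autorewrite with cat.
have [|w' ew] := isker_lift (t := w) (isker_flat_in R K).
  apply: (ispb_ext rp); [rw (eq_sym (pr r1)), e1 | rw (eq_sym (pr r2)), e2];
    by rw (proj_flat_in A K); rewrite zero_comp comp_zero.
exists T', t, w'; split=> //; split; apply: flat_in_mono.
- by rw (flat_in_map r1 (idm K)), ew, e1.
- by rw (flat_in_map r2 (idm K)), ew, e2.
Qed.

(** Two elements of A♭K with the same image in A'♭K come, on a cover, from one element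
    of R♭K. *)
Lemma action_descends (A A' K R : C) (q : Hom A A') (r1 r2 : Hom R A)
    (xi : Hom (flat A K) K) :
  IsRegularEpi q -> IsPullback q q r1 r2 -> IsAction xi ->
  act_pullback r1 xi = act_pullback r2 xi ->
  exists xi' : Hom (flat A' K) K, IsAction xi' /\ act_pullback q xi' = xi.
Proof.
move=> rq rp [xu xm] e.
have rF (L : C) : IsRegularEpi (flat_map q (idm L)).
  apply: flat_map_regepi => //; exact: (splitepi_regepi (comp_idl (idm L))).
have [S [s1 [s2 sp]]] := pullback_exists (flat_map q (idm K)) (flat_map q (idm K)).
have [_ /(_ _ xi)] := regepi_coequalizes_kernel_pair (rF K) sp.
case.
  have [T' [t [w [rt [e1 e2]]]]] := flat_map_kernel_pair rq rp (ispb_comm sp).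
  apply: (regepi_epi rt); rw (eq_sym e1), (eq_sym e2).
  by have := f_equal (fun h => h ∘ w) e; rewrite /act_pullback -!comp_assoc.
move=> xi' [exi _]; exists xi'; split=> //; split.
- by rewrite -xu -exi; rw (flat_map_unit q (idm K)).
- have rFF : IsRegularEpi (flat_map q (flat_map q (idm K))) by apply: flat_map_regepi.
  apply: (regepi_epi rFF).
  rw (eq_sym (flat_map_mult q (idm K))), exi, xm.
  rewrite -flat_map_comp comp_idl exi.
  rewrite -[flat_map q xi](f_equal2 (fun a b => flat_map a b) (comp_idr q) (comp_idl xi)).
  by rewrite flat_map_comp; rw exi.
Qed.

(** The action of A on K is invariant under the kernel pair of q, so it descends to A';
    T is the semidirect product of the resulting action. *)
Lemma point_descent (A A' P K R : C) (p : Hom P A) (s : Hom A P) (j : Hom K P)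
    (q : Hom A A') (r1 r2 : Hom R A) :
  p ∘ s = idm A -> IsKer p j -> IsRegularEpi q -> IsPullback q q r1 r2 ->
  SameAct (s ∘ r1) (s ∘ r2) j ->
  exists (T : C) (p' : Hom T A') (s' : Hom A' T) (t : Hom P T),
    p' ∘ s' = idm A' /\ t ∘ s = s' ∘ q /\ IsPullback p' q t p /\ IsKer p' (t ∘ j).
Proof.
move=> ps hj rq rp same; have [xi [ax sd]] := point_action ps hj.
have [|xi' [ax' exi]] := action_descends rq rp ax.
  apply: (isker_mono hj).
  rewrite /act_pullback !comp_assoc (semidirect_act sd) !act_flat_map comp_idr.
  exact: same.
have [T [p' [s' [j' sd']]]] := semidirect_exists ax'.
have [|t [ts tj]] := semidirect_universal sd (u := s' ∘ q) (v := j').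
  rewrite -exi /act_pullback comp_assoc (semidirect_act sd') act_flat_map.
  by rewrite comp_idr.
have ps' := semidirect_section sd'; have hj' := semidirect_ker sd'.
exists T, p', s', t; split=> //; split=> //; split; last by rewrite tj.
apply: (point_pullback ps hj ps'); rewrite ?tj //.
apply: (point_ext ps hj); first by rw ts, ps', ps.
by rw tj, (isker_zero hj), (isker_zero hj'); rewrite comp_zero.
Qed.

End Actions.

(** * Precrossed modules as reflexive graphs *)

Section Graphs.
Context {C : SemiAbelian} {B : C}.

Lemma conj_actE (X : C) : conj_act X = act (idm X) (idm X).
Proof. by []. Qed.

Lemma normalization_exists (G : ReflexiveGraph B) :
  exists (X : PXMod B) (k : Hom (px_ob X) (rg_ob G)), IsNormalization k.
Proof.
have hk := isker_ker (rg_dom G); move: (ker_in _) hk; set K := pb_ob _ => k hk.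
have [xi [ax sd]] := point_action (rg_dom_unit G) hk.
have px : (rg_cod G ∘ k) ∘ xi = conj_act B ∘ flat_map (idm B) (rg_cod G ∘ k).
  rewrite -comp_assoc (semidirect_act sd) comp_act rg_cod_unit.
  by rewrite conj_actE act_flat_map !comp_idl.
by exists (MkPX ax px), k.
Qed.

Lemma graph_exists (X : PXMod B) :
  exists (Gk : {G : ReflexiveGraph B & Hom (px_ob X) (rg_ob G)}),
    IsNormalization (projT2 Gk).
Proof.
have [S [p [i [j sd]]]] := semidirect_exists (px_action X).
have [|c [ci cj]] := semidirect_universal sd (u := idm B) (v := px_bd X).
  by rewrite px_precrossed conj_actE act_flat_map !comp_idl.
by exists (existT _ (MkRG (semidirect_section sd) ci) j).
Qed.

(** A fixed choice of graphs makes tot a functor into the base category. *)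
Definition graph_choice (X : PXMod B) := constructive_indefinite_description _ (graph_exists X).

Definition graph (X : PXMod B) : ReflexiveGraph B := projT1 (proj1_sig (graph_choice X)).
Definition tot (X : PXMod B) : C := rg_ob (graph X).
Definition dom (X : PXMod B) : Hom (tot X) B := rg_dom (graph X).
Definition cod (X : PXMod B) : Hom (tot X) B := rg_cod (graph X).
Definition unt (X : PXMod B) : Hom B (tot X) := rg_unit (graph X).
Definition inc (X : PXMod B) : Hom (px_ob X) (tot X) := projT2 (proj1_sig (graph_choice X)).

Lemma graph_normalization (X : PXMod B) : IsNormalization (G := graph X) (inc X).
Proof. exact: (proj2_sig (graph_choice X)). Qed.

Lemma graph_semidirect (X : PXMod B) : IsSemidirect (px_act X) (dom X) (unt X) (inc X).
Proof. by case: (graph_normalization X). Qed.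

Lemma dom_unt (X : PXMod B) : dom X ∘ unt X = idm B. Proof. exact: rg_dom_unit. Qed.
Lemma cod_unt (X : PXMod B) : cod X ∘ unt X = idm B. Proof. exact: rg_cod_unit. Qed.
Lemma isker_inc (X : PXMod B) : IsKer (dom X) (inc X).
Proof. exact: semidirect_ker (graph_semidirect X). Qed.
Lemma dom_inc (X : PXMod B) : dom X ∘ inc X = zero _ _. Proof. exact: isker_zero (isker_inc X). Qed.
Lemma cod_inc (X : PXMod B) : cod X ∘ inc X = px_bd X.
Proof. by case: (graph_normalization X). Qed.
Lemma inc_act (X : PXMod B) : inc X ∘ px_act X = act (unt X) (inc X).
Proof. exact: semidirect_act (graph_semidirect X). Qed.

Lemma tot_ext (X : PXMod B) (T : C) (u v : Hom (tot X) T) :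
  u ∘ unt X = v ∘ unt X -> u ∘ inc X = v ∘ inc X -> u = v.
Proof. move=> e1 e2; exact: (semidirect_ext (graph_semidirect X) e1 e2). Qed.

Lemma tot_extremal (X : PXMod B) : JointlyExtremalEpi (inc X) (unt X).
Proof.
move=> M m f g mm e1 e2.
exact: (ker_jointly_extremal (dom_unt X) (isker_inc X) mm e2 e1).
Qed.

Lemma tmap_exists (X Y : PXMod B) (f : Hom X Y) :
  exists F : Hom (tot X) (tot Y), F ∘ unt X = unt Y /\ F ∘ inc X = inc Y ∘ px_hom f.
Proof.
apply: (semidirect_universal (graph_semidirect X)).
rewrite -comp_assoc px_hom_act comp_assoc inc_act act_flat_map comp_idr.
by [].
Qed.

Definition tmap {X Y : PXMod B} (f : Hom X Y) : Hom (tot X) (tot Y) :=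
  proj1_sig (constructive_indefinite_description _ (tmap_exists f)).

Lemma tmap_unt (X Y : PXMod B) (f : Hom X Y) : tmap f ∘ unt X = unt Y.
Proof. by rewrite /tmap; case: constructive_indefinite_description => F []. Qed.

Lemma tmap_inc (X Y : PXMod B) (f : Hom X Y) : tmap f ∘ inc X = inc Y ∘ px_hom f.
Proof. by rewrite /tmap; case: constructive_indefinite_description => F []. Qed.

Lemma dom_tmap (X Y : PXMod B) (f : Hom X Y) : dom Y ∘ tmap f = dom X.
Proof.
apply: tot_ext; first by rw (tmap_unt f), (dom_unt X); exact: dom_unt.
by rw (tmap_inc f), (dom_inc Y), (dom_inc X); exact: zero_comp.
Qed.

Lemma cod_tmap (X Y : PXMod B) (f : Hom X Y) : cod Y ∘ tmap f = cod X.
Proof.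
apply: tot_ext; first by rw (tmap_unt f), (cod_unt X); exact: cod_unt.
by rw (tmap_inc f), (cod_inc Y), (cod_inc X); exact: px_hom_bd.
Qed.

Lemma tmap_id (X : PXMod B) : tmap (idm X) = idm (tot X).
Proof.
apply: tot_ext; first by rewrite tmap_unt comp_idl.
by rewrite tmap_inc comp_idl; exact: comp_idr.
Qed.

Lemma tmap_comp (X Y Z : PXMod B) (g : Hom Y Z) (f : Hom X Y) :
  tmap (g ∘ f) = tmap g ∘ tmap f.
Proof.
apply: tot_ext; first by rw (tmap_unt f), (tmap_unt g); exact: tmap_unt.
by rw (tmap_inc f), (tmap_inc g); rewrite tmap_inc.
Qed.

Lemma tmap_inj (X Y : PXMod B) (f g : Hom X Y) : tmap f = tmap g -> f = g.
Proof.
move=> e; apply: px_hom_ext; apply: (isker_mono (isker_inc Y)).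
by rewrite -!tmap_inc e.
Qed.

Lemma tmap_full (X Y : PXMod B) (F : Hom (tot X) (tot Y)) :
  dom Y ∘ F = dom X -> cod Y ∘ F = cod X -> F ∘ unt X = unt Y ->
  exists f : Hom X Y, tmap f = F.
Proof.
move=> eD ec eu; have [|f ef] := isker_lift (t := F ∘ inc X) (isker_inc Y).
  by rw eD; exact: dom_inc.
have e1 : px_bd Y ∘ f = px_bd X by rewrite -!cod_inc; rw ef, ec.
have e2 : f ∘ px_act X = px_act Y ∘ flat_map (idm B) f.
  apply: (isker_mono (isker_inc Y)); rw ef, (inc_act X), (inc_act Y).
  by rewrite comp_act act_flat_map comp_idr eu ef.
exists (MkPXHom e1 e2); apply: tot_ext; first by rewrite tmap_unt.
by rewrite tmap_inc.
Qed.

(** Both total objects are semidirect products for the same action. *)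
Lemma normalization_iso (G : ReflexiveGraph B) (X : PXMod B)
    (k : Hom (px_ob X) (rg_ob G)) : IsNormalization k ->
  exists th : Hom (tot X) (rg_ob G), IsIso th /\ rg_dom G ∘ th = dom X /\
    rg_cod G ∘ th = cod X /\ th ∘ unt X = rg_unit G /\ th ∘ inc X = k.
Proof.
move=> [sd eb].
have [th [t1 t2]] := semidirect_universal (graph_semidirect X) (semidirect_act sd).
have eD : rg_dom G ∘ th = dom X.
  apply: tot_ext; first by rw t1, (dom_unt X); exact: rg_dom_unit.
  by rw t2, (dom_inc X), (isker_zero (semidirect_ker sd)).
have ec : rg_cod G ∘ th = cod X.
  apply: tot_ext; first by rw t1, (cod_unt X); exact: rg_cod_unit.
  by rw t2, (cod_inc X).
exists th; split=> //.
exact: (split_short_five (dom_unt X) (isker_inc X) (rg_dom_unit G) (semidirect_ker sd)).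
Qed.

Lemma graph_realize (T : C) (d c : Hom T B) (e : Hom B T) :
  d ∘ e = idm B -> c ∘ e = idm B ->
  exists (X : PXMod B) (th : Hom (tot X) T), IsIso th /\ d ∘ th = dom X /\
    c ∘ th = cod X /\ th ∘ unt X = e.
Proof.
move=> hd hc; have [X [k hk]] := normalization_exists (MkRG hd hc).
have [th [h1 [h2 [h3 [h4 _]]]]] := normalization_iso hk.
by exists X, th.
Qed.

Lemma graph_realize_inv (T : C) (d c : Hom T B) (e : Hom B T) :
  d ∘ e = idm B -> c ∘ e = idm B ->
  exists (X : PXMod B) (th : Hom T (tot X)), IsIso th /\ dom X ∘ th = d /\
    cod X ∘ th = c /\ th ∘ e = unt X.
Proof.
move=> hd hc; have [X [th [[th' [i1 i2]] [h1 [h2 h3]]]]] := graph_realize hd hc.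
exists X, th'; split; first by exists th.
by split; [rewrite -h1; rw i2 | split; [rewrite -h2; rw i2 | rewrite -h3; rw i1]].
Qed.

Lemma tmap_ispb_reflect (X Y Z P : PXMod B) (f : Hom X Z) (g : Hom Y Z)
    (p1 : Hom P X) (p2 : Hom P Y) :
  IsPullback (tmap f) (tmap g) (tmap p1) (tmap p2) -> IsPullback f g p1 p2.
Proof.
move=> pb; apply: ispb_intro.
- by apply: tmap_inj; rewrite !tmap_comp (ispb_comm pb).
- move=> T u v e1 e2; apply: tmap_inj; apply: (ispb_ext pb); rewrite -!tmap_comp;
    by rewrite ?e1 ?e2.
- move=> T a b /(f_equal tmap); rewrite !tmap_comp => e.
  have [F [F1 F2]] := ispb_lift pb e.
  have [|||u eu] := tmap_full (F := F).
  + by rewrite -(dom_tmap p1); rw F1; exact: dom_tmap.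
  + by rewrite -(cod_tmap p1); rw F1; exact: cod_tmap.
  + by apply: (ispb_ext pb); [rw F1 | rw F2]; rewrite !tmap_unt.
  by exists u; split; apply: tmap_inj; rewrite tmap_comp eu.
Qed.

Lemma tmap_pullback_exists (X Y Z : PXMod B) (f : Hom X Z) (g : Hom Y Z) :
  exists (P : PXMod B) (p1 : Hom P X) (p2 : Hom P Y),
    IsPullback (tmap f) (tmap g) (tmap p1) (tmap p2).
Proof.
have [T [q1 [q2 pb]]] := pullback_exists (tmap f) (tmap g).
have [|e [e1 e2]] := ispb_lift pb (a := unt X) (b := unt Y); first by rewrite !tmap_unt.
have [||P [th [ith [h1 [h2 h3]]]]] := graph_realize (d := dom X ∘ q1) (c := cod X ∘ q1) (e := e).
- by rw e1; exact: dom_unt.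
- by rw e1; exact: cod_unt.
have dq2 : dom Y ∘ q2 = dom X ∘ q1.
  by rewrite -(dom_tmap g) -(dom_tmap f); rw (ispb_comm pb).
have cq2 : cod Y ∘ q2 = cod X ∘ q1.
  by rewrite -(cod_tmap g) -(cod_tmap f); rw (ispb_comm pb).
have [|||p1 ep1] := tmap_full (X := P) (Y := X) (F := q1 ∘ th).
- by rewrite comp_assoc.
- by rewrite comp_assoc.
- by rewrite -comp_assoc h3.
have [|||p2 ep2] := tmap_full (X := P) (Y := Y) (F := q2 ∘ th).
- by rewrite comp_assoc dq2.
- by rewrite comp_assoc cq2.
- by rewrite -comp_assoc h3.
by exists P, p1, p2; rewrite ep1 ep2; apply: ispb_iso.
Qed.

Lemma tmap_iso (X Y : PXMod B) (f : Hom X Y) : IsIso f -> IsIso (tmap f).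
Proof.
move=> [g [e1 e2]]; exists (tmap g).
by rewrite -!tmap_comp e1 e2 !tmap_id.
Qed.

Lemma tmap_ispb (X Y Z P : PXMod B) (f : Hom X Z) (g : Hom Y Z)
    (p1 : Hom P X) (p2 : Hom P Y) :
  IsPullback f g p1 p2 -> IsPullback (tmap f) (tmap g) (tmap p1) (tmap p2).
Proof.
move=> pb; have [Q [q1 [q2 qb]]] := tmap_pullback_exists f g.
have [i [ii [<- <-]]] := ispb_unique (tmap_ispb_reflect qb) pb.
by rewrite !tmap_comp; apply: ispb_iso => //; apply: tmap_iso.
Qed.

Lemma tmap_mono_reflect (X Y : PXMod B) (f : Hom X Y) : IsMono (tmap f) -> IsMono f.
Proof. by move=> m T a b e; apply/tmap_inj/m; rewrite -!tmap_comp e. Qed.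

Lemma tmap_regepi_reflect (X Y : PXMod B) (f : Hom X Y) :
  IsRegularEpi (tmap f) -> IsRegularEpi f.
Proof.
move=> rf; have [R [r1 [r2 pb]]] := tmap_pullback_exists f f.
exists R, r1, r2; split; first by apply: tmap_inj; rewrite !tmap_comp (ispb_comm pb).
move=> T t e; have [_ /(_ _ (tmap t))] := regepi_coequalizes_kernel_pair rf pb.
case; first by rewrite -!tmap_comp e.
move=> U [eU _]; have ef := regepi_epi rf.
have [|||u eu] := tmap_full (F := U).
- by apply: ef; rw eU, (dom_tmap t); rewrite dom_tmap.
- by apply: ef; rw eU, (cod_tmap t); rewrite cod_tmap.
- by rewrite -(tmap_unt f); rw eU; exact: tmap_unt.
exists u; split; first by apply: tmap_inj; rewrite tmap_comp eu.
by move=> v ev; apply/tmap_inj/ef; rewrite -!tmap_comp ev tmap_comp eu.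
Qed.

Lemma tmap_image (X Y : PXMod B) (f : Hom X Y) :
  exists (I : PXMod B) (q : Hom X I) (m : Hom I Y),
    IsRegularEpi (tmap q) /\ IsMono (tmap m) /\ m ∘ q = f.
Proof.
have [T [q [m [rq [mm e]]]]] := image_factorization (tmap f).
have [||I [th [ith [h1 [h2 h3]]]]] := graph_realize_inv (d := dom Y ∘ m) (c := cod Y ∘ m)
  (e := q ∘ unt X).
- by rw e, (dom_tmap f); exact: dom_unt.
- by rw e, (cod_tmap f); exact: cod_unt.
have [|||q' eq'] := tmap_full (X := X) (Y := I) (F := th ∘ q).
- by rw h1, e; exact: dom_tmap.
- by rw h2, e; exact: cod_tmap.
- by rewrite -comp_assoc h3.
case: (ith) => th' [i1 i2].
have [|||m' em'] := tmap_full (X := I) (Y := Y) (F := m ∘ th').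
- by rewrite comp_assoc -h1; rw i2.
- by rewrite comp_assoc -h2; rw i2.
- by rewrite -h3; rw i1, e; exact: tmap_unt.
exists I, q', m'; rewrite eq' em'; split; first exact: regepi_iso_left.
split; first by apply: mono_comp => //; apply: iso_mono; exists th.
by apply: tmap_inj; rewrite tmap_comp eq' em'; rw i1.
Qed.

(** The image of tmap f is again a graph over B, and f factors through it. *)
Lemma tmap_regepi (X Y : PXMod B) (f : Hom X Y) :
  IsRegularEpi f -> IsRegularEpi (tmap f).
Proof.
move=> rf; have [I [q [m [rq [mm e]]]]] := tmap_image f.
have [w [w1 w2]] := regepi_lift (y := idm Y) rf (tmap_mono_reflect mm)
  (eq_trans e (eq_sym (comp_idl f))).
rewrite -e tmap_comp; apply: regepi_iso_left => //.
by apply: (mono_retraction_iso (s := tmap w)) => //; rewrite -tmap_comp w1 tmap_id.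
Qed.

Lemma inc_ispb (X Y : PXMod B) (f : Hom X Y) :
  IsPullback (tmap f) (inc Y) (inc X) (px_hom f).
Proof.
apply: ispb_intro; first exact: tmap_inc.
- by move=> T u v e _; apply: (isker_mono (isker_inc X)).
- move=> T a b e; have [|u eu] := isker_lift (t := a) (isker_inc X).
    by rewrite -(dom_tmap f); rw e, (dom_inc Y); rewrite zero_comp.
  exists u; split=> //; apply: (isker_mono (isker_inc Y)).
  by rw (eq_sym (tmap_inc f)), eu, e.
Qed.

Lemma px_hom_regepi (X Y : PXMod B) (f : Hom X Y) :
  IsRegularEpi f -> IsRegularEpi (px_hom f).
Proof. by move/tmap_regepi; apply: regular_epi_stable; exact: inc_ispb. Qed.

Lemma initial_of_iso (I : PXMod B) : IsIso (unt I) -> IsInitial I.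
Proof.
move=> [u [e1 e2]] X.
have eu : u = dom I by rewrite -(comp_idl u) -(dom_unt I); rw e2.
have ec : dom I = cod I.
  by rewrite -(comp_idl (dom I)) -(cod_unt I) -eu; rw e2.
have [|||f ef] := tmap_full (X := I) (Y := X) (F := unt X ∘ dom I).
- by rw (dom_unt X).
- by rw (cod_unt X).
- by rw (dom_unt I).
exists f; split=> // g _; apply: tmap_inj; apply: (iso_epi (f := unt I)).
  by exists u.
by rewrite !tmap_unt.
Qed.

Lemma initial_exists : exists I : PXMod B, IsIso (unt I).
Proof.
have [I [th [ith [_ [_ e]]]]] := graph_realize_inv (comp_idl (idm B)) (comp_idl (idm B)).
by exists I; rewrite -e comp_idr.
Qed.

Lemma initial_iso (I : PXMod B) : IsInitial I -> IsIso (unt I).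
Proof.
move=> hI; have [J hJ] := initial_exists.
have [f [_ uf]] := hI J; have [g [_ ug]] := initial_of_iso hJ I.
have [i [_ ui]] := hI I; have [j [_ uj]] := initial_of_iso hJ J.
have [f' [f1 f2]] : IsIso (tmap g).
  exists (tmap f); rewrite -!tmap_comp.
  by rewrite -(uj (f ∘ g)) // -(ui (g ∘ f)) // (uj (idm J)) // (ui (idm I)) // !tmap_id.
rewrite -(tmap_unt g); apply: iso_comp => //.
by exists f'.
Qed.

Lemma initial_dom_cod (I : PXMod B) : IsIso (unt I) -> dom I = cod I /\ inc I = zero _ _.
Proof.
move=> [u [e1 e2]]; split.
- by apply: (iso_epi (f := unt I)); [exists u | rewrite dom_unt cod_unt].
- have eu : u = dom I by rewrite -(comp_idl u) -(dom_unt I); rw e2.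
  by rewrite -(comp_idl (inc I)) -e2 eu -comp_assoc dom_inc comp_zero.
Qed.

(** The structure maps of K factor through the initial precrossed module, whose total
    object is B: this forces the boundary to vanish. *)
Lemma px_kernel (X Y K : PXMod B) (f : Hom X Y) (k : Hom K X) : IsKernel f k ->
  IsKer (tmap f) (inc X ∘ px_hom k) /\ px_bd K = zero _ _ /\ dom K = cod K /\
    IsMono (tmap k).
Proof.
move=> [I [i [t [hI pb]]]]; have [eI zI] := initial_dom_cod (initial_iso hI).
have tb := tmap_ispb pb.
have bK : px_bd K = zero _ _.
  by rewrite -cod_inc -(cod_tmap t) -eI dom_tmap dom_inc.
split; last first.
  split=> //; split; first by rewrite -(dom_tmap t) -(cod_tmap t) eI.
  apply: (ispb_mono (ispb_sym tb)); have [v [v1 v2]] := initial_iso hI.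
  apply: (section_mono (r := unt I ∘ dom Y)); rw (dom_tmap i).
  have -> : dom I = v by rewrite -(comp_idl v) -(dom_unt I); rw v2.
  exact: v2.
have zt T (a : Hom T (px_ob K)) : tmap t ∘ (inc K ∘ a) = zero _ _.
  by rw (tmap_inc t); rewrite zI zero_comp.
split; [|split].
- rewrite -tmap_inc; rw (ispb_comm tb).
  by have := zt _ (idm _); rewrite comp_idr => ->; rewrite comp_zero.
- rewrite -tmap_inc => T a b; rewrite -!comp_assoc => e.
  apply: (isker_mono (isker_inc K)); apply: (ispb_ext tb) => //.
  by rewrite !zt.
- move=> T x e; have [|y [y1 y2]] := ispb_lift tb (a := x) (b := zero _ _).
    by rewrite e comp_zero.
  have [|z ez] := isker_lift (t := y) (isker_inc K).
    rewrite -(dom_tmap k); rw y1; rewrite -(dom_tmap f); rw e.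
    by rewrite comp_zero.
  by exists z; rewrite -tmap_inc; rw ez.
Qed.

Lemma px_kernel_exists (X Y : PXMod B) (f : Hom X Y) :
  exists (K : PXMod B) (k : Hom K X), IsKernel f k.
Proof.
have [I hI] := initial_exists; have [i _] := initial_of_iso hI Y.
have [K [k [t pb]]] := tmap_pullback_exists f i.
exists K, k, I, i, t; split; first exact: initial_of_iso.
exact: tmap_ispb_reflect.
Qed.

Lemma tmap_coequalizer_exists (X : PXMod B) (S : C) (a b : Hom S (tot X)) :
  dom X ∘ a = dom X ∘ b -> cod X ∘ a = cod X ∘ b ->
  exists (Q : PXMod B) (q : Hom X Q), IsCoequalizer a b (tmap q).
Proof.
move=> ed ec; have [T [t [et ut]]] := coequalizer_exists a b.
have [d [edt _]] := ut _ _ ed; have [c [ect _]] := ut _ _ ec.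
have [||Q [th [ith [h1 [h2 h3]]]]] := graph_realize_inv (d := d) (c := c) (e := t ∘ unt X).
- by rw edt; exact: dom_unt.
- by rw ect; exact: cod_unt.
have [|||q eq] := tmap_full (X := X) (Y := Q) (F := th ∘ t).
- by rw h1.
- by rw h2.
- by rewrite -comp_assoc h3.
exists Q, q; rewrite eq; split; first by rw et.
move=> U u eu; have [v [ev uv]] := ut _ _ eu; case: ith => th' [i1 i2].
exists (v ∘ th'); split; first by rw i1, ev.
move=> w ew; rewrite (uv (w ∘ th)); first by rw ew.
by rw i2.
Qed.

Lemma tmap_factor (X Q T : PXMod B) (q : Hom X Q) (t : Hom X T) (W : Hom (tot Q) (tot T)) :
  IsRegularEpi (tmap q) -> W ∘ tmap q = tmap t -> exists w : Hom Q T, tmap w = W /\ w ∘ q = t.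
Proof.
move=> rq e; have eq := regepi_epi rq; have [|||w ew] := tmap_full (F := W).
- by apply: eq; rw e, (dom_tmap t), (dom_tmap q).
- by apply: eq; rw e, (cod_tmap t), (cod_tmap q).
- by rewrite -(tmap_unt q); rw e; exact: tmap_unt.
by exists w; split=> //; apply: tmap_inj; rewrite tmap_comp ew.
Qed.

(** Graphs over B are objects of the base category under B and over B × B, so their
    connected colimits are computed on total objects. *)
Lemma px_pushout_exists (S X Y : PXMod B) (a : Hom S X) (b : Hom S Y) :
  exists (Q : PXMod B) (q1 : Hom X Q) (q2 : Hom Y Q), IsPushout a b q1 q2.
Proof.
have [T [t1 [t2 [et ut]]]] := pushout_exists (tmap a) (tmap b).
have [|d [[ed1 ed2] _]] := ut _ (dom X) (dom Y); first by rewrite !dom_tmap.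
have [|c [[ec1 ec2] _]] := ut _ (cod X) (cod Y); first by rewrite !cod_tmap.
have eu : t1 ∘ unt X = t2 ∘ unt Y.
  by rewrite -(tmap_unt a) -(tmap_unt b) !comp_assoc et.
have [||Q [th [[th' [i1 i2]] [h1 [h2 h3]]]]] := graph_realize_inv (d := d) (c := c) (e := t1 ∘ unt X).
- by rw ed1; exact: dom_unt.
- by rw ec1; exact: cod_unt.
have [|||q1 eq1] := tmap_full (X := X) (Y := Q) (F := th ∘ t1).
- by rw h1.
- by rw h2.
- by rewrite -comp_assoc h3.
have [|||q2 eq2] := tmap_full (X := Y) (Y := Q) (F := th ∘ t2).
- by rw h1.
- by rw h2.
- by rewrite -comp_assoc -eu h3.
exists Q, q1, q2; split; first by apply: tmap_inj; rewrite !tmap_comp eq1 eq2; rw et.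
move=> U x y /(f_equal tmap); rewrite !tmap_comp => e.
have [W [[W1 W2] uW]] := ut _ _ _ e.
have ext (P : C) (u v : Hom T P) : u ∘ t1 = v ∘ t1 -> u ∘ t2 = v ∘ t2 -> u = v.
  move=> e1 e2; have [|z [_ uz]] := ut _ (v ∘ t1) (v ∘ t2); first by rw et.
  by rewrite -(uz u) // (uz v).
have [|||w ew] := tmap_full (X := Q) (Y := U) (F := W ∘ th').
- rewrite -[dom Q]comp_idr -i2 !comp_assoc h1; congr (_ ∘ _).
  by apply: ext; rewrite -comp_assoc ?W1 ?W2 dom_tmap.
- rewrite -[cod Q]comp_idr -i2 !comp_assoc h2; congr (_ ∘ _).
  by apply: ext; rewrite -comp_assoc ?W1 ?W2 cod_tmap.
- by rewrite -h3; rw i1, W1; exact: tmap_unt.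
exists w; split.
- by split; apply: tmap_inj; rewrite tmap_comp ew ?eq1 ?eq2; rw i1.
- move=> v [v1 v2]; apply: tmap_inj; rewrite ew.
  have -> : W = tmap v ∘ th.
    by apply: uW; rewrite -!comp_assoc -eq1 -eq2 -!tmap_comp v1 v2.
  by rw i2.
Qed.

(** The pushout under the initial precrossed module. *)
Lemma px_coproduct_exists (X Y : PXMod B) : inhabited (Coproduct X Y).
Proof.
have [I hI] := initial_exists; have uI := initial_of_iso hI.
have [x _] := uI X; have [y _] := uI Y.
have [P [p1 [p2 [_ uP]]]] := px_pushout_exists x y.
have u T (a : Hom X T) (b : Hom Y T) : exists! w : Hom P T, w ∘ p1 = a /\ w ∘ p2 = b.
  apply: uP; have [z [_ uz]] := uI T.
  by rewrite -(uz (a ∘ x)) // (uz (b ∘ y)).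
have c T (a : Hom X T) (b : Hom Y T) : {w : Hom P T | w ∘ p1 = a /\ w ∘ p2 = b}.
  by apply: constructive_indefinite_description; have [w [e _]] := u T a b; exists w.
constructor; exists P p1 p2 (fun T a b => proj1_sig (c T a b)).
- by move=> T a b; case: (c T a b) => w [].
- by move=> T a b; case: (c T a b) => w [].
- move=> T v w e1 e2; have [z [_ uz]] := u T (w ∘ p1) (w ∘ p2).
  by rewrite -(uz v) // (uz w).
Qed.

End Graphs.

(** * The Peiffer commutator *)

Lemma pushout_regepi (C : Category) (S X Y Q : C) (a : Hom S X) (b : Hom S Y)
    (q1 : Hom X Q) (q2 : Hom Y Q) :
  IsPushout a b q1 q2 -> IsRegularEpi b -> IsRegularEpi q1.
Proof.
move=> [e u] rb; have eb := regepi_epi rb; case: (rb) => R [x [y [exy uxy]]].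
exists R, (a ∘ x), (a ∘ y); split; first by rw e, exy.
move=> T t et; have [|s [es _]] := uxy _ (t ∘ a); first by rw et.
have [w [[w1 w2] uw]] := u _ t s (eq_sym es).
exists w; split=> // v ev; apply: uw; split=> //.
by apply: eb; rw (eq_sym e), ev, es.
Qed.

Section Peiffer.
Context {C : SemiAbelian} {B : C}.

(** The composite graph X_1 ×_B Y_1 is the semidirect product of X with Y_1, which acts
    on X through cod Y; this gives its morphisms into A. *)
Lemma peiffer_semidirect_exists (X Y : PXMod B) :
  exists (S : PXMod B) (jX : Hom X S) (iY : Hom Y S), IsPXSemidirect jX iY /\
    forall (A : PXMod B) (m : Hom X A) (n : Hom Y A),
      SameAct (unt A ∘ cod Y) (tmap n) (inc A ∘ px_hom m) ->
      exists f : Hom S A, f ∘ jX = m /\ f ∘ iY = n.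
Proof.
pose G := rg_composite (graph X) (graph Y).
have pb : IsPullback (dom X) (cod Y) (rg_pr1 (graph X) (graph Y)) (rg_pr2 (graph X) (graph Y)).
  exact: ispb_of_pullback.
have domG : rg_dom G = dom Y ∘ rg_pr2 (graph X) (graph Y) by [].
have codG : rg_cod G = cod X ∘ rg_pr1 (graph X) (graph Y) by [].
have u1 : rg_pr1 (graph X) (graph Y) ∘ rg_unit G = unt X by exact: pb_lift1.
have u2 : rg_pr2 (graph X) (graph Y) ∘ rg_unit G = unt Y by exact: pb_lift2.
have [S [kS hS]] := normalization_exists G.
have [th [ith [t1 [t2 [t3 t4]]]]] := normalization_iso hS.
have sdS := proj1 hS; have mS := isker_mono (semidirect_ker sdS).
have zS := isker_zero (semidirect_ker sdS).
have edY : dom Y ∘ rg_pr2 (graph X) (graph Y) ∘ kS = zero _ _ by rewrite -domG.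
pose p1 := rg_pr1 (graph X) (graph Y); pose p2 := rg_pr2 (graph X) (graph Y).
rewrite -/p1 -/p2 in pb domG codG u1 u2 edY.
have [|a [a1 a2]] := ispb_lift pb (a := idm (tot X)) (b := unt Y ∘ dom X).
  by rw (cod_unt Y).
have [|b [b1 b2]] := ispb_lift pb (a := unt X ∘ cod Y) (b := idm (tot Y)).
  by rw (dom_unt X).
have au : a ∘ unt X = rg_unit G.
  apply: (ispb_ext pb); first by rw a1, u1.
  by rw a2, u2, (dom_unt X).
have bu : b ∘ unt Y = rg_unit G.
  apply: (ispb_ext pb); last by rw b2, u2.
  by rw b1, u1, (cod_unt Y).
case: (ith) => th' [i1 i2].
have [|||jX ejX] := tmap_full (X := X) (Y := S) (F := th' ∘ a).
- by rewrite -t1; rw i2, domG, a2, (dom_unt Y).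
- by rewrite -t2; rw i2, codG, a1.
- by rw au, (eq_sym t3), i1.
have [|||iY eiY] := tmap_full (X := Y) (Y := S) (F := th' ∘ b).
- by rewrite -t1; rw i2, domG, b2.
- by rewrite -t2; rw i2, codG, b1, (cod_unt X).
- by rw bu, (eq_sym t3), i1.
have kj : kS ∘ px_hom jX = a ∘ inc X by rewrite -t4; rw (eq_sym (tmap_inc jX)), ejX, i2.
have ki : kS ∘ px_hom iY = b ∘ inc Y by rewrite -t4; rw (eq_sym (tmap_inc iY)), eiY, i2.
have [|p ep] := isker_lift (t := p2 ∘ kS) (isker_inc Y); first by rewrite comp_assoc.
have p1j : p1 ∘ kS ∘ px_hom jX = inc X by rw kj, a1.
have p1i : p1 ∘ kS ∘ px_hom iY = unt X ∘ px_bd Y by rw ki, b1, (cod_inc Y).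
have p2j : p2 ∘ kS ∘ px_hom jX = zero _ _.
  by rw kj, a2, (dom_inc X); rewrite comp_zero.
have p2i : p2 ∘ kS ∘ px_hom iY = inc Y by rw ki, b2.
have mI := isker_mono (isker_inc Y).
exists S, jX, iY; split.
- exists (graph X), (graph Y), (inc X), (inc Y), kS, p.
  split; first exact: graph_normalization.
  split; first exact: graph_normalization.
  split=> //; split; last by [].
  apply: semidirect_intro.
  + by apply: mI; rw ep, p2i.
  + split; first by apply: mI; rw ep, p2j; rewrite comp_zero.
    split.
      apply: (mono_cancel (g := p1 ∘ kS)); rewrite p1j.
      exact: isker_mono (isker_inc X).
    move=> T t e; have e2 : p2 ∘ kS ∘ t = zero _ _.
      by rewrite -ep; rw e; rewrite comp_zero.
    have [|x ex] := isker_lift (t := p1 ∘ kS ∘ t) (isker_inc X).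
      by rw (ispb_comm pb), e2; rewrite comp_zero.
    exists x; apply: mS; apply: (ispb_ext pb); first by rw p1j, ex.
    by rw p2j, e2; rewrite zero_comp.
  + apply: mS; rewrite comp_act /act_pullback.
    apply: (ispb_ext pb); rewrite comp_act.
    * rw p1j, (inc_act X), p1i.
      by rewrite act_flat_map comp_idr.
    * by rw p2j; rewrite zero_comp act_zero_r.
- move=> A m n same.
  have hk : IsKer p2 (a ∘ inc X).
    apply: (isker_pullback_inv pb); first by rw a1; exact: isker_inc.
    by rw a2, (dom_inc X); rewrite comp_zero.
  have sd : IsSemidirect (act_pullback (cod Y) (px_act X)) p2 b (a ∘ inc X).
    apply: semidirect_intro => //; apply: (ispb_ext pb).
    + rewrite comp_act /act_pullback; rw a1, b1, (inc_act X).
      by rewrite act_flat_map comp_idr.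
    + rewrite comp_act; rw a2, (dom_inc X).
      by rewrite !zero_comp !comp_zero act_zero_r.
  have [|F [F1 F2]] := semidirect_universal sd (u := tmap n) (v := inc A ∘ px_hom m).
    rewrite -same /act_pullback -comp_assoc.
    rw (px_hom_act m), (inc_act A).
    by rewrite -flat_map_comp comp_idl comp_idr act_flat_map.
  have Fa : F ∘ a = tmap m.
    apply: tot_ext; first by rw au, (eq_sym bu), F1, (tmap_unt n); rewrite tmap_unt.
    by rw F2; rewrite tmap_inc.
  have [|||f ef] := tmap_full (X := S) (Y := A) (F := F ∘ th).
  + rewrite -t1 comp_assoc; congr (_ ∘ _); apply: (semidirect_ext sd).
      by rw F1, domG, b2; exact: dom_tmap.
    by rw F2, domG, a2, (dom_inc A), (dom_inc X); rewrite !comp_zero zero_comp.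
  + rewrite -t2 comp_assoc; congr (_ ∘ _); apply: (semidirect_ext sd).
      by rw F1, codG, b1, (cod_unt X); exact: cod_tmap.
    by rw F2, codG, a1, (cod_inc A), (cod_inc X); exact: px_hom_bd.
  + by rw t3, (eq_sym bu), F1; exact: tmap_unt.
  exists f; split; apply: tmap_inj; rewrite tmap_comp ef ?ejX ?eiY; rw i2 => //.
Qed.

Lemma px_hom_comp (X Y Z : PXMod B) (g : Hom Y Z) (f : Hom X Y) :
  px_hom (g ∘ f) = px_hom g ∘ px_hom f.
Proof. by []. Qed.

(** Conjugation in the semidirect product is the pullback action, and f preserves both. *)
Lemma px_semidirect_same (X Y S A : PXMod B) (jX : Hom X S) (iY : Hom Y S)
    (m : Hom X A) (n : Hom Y A) (f : Hom S A) :
  IsPXSemidirect jX iY -> f ∘ jX = m -> f ∘ iY = n ->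
  SameAct (unt A ∘ px_bd Y) (inc A ∘ px_hom n) (inc A ∘ px_hom m).
Proof.
move=> [G [H [kX [kY [kS [p [_ [_ [_ [sd _]]]]]]]]]] e1 e2.
have := f_equal (fun h => inc A ∘ (px_hom f ∘ h)) (semidirect_act sd).
rewrite !comp_act -!px_hom_comp e1 e2 /SameAct => <-.
rewrite (comp_assoc (px_hom f)) -px_hom_comp e1 /act_pullback.
rw (px_hom_act m), (inc_act A).
by rewrite -flat_map_comp comp_idl comp_idr act_flat_map.
Qed.

Lemma px_hom_iso_tmap (X Y : PXMod B) (f : Hom X Y) : IsIso (px_hom f) -> IsIso (tmap f).
Proof.
move=> i; apply: (split_short_five (dom_unt X) (isker_inc X) (dom_unt Y)
  (j' := inc Y ∘ px_hom f)).
- exact: isker_iso (isker_inc Y) i.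
- exact: dom_tmap.
- exact: tmap_unt.
- exact: tmap_inc.
Qed.

(** On underlying objects jX and iY are the kernel and the section of a point. *)
Lemma px_semidirect_regepi (X Y S T : PXMod B) (jX : Hom X S) (iY : Hom Y S)
    (x : Hom X T) (y : Hom Y T) (h : Hom T S) :
  IsPXSemidirect jX iY -> h ∘ x = jX -> h ∘ y = iY -> IsRegularEpi h.
Proof.
move=> [G [H [kX [kY [kS [p [_ [_ [_ [sd _]]]]]]]]]] ex ey.
have [I [q [m [rq [mm e]]]]] := tmap_image h.
apply: tmap_regepi_reflect; rewrite -e tmap_comp; apply: regepi_iso_left => //.
apply: px_hom_iso_tmap.
have ext := ker_jointly_extremal (semidirect_section sd) (semidirect_ker sd).
apply: (ext _ _ (px_hom (q ∘ y)) (px_hom (q ∘ x))).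
- exact: ispb_mono (inc_ispb m) mm.
- by rewrite -px_hom_comp comp_assoc e ey.
- by rewrite -px_hom_comp comp_assoc e ex.
Qed.

(** Σ is a regular epimorphism, hence the cokernel of its kernel.  If the image of this
    kernel is zero, [m, n] factors through Σ and so through both semidirect products. *)
Lemma peiffer_zero_same (M N A : PXMod B) (m : Hom M A) (n : Hom N A) :
  PeifferCommutatorZero m n ->
  SameAct (unt A ∘ px_bd N) (inc A ∘ px_hom n) (inc A ∘ px_hom m) /\
  SameAct (unt A ∘ px_bd M) (inc A ∘ px_hom m) (inc A ∘ px_hom n).
Proof.
move=> [P [k [[D [K [kap [hK [e [_ [_ ek]]]]]]] hP]]].
have r1 := px_semidirect_regepi (pp_XY_semidirect D)
  (cp_copair_inl _ _ _) (cp_copair_inr (pp_coprod D) _ _).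
have r2 := px_semidirect_regepi (pp_YX_semidirect D)
  (cp_copair_inr _ _ _) (cp_copair_inl (pp_coprod D) _ _).
have rS : IsRegularEpi (tmap (pp_sigma D)).
  rewrite /pp_sigma tmap_comp; apply: regepi_comp; apply: tmap_regepi => //.
  exact: pushout_regepi (pp_pushout D) r2.
have [hk _] := px_kernel hK.
have [|W eW] := regepi_cokernel (t := tmap (cp_copair (pp_coprod D) m n)) rS hk.
  rw (tmap_inc (cp_copair (pp_coprod D) m n)).
  rewrite -px_hom_comp -ek px_hom_comp comp_assoc -tmap_inc.
  by rewrite (proj2 (initial_dom_cod (initial_iso hP))) comp_zero zero_comp.
have [w [_ ew]] := tmap_factor rS eW.
have [po _] := pp_pushout D.
split.
- apply: (px_semidirect_same (f := w ∘ pp_q1 D) (pp_XY_semidirect D)).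
  + rewrite -(cp_copair_inl (pp_coprod D) m n) -ew /pp_sigma -!comp_assoc.
    by rewrite cp_copair_inl.
  + rewrite -(cp_copair_inr (pp_coprod D) m n) -ew /pp_sigma -!comp_assoc.
    by rewrite cp_copair_inr.
- apply: (px_semidirect_same (f := w ∘ pp_q2 D) (pp_YX_semidirect D)).
  + rewrite -(cp_copair_inr (pp_coprod D) m n) -ew /pp_sigma po -!comp_assoc.
    by rewrite cp_copair_inr.
  + rewrite -(cp_copair_inl (pp_coprod D) m n) -ew /pp_sigma po -!comp_assoc.
    by rewrite cp_copair_inl.
Qed.

Lemma same_on_graph (UA : ConditionUA C) (A N : PXMod B) (n : Hom N A) (K Q : C)
    (q : Hom (tot A) Q) (k : Hom K (tot A)) :
  IsKer q k -> SameAct (unt A ∘ px_bd N) (inc A ∘ px_hom n) k ->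
  SameAct (unt A ∘ cod N) (tmap n) k.
Proof.
move=> hk s; apply: (ua_same UA (@tot_extremal C B N) hk).
- by rewrite -comp_assoc cod_inc tmap_inc.
- by rewrite -comp_assoc cod_unt comp_idr tmap_unt.
Qed.

(** By (UA) the agreement for N extends to its total object, and then m and n extend to
    both semidirect products, hence to the Peiffer product.  So [m, n] factors through Σ
    and is zero on the kernel of Σ. *)
Lemma same_peiffer_zero (UA : ConditionUA C) (M N A : PXMod B) (m : Hom M A) (n : Hom N A)
    (QM QN : C) (qM : Hom (tot A) QM) (qN : Hom (tot A) QN) :
  IsKer qM (inc A ∘ px_hom m) -> IsKer qN (inc A ∘ px_hom n) ->
  SameAct (unt A ∘ px_bd N) (inc A ∘ px_hom n) (inc A ∘ px_hom m) ->
  SameAct (unt A ∘ px_bd M) (inc A ∘ px_hom m) (inc A ∘ px_hom n) ->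
  PeifferCommutatorZero m n.
Proof.
move=> hm hn sm sn.
have [D] := px_coproduct_exists M N.
have [S [jM [iN [h1 u1]]]] := peiffer_semidirect_exists M N.
have [S' [jN [iM [h2 u2]]]] := peiffer_semidirect_exists N M.
have [f [f1 f2]] := u1 _ _ _ (same_on_graph UA hm sm).
have [f' [f1' f2']] := u2 _ _ _ (same_on_graph UA hn sn).
have [Q [q1 [q2 po]]] := px_pushout_exists (cp_copair D jM iN) (cp_copair D iM jN).
pose PP := MkPeifferProduct h1 h2 po.
have [K [kap hK]] := px_kernel_exists (pp_sigma PP).
case: (po) => _ /(_ _ f f').
case.
  apply: (cp_ext (c := D)); rewrite -!comp_assoc ?cp_copair_inl ?cp_copair_inr.
  - by rewrite f1 f2'.
  - by rewrite f2 f1'.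
move=> w [[w1 w2] _].
have ew : w ∘ pp_sigma PP = cp_copair D m n.
  have -> : pp_sigma PP = q1 ∘ cp_copair D jM iN by [].
  rewrite comp_assoc w1.
  by apply: (cp_ext (c := D)); rewrite -!comp_assoc ?cp_copair_inl ?cp_copair_inr.
case: (hK) => I [i [t [hI pb]]].
exists I, (w ∘ i); split=> //; exists PP, K, kap; split=> //.
exists t; split; [|split].
- apply: tmap_regepi_reflect; have [v [v1 v2]] := initial_iso hI.
  apply: (splitepi_regepi (s := unt K ∘ v)).
  by rw (tmap_unt t), v2.
- apply: tmap_mono_reflect; have iI := initial_iso hI.
  apply: (section_mono (r := unt I ∘ dom A)); rw (dom_tmap (w ∘ i)).
  have [v [v1 v2]] := iI.
  have -> : dom I = v by rewrite -(comp_idl v) -(dom_unt I); rw v2.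
  exact: v2.
- have -> : cp_copair (pp_coprod PP) m n = cp_copair D m n by [].
  by rewrite -ew -comp_assoc; rw (ispb_comm pb).
Qed.

End Peiffer.

(** * Central extensions *)

Section Central.
Context {C : SemiAbelian} {B : C}.

Lemma crossed_same (X : PXMod B) :
  IsCrossedModule X <-> SameAct (inc X) (unt X ∘ px_bd X) (inc X).
Proof.
have e1 : inc X ∘ act_pullback (px_bd X) (px_act X) = act (unt X ∘ px_bd X) (inc X).
  by rewrite /act_pullback comp_assoc inc_act act_flat_map comp_idr.
have e2 : inc X ∘ conj_act (px_ob X) = act (inc X) (inc X).
  by rewrite conj_actE comp_act comp_idr.
split; first by rewrite /SameAct -e1 -e2 => ->.
by move=> e; apply: (isker_mono (isker_inc X)); rewrite e1 e2.
Qed.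

(** For k the inclusion of a normal K with boundary zero, this says that the commutator of
    X and K vanishes. *)
Definition CentralIn (X : PXMod B) {K : C} (k : Hom K (tot X)) : Prop :=
  SameAct (inc X) (unt X ∘ px_bd X) k /\ SameAct (inc X) (zero _ _) k.

Lemma central_zero (X : PXMod B) (K : C) : CentralIn (zero K (tot X)).
Proof. by split; apply: same_zero. Qed.

Lemma central_pre (X : PXMod B) (K L : C) (k : Hom K (tot X)) (l : Hom L K) :
  CentralIn k -> CentralIn (k ∘ l).
Proof. by move=> [h1 h2]; split; apply: same_pre_acted. Qed.

(** By the Peiffer identity an element with zero boundary acts by conjugation as it does
    through its boundary, that is, trivially; commuting is symmetric. *)
Lemma crossed_central (X : PXMod B) (K : C) (k : Hom K (tot X)) :
  IsCrossedModule X -> dom X ∘ k = zero _ _ -> cod X ∘ k = zero _ _ -> CentralIn k.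
Proof.
move=> /crossed_same hX hd hc; have [k' ek] := isker_lift (isker_inc X) hd.
split; first by rewrite -ek; apply: same_pre_acted.
apply: same_commute; have := same_pre_acting k' hX.
by rewrite -comp_assoc ek -cod_inc; rw ek, hc; rewrite comp_zero.
Qed.

Lemma central_jointly (P X Y Z : PXMod B) (f : Hom X Z) (g : Hom Y Z) (p1 : Hom P X)
    (p2 : Hom P Y) (K : C) (k : Hom K (tot P)) :
  IsPullback f g p1 p2 -> CentralIn (tmap p1 ∘ k) -> CentralIn (tmap p2 ∘ k) -> CentralIn k.
Proof.
move=> /tmap_ispb pb; have E (Q : PXMod B) (p : Hom P Q) : CentralIn (tmap p ∘ k) ->
    SameAct (tmap p ∘ inc P) (tmap p ∘ (unt P ∘ px_bd P)) (tmap p ∘ k) /\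
    SameAct (tmap p ∘ inc P) (tmap p ∘ zero _ _) (tmap p ∘ k).
  move=> [h1 h2]; split.
    rewrite comp_assoc tmap_unt tmap_inc -(px_hom_bd p) comp_assoc.
    exact: same_pre_acting h1.
  by have := same_pre_acting (px_hom p) h2; rewrite tmap_inc comp_zero zero_comp.
by move=> /E [h1 h2] /E [h3 h4]; split; apply: (same_jointly pb).
Qed.

Lemma central_descend (P X : PXMod B) (t : Hom P X) (K L : C) (k : Hom K (tot P))
    (l : Hom L (tot X)) (e : Hom K L) :
  IsRegularEpi t -> IsRegularEpi e -> tmap t ∘ k = l ∘ e -> CentralIn k -> CentralIn l.
Proof.
move=> rt re et [h1 h2]; split.
- apply: (same_descend (px_hom_regepi rt) re).
  rewrite -tmap_inc -comp_assoc (px_hom_bd t) -et -(tmap_unt t) -comp_assoc.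
  exact: same_post.
- apply: (same_descend (px_hom_regepi rt) re).
  rewrite -tmap_inc -et zero_comp -(comp_zero _ (tmap t)).
  exact: same_post.
Qed.

Lemma central_full (UA : ConditionUA C) (X : PXMod B) (K Q : C) (q : Hom (tot X) Q)
    (k : Hom K (tot X)) :
  IsKer q k -> CentralIn k ->
  SameAct (idm _) (unt X ∘ cod X) k /\ SameAct (idm _) (unt X ∘ dom X) k.
Proof.
move=> hk [h1 h2]; split; apply: (ua_same UA (@tot_extremal C B X) hk).
- by rewrite comp_idl -comp_assoc cod_inc.
- by rewrite comp_idl -comp_assoc cod_unt comp_idr.
- by rewrite comp_idl -comp_assoc dom_inc comp_zero.
- by rewrite comp_idl -comp_assoc dom_unt comp_idr.
Qed.

(** A trivial extension is jointly embedded into its codomain, where its kernel vanishes,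
    and a crossed module, in which elements of boundary zero are central. *)
Lemma central_extension_central (X Y : PXMod B) (f : Hom X Y) (K : C) (k : Hom K (tot X)) :
  IsCentralExtension (@IsCrossedModule C B) f -> tmap f ∘ k = zero _ _ -> CentralIn k.
Proof.
move=> [rf [Z [p [rp [P [f' [p' [pb [rf' [X' [Y' [eX [eY [f'' [rX [rY nat]]]]]]]]]]]]]]]] ek.
have [|k' [k1 k2]] := ispb_lift (tmap_ispb pb) (a := k) (b := zero _ _).
  by rewrite ek comp_zero.
have ck : CentralIn k'.
  apply: (central_jointly nat); first by rewrite k2; exact: central_zero.
  apply: (crossed_central (proj1 rX)); rewrite comp_assoc ?dom_tmap ?cod_tmap.
  - by rewrite -(dom_tmap f'); rw k2; rewrite comp_zero.
  - by rewrite -(cod_tmap f'); rw k2; rewrite comp_zero.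
apply: (central_descend (t := p') (e := idm K)) ck.
- apply: tmap_regepi_reflect; apply: (regepi_pullback_sym (tmap_ispb pb)).
  exact: tmap_regepi.
- exact: (splitepi_regepi (comp_idl (idm K))).
- by rewrite k1 comp_idr.
Qed.

(** The coequalizer of the two sides of the Peiffer identity. *)
Lemma crossed_reflection (X : PXMod B) :
  exists (G : PXMod B) (q : Hom X G),
    IsReflection (@IsCrossedModule C B) q /\ IsRegularEpi q.
Proof.
have [||G [q cq]] := tmap_coequalizer_exists (X := X)
  (a := act (inc X) (inc X)) (b := act (unt X ∘ px_bd X) (inc X)).
- by rewrite !comp_act dom_inc !act_zero_r.
- by rewrite !comp_act cod_inc comp_assoc cod_unt comp_idl.
have rq := tmap_regepi_reflect (coequalizer_regepi cq).
case: (cq) => e u; exists G, q; split=> //; split.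
- apply/crossed_same; apply: (same_descend (px_hom_regepi rq) (px_hom_regepi rq)).
  have := e; rewrite !comp_act tmap_inc comp_assoc tmap_unt /SameAct => ->.
  by rewrite -comp_assoc px_hom_bd.
- move=> T t /crossed_same hT; have [|W [eW uW]] := u _ (tmap t).
    rewrite !comp_act tmap_inc comp_assoc tmap_unt -(px_hom_bd t) comp_assoc.
    exact: same_pre.
  have [w [ew1 ew2]] := tmap_factor (tmap_regepi rq) eW.
  exists w; split=> // v ev; apply: tmap_inj; rewrite ew1; apply: uW.
  by rewrite -tmap_comp ev.
Qed.

(** The kernel of q, placed on the diagonal, is the kernel of t; so a morphism out of R
    factors through t as soon as its restriction to the diagonal factors through q. *)
Lemma diagonal_factor (R X T X' U : PXMod B) (p : Hom R X) (d : Hom X R) (q : Hom X X')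
    (t : Hom R T) (p' : Hom T X') (s' : Hom (tot X') (tot T)) (s : Hom R U) (v : Hom X' U) :
  p ∘ d = idm X -> IsPullback q p' p t -> IsRegularEpi q ->
  tmap t ∘ tmap d = s' ∘ tmap q -> s ∘ d = v ∘ q -> exists! w : Hom T U, w ∘ t = s.
Proof.
move=> pd pb rq ed es; have tb := tmap_ispb pb.
have rt := regular_epi_stable tb (tmap_regepi rq).
have hk := isker_ker (tmap q); move: (ker_in _) hk; set K := pb_ob _ => k hk.
have hl : IsKer (tmap t) (tmap d ∘ k).
  apply: (isker_pullback_inv tb).
  - by rewrite comp_assoc -tmap_comp pd tmap_id comp_idl.
  - by rw ed, (isker_zero hk); rewrite comp_zero.
have [|W eW] := regepi_cokernel (t := tmap s) rt hl.
  rewrite comp_assoc -tmap_comp es tmap_comp; rw (isker_zero hk).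
  by rewrite comp_zero.
have [w [ew1 ew2]] := tmap_factor rt eW.
exists w; split=> // w' ew'; apply: tmap_inj; apply: (regepi_epi rt).
by rewrite -!tmap_comp ew2 ew'.
Qed.

(** X_1 conjugates M as it acts on it through dom, so the identity of X_1 and the
    inclusion of M extend to the semidirect product X_1 ×_B M_1 of M and X_1. *)
Lemma central_multiplication (UA : ConditionUA C) (X M : PXMod B) (m : Hom M X)
    (Q O : C) (q : Hom (tot X) Q) (o1 : Hom O (tot X)) (o2 : Hom O (tot M))
    (s : Hom (tot X) O) (k : Hom (px_ob M) O) :
  IsKer q (inc X ∘ px_hom m) -> CentralIn (inc X ∘ px_hom m) ->
  IsPullback (dom X) (dom M) o1 o2 ->
  o1 ∘ s = idm _ -> o2 ∘ s = unt M ∘ dom X -> o1 ∘ k = zero _ _ -> o2 ∘ k = inc M ->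
  IsKer o1 k /\ exists F : Hom O (tot X), F ∘ s = idm _ /\ F ∘ k = inc X ∘ px_hom m.
Proof.
move=> hm cm pb s1 s2 k1 k2.
have hk : IsKer o1 k.
  by apply: (isker_pullback_inv (ispb_sym pb)); rewrite ?k2 //; exact: isker_inc.
split=> //.
have sd : IsSemidirect (act_pullback (dom X) (px_act M)) o1 s k.
  apply: semidirect_intro => //; apply: (ispb_ext pb); rewrite comp_act /act_pullback.
  - by rw k1; rewrite !zero_comp act_zero_r.
  - by rw k2, (inc_act M), s2; rewrite act_flat_map comp_idr.
apply: (semidirect_universal sd).
have [_ ->] := central_full UA hm cm.
rewrite /act_pullback; rw (px_hom_act m), (inc_act X).
by rewrite -flat_map_comp comp_idl comp_idr act_flat_map.
Qed.

(** The projection and the multiplication of X_1 ×_B M_1 agree after f, and the resulting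
    morphism of points over X_1 is an isomorphism on kernels. *)
Lemma central_kernel_pair (UA : ConditionUA C) (X Y M R : PXMod B) (f : Hom X Y)
    (m : Hom M X) (p1 p2 : Hom R X) (O : C) (o1 : Hom O (tot X)) (o2 : Hom O (tot M))
    (s : Hom (tot X) O) (k : Hom (px_ob M) O) :
  IsKer (tmap f) (inc X ∘ px_hom m) -> CentralIn (inc X ∘ px_hom m) ->
  IsPullback (tmap f) (tmap f) (tmap p1) (tmap p2) -> IsPullback (dom X) (dom M) o1 o2 ->
  o1 ∘ s = idm _ -> o2 ∘ s = unt M ∘ dom X -> o1 ∘ k = zero _ _ -> o2 ∘ k = inc M ->
  exists P : Hom O (tot R), IsIso P /\ tmap p1 ∘ P = o1 /\ tmap p2 ∘ (P ∘ s) = idm _ /\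
    tmap p2 ∘ (P ∘ k) = inc X ∘ px_hom m.
Proof.
move=> hm cm rb ob s1 s2 k1 k2.
have [hk [F [F1 F2]]] := central_multiplication UA hm cm ob s1 s2 k1 k2.
have [|P [P1 P2]] := ispb_lift rb (a := o1) (b := F).
  apply: (point_ext s1 hk); first by rw s1, F1.
  by rw k1, F2, (isker_zero hm); rewrite comp_zero.
exists P; split; last by split=> //; split; rw P2.
apply: (split_short_five s1 hk (p' := tmap p1) (s' := P ∘ s) (j' := P ∘ k)) => //.
- by rw P1.
- apply: (isker_pullback_inv (ispb_sym rb)); first by rw P2, F2.
  by rw P1.
Qed.

(** The extension is pulled back along itself.  By centrality the domain of the result is
    X_1 ×_B M_1 with M the kernel, and its reflection into crossed modules is
    G_1 ×_B M_1 with G that of X. *)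
Lemma central_central_extension (UA : ConditionUA C) (X Y : PXMod B) (f : Hom X Y)
    (K : C) (k : Hom K (tot X)) :
  IsRegularEpi f -> IsKer (tmap f) k -> CentralIn k ->
  IsCentralExtension (@IsCrossedModule C B) f.
Proof.
move=> rf hk ck.
have [M [m /px_kernel [hm [bM [dcM mm]]]]] := px_kernel_exists f.
have cm : CentralIn (inc X ∘ px_hom m).
  by have [i [_ <-]] := isker_unique hk hm; apply: central_pre.
have [O [o1 [o2 ob]]] := pullback_exists (dom X) (dom M).
have [|s [s1 s2]] := ispb_lift ob (a := idm (tot X)) (b := unt M ∘ dom X).
  by rw (dom_unt M).
have [|l [l1 l2]] := ispb_lift ob (a := zero (px_ob M) (tot X)) (b := inc M).
  by rewrite dom_inc comp_zero.
have [R [p1 [p2 rb]]] := tmap_pullback_exists f f.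
have [P [[P' [i1 i2]] [P1 [P2 P3]]]] := central_kernel_pair UA hm cm rb ob s1 s2 l1 l2.
have op : o1 ∘ P' = tmap p1 by rewrite -P1; rw i2.
have [G [q [[cG uG] rq]]] := crossed_reflection X.
have [O' [n1 [n2 nb]]] := pullback_exists (dom G) (dom M).
have [|r [r1 r2]] := ispb_lift nb (a := tmap q ∘ o1) (b := o2).
  by rw (dom_tmap q), (ispb_comm ob).
have rpb : IsPullback (tmap q) n1 o1 r.
  by apply: (ispb_cancel nb); rewrite ?dom_tmap ?r2.
have [|e [e1 e2]] := ispb_lift nb (a := unt G) (b := unt M); first by rewrite !dom_unt.
have [||T [th [[th' [j1 j2]] [h1 [h2 h3]]]]] := graph_realize_inv (d := dom G ∘ n1)
  (c := cod G ∘ n1) (e := e).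
- by rw e1; exact: dom_unt.
- by rw e1; exact: cod_unt.
have Pu : P' ∘ unt R = s ∘ unt X.
  suff <- : P ∘ (s ∘ unt X) = unt R by rw i1.
  by apply: (ispb_ext rb); rewrite tmap_unt; [rw P1, s1 | rw P2].
have rsu : r ∘ (s ∘ unt X) = e.
  apply: (ispb_ext nb); first by rw r1, s1, (tmap_unt q); rewrite e1.
  by rw r2, s2, (dom_unt X); rewrite e2.
have [|||t et] := tmap_full (X := R) (Y := T) (F := th ∘ (r ∘ P')).
- by rw h1, r1, op, (dom_tmap q); rewrite dom_tmap.
- by rw h2, r1, op, (cod_tmap q); rewrite cod_tmap.
- by rw Pu, rsu.
have [|||t' et'] := tmap_full (X := T) (Y := G) (F := n1 ∘ th').
- by rewrite comp_assoc -h1; rw j2.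
- by rewrite comp_assoc -h2; rw j2.
- by rewrite -h3; rw j1.
have nat : IsPullback q t' p1 t.
  apply: tmap_ispb_reflect; rewrite et et' -op.
  apply: ispb_sym; apply: ispb_iso_corner => //; apply: ispb_sym.
  by apply: ispb_iso rpb _; exists P.
(* The kernel of dom on G_1 ×_B M_1 consists of pairs from G and M, and M is abelian
   with trivial action of G. *)
have cT : IsCrossedModule T.
  have [|v1 ev1] := isker_lift (t := n1 ∘ (th' ∘ inc T)) (isker_inc G).
    by rewrite comp_assoc -h1; rw j2; exact: dom_inc.
  have [|v2 ev2] := isker_lift (t := n2 ∘ (th' ∘ inc T)) (isker_inc M).
    by rw (eq_sym (ispb_comm nb)), (eq_sym h1), j2, (dom_inc T).
  have bT : px_bd T = px_bd G ∘ v1.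
    by rewrite -!cod_inc; rw ev1, (eq_sym h2), j2.
  have abM : SameAct (inc M) (zero _ _) (inc M).
    apply: (same_mono mm); rewrite tmap_inc comp_zero.
    by have := same_pre_acting (px_hom m) (proj2 cm); rewrite zero_comp.
  have trM : SameAct (unt M ∘ px_bd G) (zero _ _) (inc M).
    apply: (same_descend (a := px_hom q) (b := idm _) (px_hom_regepi rq)).
      exact: (splitepi_regepi (comp_idl (idm _))).
    rewrite comp_idr -comp_assoc (px_hom_bd q) zero_comp.
    apply: (same_mono mm); rewrite comp_assoc tmap_unt tmap_inc comp_zero.
    exact: same_trans (same_sym (proj1 cm)) (proj2 cm).
  have same : SameAct (th' ∘ inc T) (e ∘ px_bd T) (th' ∘ inc T).
    apply: (same_jointly nb); rewrite bT !(comp_assoc _ e) ?e1 ?e2 -?ev1 -?ev2.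
    - have := same_pre v1 v1 (proj1 (crossed_same G) cG); by rewrite -comp_assoc.
    - apply: (same_trans (v := zero _ _)).
        by have := same_pre v2 v2 abM; rewrite zero_comp.
      apply: same_sym; have := same_pre v1 v2 trM; by rewrite zero_comp -comp_assoc.
  apply/crossed_same; have := same_post th same.
  by rewrite !comp_assoc j2 comp_idl h3.
have [d [d1 d2]] := ispb_lift (tmap_ispb_reflect rb) (a := idm X) (b := idm X) eq_refl.
have ed : tmap d = P ∘ s.
  apply: (ispb_ext rb); rewrite -tmap_comp ?d1 ?d2 tmap_id ?P2 //.
  by rw P1, s1.
have [|s' [s1' s2']] := ispb_lift nb (a := idm (tot G)) (b := unt M ∘ dom G).
  by rw (dom_unt M).
split=> //; exists X, f; split=> //; exists R, p1, p2; split.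
  exact: ispb_sym (tmap_ispb_reflect rb).
split; first exact: splitepi_regepi d1.
exists T, G, t, q, t'; split; last by [].
split=> // U u hU; have [v [ev _]] := uG U (u ∘ d) hU.
apply: (diagonal_factor (s' := th ∘ s') d1 nat rq _ (eq_sym ev)).
rewrite et ed; rw i1; congr (_ ∘ _); apply: (ispb_ext nb).
- by rw r1, s1, s1'.
- by rw r2, s2, s2', (dom_tmap q).
Qed.

End Central.

(** * Necessity of the two conditions *)

Lemma regepi_idm (A : Category) (X : A) : IsRegularEpi (idm X).
Proof. exact: (splitepi_regepi (comp_idl (idm X))). Qed.

(** The domain functor of Ext has a left adjoint, sending T to its identity. *)
Lemma ext_top_ispb (A : Category) (E F G P : Ext A) (f : Hom E G) (g : Hom F G)
    (p1 : Hom P E) (p2 : Hom P F) :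
  IsPullback f g p1 p2 -> IsPullback (ext_top f) (ext_top g) (ext_top p1) (ext_top p2).
Proof.
move=> pb.
have idE T (X : Ext A) (a : Hom T (ext_dom X)) :
    exists a' : @Hom (Ext A) (MkExt (regepi_idm T)) X, ext_top a' = a.
  have e : ext_arr X ∘ a = (ext_arr X ∘ a) ∘ idm T by rewrite comp_idr.
  by exists (@MkExtHom A (MkExt (regepi_idm T)) X a _ e).
have idext T (X : Ext A) (a b : @Hom (Ext A) (MkExt (regepi_idm T)) X) :
    ext_top a = ext_top b -> a = b.
  move=> e; apply: ext_hom_ext => //.
  have ea := ext_comm a; have eb := ext_comm b; rewrite /= in ea eb.
  by rewrite -[ext_bot a]comp_idr -[ext_bot b]comp_idr -ea -eb e.
apply: ispb_intro.
- exact: (f_equal (fun x => ext_top x) (ispb_comm pb)).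
- move=> T u v e1 e2; have [u' eu] := idE T P u; have [v' ev] := idE T P v.
  rewrite -eu -ev; suff -> : u' = v' by []; apply: (ispb_ext pb); apply: idext.
  + by move: e1; rewrite -eu -ev.
  + by move: e2; rewrite -eu -ev.
- move=> T a b e; have [a' ea] := idE T E a; have [b' eb] := idE T F b.
  have [|u [u1 u2]] := ispb_lift pb (a := a') (b := b').
    by apply: idext; move: e; rewrite -ea -eb.
  exists (ext_top u); rewrite -ea -eb -u1 -u2.
  by split.
Qed.

Section Necessity.
Context {C : SemiAbelian} {B : C}.

Lemma px_regepi_stable (X Y Z P : PXMod B) (f : Hom X Z) (g : Hom Y Z)
    (p1 : Hom P X) (p2 : Hom P Y) :
  IsPullback f g p1 p2 -> IsRegularEpi f -> IsRegularEpi p2.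
Proof.
move=> pb rf; apply: tmap_regepi_reflect.
exact: (regular_epi_stable (tmap_ispb pb)) (tmap_regepi rf).
Qed.

Lemma px_regepi_comp (X Y Z : PXMod B) (g : Hom Y Z) (f : Hom X Y) :
  IsRegularEpi g -> IsRegularEpi f -> IsRegularEpi (g ∘ f).
Proof.
move=> rg rf; apply: tmap_regepi_reflect; rewrite tmap_comp.
by apply: regepi_comp; apply: tmap_regepi.
Qed.

Lemma px_regepi_cancel (X Y Z : PXMod B) (g : Hom Y Z) (f : Hom X Y) :
  IsRegularEpi (g ∘ f) -> IsRegularEpi g.
Proof.
move=> r; apply: tmap_regepi_reflect; apply: (regepi_cancel (f := tmap f)).
by rewrite -tmap_comp; apply: tmap_regepi.
Qed.

(** As the kernel of the single morphism k the intersection is normal, and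
    central_kernel_pair applies to k. *)
Lemma meet_kernel (X Y Z W P : PXMod B) (g : Hom X Z) (f : Hom X Y) (h : Hom Z W)
    (j : Hom Y W) (p1 : Hom P Y) (p2 : Hom P Z) (k : Hom X P)
    (Kf : PXMod B) (kf : Hom Kf X) (Kg : PXMod B) (kg : Hom Kg X)
    (M : PXMod B) (m : Hom M X) :
  IsKernel f kf -> IsKernel g kg -> IsMeet kf kg m ->
  IsPullback j h p1 p2 -> p1 ∘ k = f -> p2 ∘ k = g ->
  IsKer (tmap k) (inc X ∘ px_hom m) /\ IsMono (tmap m) /\ px_bd M = zero _ _.
Proof.
move=> /px_kernel [hf [bf [ef mf]]] /px_kernel [hg [bg [eg mg]]] [q1 [q2 [qb em]]] pb k1 k2.
have tq := tmap_ispb qb.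
have mm : IsMono (tmap m).
  rewrite em tmap_comp; apply: mono_comp => //.
  exact: ispb_mono (ispb_sym tq) mg.
split; last first.
  by split=> //; rewrite -(px_hom_bd q1) bf zero_comp.
have zf : tmap f ∘ (inc X ∘ px_hom m) = zero _ _.
  by rewrite em px_hom_comp; rw (isker_zero hf); rewrite zero_comp.
have zg : tmap g ∘ (inc X ∘ px_hom m) = zero _ _.
  by rewrite em (ispb_comm qb) px_hom_comp; rw (isker_zero hg); rewrite zero_comp.
split; [|split].
- apply: (ispb_ext (tmap_ispb pb)); rewrite comp_zero comp_assoc -tmap_comp.
  + by rewrite k1.
  + by rewrite k2.
- by rewrite -tmap_inc; apply: mono_comp => //; exact: isker_mono (isker_inc M).
- move=> T t e.
  have [|u eu] := isker_lift (t := t) hf.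
    by rewrite -k1 tmap_comp; rw e; rewrite comp_zero.
  have [|v ev] := isker_lift (t := t) hg.
    by rewrite -k2 tmap_comp; rw e; rewrite comp_zero.
  have [|w [w1 w2]] := ispb_lift tq (a := inc Kf ∘ u) (b := inc Kg ∘ v).
    by rewrite !comp_assoc !tmap_inc eu ev.
  have [|z ez] := isker_lift (t := w) (isker_inc M).
    by rewrite -(dom_tmap q1); rw w1, (dom_inc Kf); rewrite zero_comp.
  exists z; rewrite -tmap_inc; rw ez; rewrite em tmap_comp.
  by rw w1, (tmap_inc kf), eu.
Qed.

Lemma peiffer_with_all (UA : ConditionUA C) (M X : PXMod B) (m : Hom M X) (Q : C)
    (q : Hom (tot X) Q) :
  IsKer q (inc X ∘ px_hom m) -> px_bd M = zero _ _ ->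
  PeifferCommutatorZero m (idm X) <-> CentralIn (inc X ∘ px_hom m).
Proof.
move=> hm bM.
have eX : inc X ∘ px_hom (idm X) = inc X by exact: comp_idr.
split.
- move=> /peiffer_zero_same []; rewrite eX bM comp_zero => h1 h2.
  split; first exact: same_sym.
  by apply: same_commute; exact: same_sym.
- move=> [h1 h2]; apply: (same_peiffer_zero UA hm (qN := dom X)); rewrite ?eX ?bM ?comp_zero.
  + exact: isker_inc.
  + exact: same_sym.
  + by apply: same_sym; exact: same_commute.
Qed.

Lemma peiffer_of_kernels (UA : ConditionUA C) (M N X : PXMod B) (m : Hom M X) (n : Hom N X)
    (QM QN : C) (qM : Hom (tot X) QM) (qN : Hom (tot X) QN) :
  IsKer qM (inc X ∘ px_hom m) -> IsKer qN (inc X ∘ px_hom n) ->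
  px_bd M = zero _ _ -> px_bd N = zero _ _ ->
  PeifferCommutatorZero m n <->
  SameAct (inc X ∘ px_hom n) (zero _ _) (inc X ∘ px_hom m).
Proof.
move=> hm hn bM bN; split.
- by move=> /peiffer_zero_same []; rewrite bN comp_zero => h1 _; exact: same_sym.
- move=> s; apply: (same_peiffer_zero UA hm hn); rewrite ?bM ?bN comp_zero; apply: same_sym => //.
  exact: same_commute.
Qed.

(** Only the pullback of domains in the naturality square is used, together with the
    regular epimorphism from R to the pullback of h, through which K[f] is covered. *)
Lemma double_central_conditions (X Y Z W : PXMod B)
    (g : Hom X Z) (f : Hom X Y) (h : Hom Z W) (j : Hom Y W)
    (hf : IsRegularEpi f) (hh : IsRegularEpi h) (sq : h ∘ g = j ∘ f)
    (Kf Kg L : C) (kf : Hom Kf (tot X)) (kg : Hom Kg (tot X)) (l : Hom L (tot X)) :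
  IsDoubleCentralExtension (@IsCrossedModule C B) (ext_square hf hh sq) ->
  tmap f ∘ kf = zero _ _ -> tmap g ∘ kg = zero _ _ -> dom X ∘ kg = zero _ _ ->
  tmap f ∘ l = zero _ _ -> tmap g ∘ l = zero _ _ ->
  CentralIn l /\ SameAct kg (zero _ _) kf.
Proof.
move=> [_ [r [p [[rp [_ [P0 [p1 [p2 [k [kb [k1 [k2 rk]]]]]]]]]
  [f' [s' [p' [pbt [pbb [_ [X'' [Y'' [eX [eY [s'' [rX [_ nat]]]]]]]]]]]]]]]]] zf zg dg zlf zlg.
rewrite /= in k1 k2 pbt pbb kb rp.
have tt := tmap_ispb pbt; have tb := tmap_ispb pbb; have tk := tmap_ispb kb.
have tn := ext_top_ispb nat.
have ec (E F : Ext (PXMod B)) (u : Hom E F) :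
    tmap (ext_bot u) ∘ tmap (ext_arr E) = tmap (ext_arr F) ∘ tmap (ext_top u).
  by rewrite -!tmap_comp ext_comm.
have cX K (a : Hom K (tot (ext_dom f'))) : tmap (ext_arr f') ∘ a = zero _ _ ->
    CentralIn (tmap (ext_top eX) ∘ a).
  move=> ea; apply: (central_extension_central (proj1 rX)).
  by rw (eq_sym (ec _ _ eX)), ea; rewrite comp_zero.
have zf' K (a : Hom K (tot (ext_dom f'))) : tmap f ∘ (tmap (ext_top p') ∘ a) = zero _ _ ->
    tmap (ext_arr r) ∘ (tmap (ext_top s') ∘ a) = zero _ _ ->
    tmap (ext_arr f') ∘ a = zero _ _.
  move=> e1 e2; apply: (ispb_ext tb); rewrite comp_zero.
  - by rw (ec _ _ p').
  - by rw (ec _ _ s').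
have rp' : IsRegularEpi (ext_top p') by apply: px_regepi_stable (ispb_sym pbt) rp.
split.
- have [|c [c1 c2]] := ispb_lift tt (a := l) (b := zero _ _).
    by rewrite /= zlg comp_zero.
  have cc : CentralIn c.
    apply: (central_jointly tn); first by rewrite c2; exact: central_zero.
    by apply: cX; apply: zf'; rewrite ?c1 ?c2 ?comp_zero.
  apply: (central_descend (t := ext_top p') (e := idm L)) cc => //; first exact: regepi_idm.
  by rewrite c1 comp_idr.
- have [|x [x1 x2]] := ispb_lift tk (a := zero _ _) (b := tmap g ∘ kf).
    by rewrite comp_zero comp_assoc -tmap_comp sq tmap_comp; rw zf; rewrite comp_zero.
  have [E [eps [y [re ey]]]] := regepi_cover x (tmap_regepi rk).
  have [|a [a1 a2]] := ispb_lift tt (a := kf ∘ eps) (b := y).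
    by rewrite -k2 tmap_comp -comp_assoc ey /=; rw x2.
  have [|b [b1 b2]] := ispb_lift tt (a := kg) (b := zero _ _).
    by rewrite /= zg comp_zero.
  have ca : CentralIn (tmap (ext_top eX) ∘ a).
    apply: cX; apply: zf'; rewrite ?a1 ?a2; first by rw zf; rewrite zero_comp.
    by rewrite -k1 tmap_comp -comp_assoc ey; rw x1; rewrite zero_comp.
  have [|b' eb'] := isker_lift (t := tmap (ext_top eX) ∘ b) (isker_inc _).
    by rewrite comp_assoc dom_tmap -(dom_tmap (ext_top p')); rw b1.
  have same : SameAct b (zero _ _) a.
    apply: (same_jointly (tmap_ispb tn)); first by rewrite b2 comp_zero.
    have := same_pre_acting b' (proj2 ca).
    by rewrite eb' zero_comp comp_zero.
  apply: (same_descend (a := idm _) (b := eps)) => //; first exact: regepi_idm.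
  have := same_post (tmap (ext_top p')) same.
  by rewrite b1 a1 comp_zero !comp_idr.
Qed.

End Necessity.

(** * Sufficiency of the two conditions *)

Section Sufficiency.
Context {C : SemiAbelian} {B : C}.

(** The quotient of X is the coequalizer of three actions of X on the kernel of f: by
    conjugation, through the boundary, and trivially. *)
Lemma central_reflection (UA : ConditionUA C) (X Y : PXMod B) (f : Hom X Y) :
  IsRegularEpi f ->
  exists (X' : PXMod B) (q : Hom X X') (f' : Hom X' Y),
    IsRegularEpi q /\ f' ∘ q = f /\ IsRegularEpi f' /\
    IsCentralExtension (@IsCrossedModule C B) f' /\
    forall (U V : PXMod B) (e : Hom U V) (t : Hom X U) (b : Hom Y V),
      IsCentralExtension (@IsCrossedModule C B) e -> e ∘ t = b ∘ f ->
      exists v : Hom X' U, v ∘ q = t.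
Proof.
move=> rf; have hk := isker_ker (tmap f); move: (ker_in _) hk; set K := pb_ob _ => k hk.
have dk : dom X ∘ k = zero _ _.
  by rewrite -(dom_tmap f); rw (isker_zero hk); rewrite comp_zero.
have ck : cod X ∘ k = zero _ _.
  by rewrite -(cod_tmap f); rw (isker_zero hk); rewrite comp_zero.
have [||X' [q cq]] := tmap_coequalizer_exists (X := X)
  (a := copair (act (inc X) k) (act (inc X) k))
  (b := copair (act (unt X ∘ px_bd X) k) (act (zero _ _) k)).
- by rewrite !comp_copair !comp_act dk !act_zero_r.
- by rewrite !comp_copair !comp_act ck !act_zero_r.
have rq := tmap_regepi_reflect (coequalizer_regepi cq).
case: (cq) => eq uq.
have [|F [eF _]] := uq _ (tmap f).
  by rewrite !comp_copair !comp_act (isker_zero hk) !act_zero_r.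
have [f' [_ ef]] := tmap_factor (tmap_regepi rq) eF.
have rf' : IsRegularEpi f' by apply: (px_regepi_cancel (f := q)); rewrite ef.
exists X', q, f'; split=> //; split=> //; split=> //; split.
- have hl := isker_ker (tmap f'); move: (ker_in _) hl; set L := pb_ob _ => l hl.
  have [|e [re ee]] := isker_cover (k := k) (tmap_regepi rq) _ hl.
    by rewrite -tmap_comp ef.
  have e1 : tmap q ∘ act (inc X) k = tmap q ∘ act (unt X ∘ px_bd X) k.
    by have := f_equal (fun x => x ∘ inl) eq; autorewrite with cat.
  have e2 : tmap q ∘ act (inc X) k = tmap q ∘ act (zero _ _) k.
    by have := f_equal (fun x => x ∘ inr) eq; autorewrite with cat.
  apply: (central_central_extension UA rf' hl); split;
    apply: (same_descend (px_hom_regepi rq) re); rewrite ee.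
  + move: e1; rewrite !comp_act tmap_inc comp_assoc tmap_unt -(px_hom_bd q).
    by rewrite comp_assoc.
  + by move: e2; rewrite !comp_act tmap_inc comp_zero zero_comp.
- move=> U V e t b ce et.
  have [|c1 c2] := central_extension_central (k := tmap t ∘ k) ce.
    rewrite comp_assoc -tmap_comp et tmap_comp; rw (isker_zero hk).
    by rewrite comp_zero.
  have [|w [ew _]] := uq _ (tmap t).
    rewrite !comp_copair !comp_act tmap_inc comp_assoc tmap_unt comp_zero.
    congr copair.
    + by have := same_pre_acting (px_hom t) c1; rewrite -comp_assoc px_hom_bd.
    + by have := same_pre_acting (px_hom t) c2; rewrite zero_comp.
  by have [v [_ ev]] := tmap_factor (tmap_regepi rq) ew; exists v.
Qed.

(** T is covered by K[g] and X', so that by (UA) it is enough to examine how these two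
    conjugate the kernel l. *)
Lemma double_reflection_central (UA : ConditionUA C) (X X' Y Z W P R J T M : PXMod B)
    (g : Hom X Z) (f : Hom X Y) (h : Hom Z W) (j : Hom Y W)
    (a1 : Hom P Y) (a2 : Hom P Z) (k : Hom X P)
    (q : Hom X X') (f' : Hom X' Y) (p1 p2 : Hom R X) (j1 j2 : Hom J Y) (d : Hom X R)
    (F : Hom R J) (t : Hom R T) (p' : Hom T X') (w : Hom T J) (m : Hom M X)
    (Kf Kg L : C) (kf : Hom Kf (tot X)) (kg : Hom Kg (tot X)) (kr : Hom Kg (tot R))
    (S : Hom (tot X') (tot T)) (l : Hom L (tot T)) :
  IsPullback j h a1 a2 -> a1 ∘ k = f -> a2 ∘ k = g ->
  IsKer (tmap f) kf -> IsKer (tmap g) kg -> IsKer (tmap k) (inc X ∘ px_hom m) ->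
  IsMono (tmap m) -> CentralIn (inc X ∘ px_hom m) -> SameAct kg (zero _ _) kf ->
  IsRegularEpi q -> f' ∘ q = f -> IsCentralExtension (@IsCrossedModule C B) f' ->
  IsPullback g g p1 p2 -> p1 ∘ d = idm X -> p2 ∘ d = idm X ->
  IsPullback j j j1 j2 -> j1 ∘ F = f ∘ p1 -> j2 ∘ F = f ∘ p2 ->
  tmap p1 ∘ kr = zero _ _ -> tmap p2 ∘ kr = kg ->
  IsPullback q p' p1 t -> tmap p' ∘ S = idm _ -> tmap t ∘ tmap d = S ∘ tmap q ->
  w ∘ t = F -> IsKer (tmap w) l -> CentralIn l.
Proof.
move=> ab k1 k2 hkf hkg hm mm cm comm rq efq cf' rb pd1 pd2 jb F1 F2 kr1 kr2 nat pS td wt hl.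
have tr := tmap_ispb rb; have tn := tmap_ispb nat; have ta := tmap_ispb ab.
have rt : IsRegularEpi (tmap t) by apply: (regular_epi_stable tn); exact: tmap_regepi.
have hkr : IsKer (tmap p1) kr by apply: (isker_pullback_inv (ispb_sym tr)); rewrite ?kr2.
have hJ : IsKer (tmap p') (tmap t ∘ kr) by exact: isker_pullback (ispb_sym tn) hkr.
have fk1 : tmap f = tmap a1 ∘ tmap k by rewrite -tmap_comp k1.
have gk2 : tmap g = tmap a2 ∘ tmap k by rewrite -tmap_comp k2.
have e1 : tmap f ∘ tmap p1 = tmap j1 ∘ tmap F by rewrite -!tmap_comp F1.
have e2 : tmap f ∘ tmap p2 = tmap j2 ∘ tmap F by rewrite -!tmap_comp F2.
have hk' := isker_ker (tmap F); move: (ker_in _) hk'; set K' := pb_ob _ => k' hk'.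
have [|e [re ee]] := isker_cover (k := k') rt _ hl; first by rewrite -tmap_comp wt.
have [|x1 ex1] := isker_lift (t := tmap p1 ∘ k') hkf.
  by rw e1, (isker_zero hk'); rewrite comp_zero.
have [|x2 ex2] := isker_lift (t := tmap p2 ∘ k') hkf.
  by rw e2, (isker_zero hk'); rewrite comp_zero.
(* The second components of K' lie in the kernel of f, which commutes with that of g. *)
have cJ : SameAct (tmap t ∘ kr) (zero _ _) l.
  apply: same_commute; apply: (same_descend (a := e) (b := idm _)) => //.
    exact: regepi_idm.
  rewrite ee zero_comp comp_idr -(comp_zero _ (tmap t)); apply: same_post.
  apply: (same_jointly tr); first by rewrite kr1; exact: same_zero.
  rewrite kr2 -ex2 comp_zero.
  by have := same_pre_acting x2 (same_commute comm); rewrite zero_comp.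
(* K' lies in the kernel pair of k, which is X_1 ×_B M_1. *)
have [O [o1 [o2 ob]]] := pullback_exists (dom X) (dom M).
have [|s [s1 s2]] := ispb_lift ob (a := idm (tot X)) (b := unt M ∘ dom X).
  by rw (dom_unt M).
have [|c [c1 c2]] := ispb_lift ob (a := zero (px_ob M) (tot X)) (b := inc M).
  by rewrite dom_inc comp_zero.
have [N [n1 [n2 nb]]] := tmap_pullback_exists k k.
have [V [[V' [i1 i2]] [V1 [V2 _]]]] := central_kernel_pair UA hm cm nb ob s1 s2 c1 c2.
have [|io [io1 io2]] := ispb_lift tr (a := o1) (b := tmap n2 ∘ V).
  by rewrite -V1 gk2; rw (ispb_comm nb).
have [|y [y1 y2]] := ispb_lift nb (a := tmap p1 ∘ k') (b := tmap p2 ∘ k').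
  apply: (ispb_ext ta).
  - by rw (eq_sym fk1), e1, e2, (isker_zero hk'); rewrite !comp_zero.
  - by rw (eq_sym gk2), (ispb_comm tr).
have ey : io ∘ (V' ∘ y) = k'.
  apply: (ispb_ext tr); first by rw io1, (eq_sym V1), i2, y1.
  by rw io2, i2, y2.
have eyo : o1 ∘ (V' ∘ y) = kf ∘ x1 by rw (eq_sym V1), i2, y1.
have ios : io ∘ s = tmap d.
  apply: (ispb_ext tr); rewrite -tmap_comp ?pd1 ?pd2 tmap_id.
  - by rw io1, s1.
  - by rw io2, V2.
(* The image of X_1 ×_B M_1 in T is X'_1 ×_B M_1. *)
have [O' [m1 [m2 mb]]] := pullback_exists (dom X') (dom M).
have [|r [r1 r2]] := ispb_lift mb (a := tmap q ∘ o1) (b := o2).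
  by rw (dom_tmap q), (ispb_comm ob).
have rpb : IsPullback (tmap q) m1 o1 r.
  by apply: (ispb_cancel mb); rewrite ?dom_tmap ?r2.
have [|s' [s1' s2']] := ispb_lift mb (a := idm (tot X')) (b := unt M ∘ dom X').
  by rw (dom_unt M).
have rs : r ∘ s = s' ∘ tmap q.
  apply: (ispb_ext mb); first by rw r1, s1, s1'.
  by rw r2, s2, s2', (dom_tmap q).
have rr : IsRegularEpi r by apply: (regular_epi_stable rpb); exact: tmap_regepi.
have hkq := isker_ker (tmap q); move: (ker_in _) hkq; set Kq := pb_ob _ => kq hkq.
have hr : IsKer r (s ∘ kq).
  apply: (isker_pullback_inv rpb); first by rw s1.
  by rw rs, (isker_zero hkq); rewrite comp_zero.
have [|th eth] := regepi_cokernel (t := tmap t ∘ io) rr hr.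
  by rw ios, td, (isker_zero hkq); rewrite comp_zero.
have ths : th ∘ s' = S.
  apply: (regepi_epi (tmap_regepi rq)).
  by rw (eq_sym rs), eth, ios, td.
have el : l ∘ e = th ∘ (r ∘ (V' ∘ y)) by rewrite ee -ey; rw eth.
have key (v : Hom (tot X') (tot X')) :
    SameAct (s' ∘ tmap q) (s' ∘ (v ∘ tmap q)) (r ∘ (V' ∘ y)) -> SameAct S (S ∘ v) l.
  move=> same; apply: (same_descend (a := tmap q) (b := e)) => //; first exact: tmap_regepi.
  by rewrite el -ths -!comp_assoc; apply: same_post.
have hl0 := isker_ker (tmap f'); move: (ker_in _) hl0; set L0 := pb_ob _ => l0 hl0.
have [cX' dX'] := central_full UA hl0 (central_extension_central cf' (isker_zero hl0)).
have [|z ez] := isker_lift (t := tmap q ∘ (kf ∘ x1)) hl0.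
  by rewrite comp_assoc -tmap_comp efq; rw (isker_zero hkf); rewrite zero_comp.
have m1y : m1 ∘ (r ∘ (V' ∘ y)) = l0 ∘ z by rw r1, eyo, ez.
have [|z' ez'] := isker_lift (t := o2 ∘ (V' ∘ y)) (isker_inc M).
  rewrite comp_assoc -(ispb_comm ob) -comp_assoc eyo ex1.
  by rewrite comp_assoc dom_tmap -(dom_tmap F); rw (isker_zero hk'); rewrite comp_zero.
have m2y : m2 ∘ (r ∘ (V' ∘ y)) = inc M ∘ z' by rw r2, ez'.
have [cX dX] := central_full UA hm cm.
have dS : SameAct S (S ∘ (unt X' ∘ dom X')) l.
  apply: key; apply: (same_jointly mb); rewrite ?m1y ?m2y.
  - by rw s1'; have := same_pre (tmap q) z dX'; rewrite comp_idl -comp_assoc.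
  - by rw s2', (dom_unt X').
have cS : SameAct S (S ∘ (unt X' ∘ cod X')) l.
  apply: key; apply: (same_jointly mb); rewrite ?m1y ?m2y.
  - by rw s1'; have := same_pre (tmap q) z cX'; rewrite comp_idl -comp_assoc.
  - rw s2', (dom_unt X'), (dom_tmap q), (cod_tmap q).
    apply: same_pre_acted; apply: (same_mono mm).
    rewrite !comp_assoc tmap_unt tmap_inc.
    exact: same_trans (same_sym dX) cX.
have Su : S ∘ unt X' = unt T.
  by rewrite -(tmap_unt q); rw (eq_sym td), (tmap_unt d); rewrite tmap_unt.
have codJ : cod T ∘ (tmap t ∘ kr) = zero _ _.
  rw (cod_tmap t); rewrite -(cod_tmap p2) -(cod_tmap g); rw kr2, (isker_zero hkg).
  by rewrite comp_zero.
have domJ : dom T ∘ (tmap t ∘ kr) = zero _ _.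
  by rw (dom_tmap t); rewrite -(dom_tmap p1); rw kr1; rewrite comp_zero.
have codS : cod T ∘ S = cod X'.
  apply: (regepi_epi (tmap_regepi rq)); rw (eq_sym td), (cod_tmap t), (cod_tmap d).
  by rewrite cod_tmap.
have domS : dom T ∘ S = dom X'.
  apply: (regepi_epi (tmap_regepi rq)); rw (eq_sym td), (dom_tmap t), (dom_tmap d).
  by rewrite dom_tmap.
have ex := ker_jointly_extremal pS hJ.
have cl : SameAct (idm _) (unt T ∘ cod T) l.
  apply: (ua_same UA ex hl); rewrite comp_idl.
  - by rw codS, (eq_sym Su).
  - by rw codJ; rewrite comp_zero.
have dl : SameAct (idm _) (unt T ∘ dom T) l.
  apply: (ua_same UA ex hl); rewrite comp_idl.
  - by rw domS, (eq_sym Su).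
  - by rw domJ; rewrite comp_zero.
split.
- by have := same_pre_acting (inc T) cl; rewrite comp_idl -comp_assoc cod_inc.
- by have := same_pre_acting (inc T) dl; rewrite comp_idl -comp_assoc dom_inc comp_zero.
Qed.

(** Two elements of X with the same image in X' differ by an element of K[f], which acts
    trivially on K[g]; so the point R[g] over X descends along q. *)
Lemma kernel_pair_descent (UA : ConditionUA C) (X X' Y Z R : PXMod B)
    (g : Hom X Z) (f : Hom X Y) (q : Hom X X') (f' : Hom X' Y) (p1 p2 : Hom R X) (d : Hom X R)
    (Kf Kg : C) (kf : Hom Kf (tot X)) (kg : Hom Kg (tot X)) (kr : Hom Kg (tot R)) :
  IsKer (tmap f) kf -> IsKer (tmap g) kg -> SameAct kg (zero _ _) kf ->
  IsRegularEpi q -> f' ∘ q = f ->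
  IsPullback g g p1 p2 -> p1 ∘ d = idm X -> p2 ∘ d = idm X ->
  tmap p1 ∘ kr = zero _ _ -> tmap p2 ∘ kr = kg ->
  exists (T : PXMod B) (t : Hom R T) (p' : Hom T X') (S : Hom (tot X') (tot T)),
    IsPullback q p' p1 t /\ tmap p' ∘ S = idm _ /\ tmap t ∘ tmap d = S ∘ tmap q.
Proof.
move=> hkf hkg comm rq efq rb pd1 pd2 kr1 kr2; have tr := tmap_ispb rb.
have hkr : IsKer (tmap p1) kr by apply: (isker_pullback_inv (ispb_sym tr)); rewrite ?kr2.
have rtq := tmap_regepi rq.
have tpd1 : tmap p1 ∘ tmap d = idm _ by rewrite -tmap_comp pd1 tmap_id.
have tpd2 : tmap p2 ∘ tmap d = idm _ by rewrite -tmap_comp pd2 tmap_id.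
have [E [r1 [r2 eb]]] := pullback_exists (tmap q) (tmap q).
have [dg [dg1 dg2]] := ispb_lift eb (a := idm _) (b := idm _) eq_refl.
have hkq := isker_ker (tmap q); move: (ker_in _) hkq; set Kq := pb_ob _ => kq hkq.
have [|n [n1 n2]] := ispb_lift eb (a := zero Kq (tot X)) (b := kq).
  by rewrite comp_zero (isker_zero hkq).
have hn : IsKer r1 n by apply: (isker_pullback_inv (ispb_sym eb)); rewrite ?n2.
have [|x ex] := isker_lift (t := kq) hkf.
  by rewrite -efq tmap_comp; rw (isker_zero hkq); rewrite comp_zero.
have same : SameAct r1 r2 kg.
  apply: (ua_same UA (ker_jointly_extremal dg1 hn) hkg); first by rewrite dg1 dg2.
  rewrite n1 n2 -ex; apply: same_sym.
  by have := same_pre_acting x (same_commute comm); rewrite zero_comp.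
have same' : SameAct (tmap d ∘ r1) (tmap d ∘ r2) kr.
  apply: (same_jointly tr); first by rewrite kr1; exact: same_zero.
  by rewrite !comp_assoc tpd2 !comp_idl kr2.
have [T0 [p0 [s0 [t0 [ps0 [ts0 [pb0 _]]]]]]] := point_descent tpd1 hkr rtq eb same'.
have [||T [th [[th' [i1 i2]] [h1 [h2 h3]]]]] := graph_realize_inv (d := dom X' ∘ p0)
  (c := cod X' ∘ p0) (e := s0 ∘ unt X').
- by rw ps0; exact: dom_unt.
- by rw ps0; exact: cod_unt.
have [|||t et] := tmap_full (X := R) (Y := T) (F := th ∘ t0).
- by rw h1, (ispb_comm pb0), (dom_tmap q); exact: dom_tmap.
- by rw h2, (ispb_comm pb0), (cod_tmap q); exact: cod_tmap.
- by rewrite -(tmap_unt d); rw ts0, (tmap_unt q).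
have [|||p' ep'] := tmap_full (X := T) (Y := X') (F := p0 ∘ th').
- by rewrite comp_assoc -h1; rw i2.
- by rewrite comp_assoc -h2; rw i2.
- by rewrite -h3; rw i1, ps0.
exists T, t, p', (th ∘ s0); split; last first.
  by rewrite et ep'; split; [rw i1 | rw ts0].
apply: tmap_ispb_reflect; rewrite et ep'; apply: ispb_sym.
exact: ispb_iso_corner.
Qed.

(** The double extension is pulled back along itself; the reflections of f and of the
    resulting extension F are q and t. *)
Lemma conditions_double_central (UA : ConditionUA C) (X Y Z W M : PXMod B)
    (g : Hom X Z) (f : Hom X Y) (h : Hom Z W) (j : Hom Y W)
    (hf : IsRegularEpi f) (hh : IsRegularEpi h) (sq : h ∘ g = j ∘ f)
    (P : PXMod B) (a1 : Hom P Y) (a2 : Hom P Z) (k : Hom X P) (m : Hom M X)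
    (Kf Kg : C) (kf : Hom Kf (tot X)) (kg : Hom Kg (tot X)) :
  IsDoubleExtension (ext_square hf hh sq) ->
  IsPullback j h a1 a2 -> a1 ∘ k = f -> a2 ∘ k = g -> IsRegularEpi k ->
  IsKer (tmap f) kf -> IsKer (tmap g) kg -> IsKer (tmap k) (inc X ∘ px_hom m) ->
  IsMono (tmap m) -> CentralIn (inc X ∘ px_hom m) -> SameAct kg (zero _ _) kf ->
  IsDoubleCentralExtension (@IsCrossedModule C B) (ext_square hf hh sq).
Proof.
move=> dbl ab k1 k2 rk hkf hkg hm mm cm comm.
have [rg [rj _]] := dbl; rewrite /= in rg rj.
have [X' [q [f' [rq [efq [rf' [cf' uf']]]]]]] := central_reflection UA hf.
have [R [p1 [p2 /tmap_ispb_reflect rb]]] := tmap_pullback_exists g g.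
have [J [j1 [j2 /tmap_ispb_reflect jb]]] := tmap_pullback_exists j j.
have [d [d1 d2]] := ispb_lift rb (a := idm X) (b := idm X) eq_refl.
have [e [e1 e2]] := ispb_lift jb (a := idm Y) (b := idm Y) eq_refl.
have [|F [F1 F2]] := ispb_lift jb (a := f ∘ p1) (b := f ∘ p2).
  by rewrite !comp_assoc -sq -!comp_assoc (ispb_comm rb).
have [|kr [kr1 kr2]] := ispb_lift (tmap_ispb rb) (a := zero Kg (tot X)) (b := kg).
  by rewrite comp_zero (isker_zero hkg).
have [T [t [p' [S [nat [pS td]]]]]] :=
  kernel_pair_descent UA hkf hkg comm rq efq rb d1 d2 kr1 kr2.
have Fd : F ∘ d = (e ∘ f') ∘ q.
  apply: (ispb_ext jb); first by rw F1, d1, e1; rewrite efq.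
  by rw F2, d2, e2; rewrite efq.
(* The comparison c of the square (p1, j1) with its pullback is itself the pullback of k
   along (y, y', x) |-> (y', g x). *)
have [Q [u1 [u2 /tmap_ispb_reflect ub]]] := tmap_pullback_exists j1 f.
have [c [c1 c2]] := ispb_lift ub F1.
have rc : IsRegularEpi c.
  have [|v [v1 v2]] := ispb_lift ab (a := j2 ∘ u1) (b := g ∘ u2).
    by rw (eq_sym (ispb_comm jb)), (ispb_comm ub); rewrite !comp_assoc sq.
  apply: (px_regepi_stable (f := k) (g := v) (p1 := p2)) rk.
  apply: ispb_intro.
  - apply: (ispb_ext ab); first by rw k1, v1, c1, F2.
    by rw k2, v2, c2, (ispb_comm rb).
  - move=> U x y ex /(f_equal (fun x => u2 ∘ x)); rw c2 => ey.
    exact: (ispb_ext rb).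
  - move=> U x y exy.
    have [|z [z1 z2]] := ispb_lift rb (a := u2 ∘ y) (b := x).
      by rewrite -{2}k2; rw exy, v2.
    exists z; split=> //; apply: (ispb_ext ub); last by rw c2, z1.
    apply: (ispb_ext jb).
    + by rw c1, F1, z1, (ispb_comm ub).
    + by rw c1, F2, z2, (eq_sym k1), exy, v1.
have rF : IsRegularEpi F.
  by rewrite -c1; apply: px_regepi_comp => //; apply: px_regepi_stable (ispb_sym ub) hf.
have uT : forall (U V : PXMod B) (x : Hom U V) (a : Hom R U) (b : Hom J V),
    IsCentralExtension (@IsCrossedModule C B) x -> x ∘ a = b ∘ F ->
    exists! w : Hom T U, w ∘ t = a.
  move=> U V x a b cx ea; have [|v ev] := uf' _ _ _ (a ∘ d) (b ∘ e) cx.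
    by rw ea, Fd; rewrite efq.
  exact: (diagonal_factor d1 nat rq td (eq_sym ev)).
have rt : IsRegularEpi t by apply: px_regepi_stable nat rq.
have [w [wt _]] : exists! w : Hom T J, w ∘ t = F.
  exact: (diagonal_factor d1 nat rq td Fd).
have rw' : IsRegularEpi w by apply: (px_regepi_cancel (f := t)); rewrite wt.
have cw : IsCentralExtension (@IsCrossedModule C B) w.
  have hl := isker_ker (tmap w).
  apply: (central_central_extension UA rw' hl).
  exact: (double_reflection_central UA ab k1 k2 hkf hkg hm mm cm comm rq efq cf' rb d1 d2 jb
    F1 F2 kr1 kr2 nat pS td wt hl).
have epw : f' ∘ p' = j1 ∘ w.
  apply: (regepi_epi rt); rw (eq_sym (ispb_comm nat)), wt, F1.
  by rewrite comp_assoc efq.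
pose EF : Ext (PXMod B) := MkExt rF.
pose Ef : Ext (PXMod B) := MkExt hf.
pose Ef' : Ext (PXMod B) := MkExt rf'.
pose Ew : Ext (PXMod B) := MkExt rw'.
have s_comm : ext_arr Ef ∘ p1 = j1 ∘ ext_arr EF by exact: eq_sym F1.
have p_comm : ext_arr Ef ∘ p2 = j2 ∘ ext_arr EF by exact: eq_sym F2.
have t_comm : ext_arr Ew ∘ t = idm J ∘ ext_arr EF by exact: eq_trans wt (eq_sym (comp_idl F)).
have q_comm : ext_arr Ef' ∘ q = idm Y ∘ ext_arr Ef by exact: eq_trans efq (eq_sym (comp_idl f)).
pose Es : @Hom (Ext (PXMod B)) EF Ef := @MkExtHom _ EF Ef p1 j1 s_comm.
pose Ep : @Hom (Ext (PXMod B)) EF Ef := @MkExtHom _ EF Ef p2 j2 p_comm.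
pose Et : @Hom (Ext (PXMod B)) EF Ew := @MkExtHom _ EF Ew t (idm J) t_comm.
pose Eq : @Hom (Ext (PXMod B)) Ef Ef' := @MkExtHom _ Ef Ef' q (idm Y) q_comm.
pose Ep' : @Hom (Ext (PXMod B)) Ew Ef' := @MkExtHom _ Ew Ef' p' j1 epw.
split=> //; exists Ef, (ext_square hf hh sq); split=> //.
exists EF, Es, Ep; split; first exact: ispb_sym.
split; first exact: ispb_sym.
split.
  split; first exact: splitepi_regepi d1.
  split; first exact: splitepi_regepi e1.
  by exists Q, u1, u2, c.
exists Ew, Ef', Et, Eq, Ep'; split; [|split].
- split=> // U a cU; have [v [ev uv]] := uT _ _ _ _ _ cU (ext_comm a).
  have v_comm : ext_arr U ∘ v = ext_bot a ∘ w.
    by apply: (regepi_epi rt); rw ev, wt; exact: (ext_comm a).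
  exists (@MkExtHom _ Ew U v _ v_comm); split.
    by apply: ext_hom_ext; [exact: ev | exact: comp_idr].
  move=> b eb; apply: ext_hom_ext => /=.
  + by apply: uv; rewrite -eb.
  + by rewrite -(f_equal (fun x => ext_bot x) eb); exact: (comp_idr (ext_bot b)).
- split=> // U a cU; have [v ev] := uf' _ _ _ _ _ cU (ext_comm a).
  have v_comm : ext_arr U ∘ v = ext_bot a ∘ f'.
    by apply: (regepi_epi rq); rw ev, efq; exact: (ext_comm a).
  exists (@MkExtHom _ Ef' U v _ v_comm); split.
    by apply: ext_hom_ext; [exact: ev | exact: comp_idr].
  move=> b eb; apply: ext_hom_ext => /=.
  + by apply: (regepi_epi rq); rewrite ev -eb.
  + by rewrite -(f_equal (fun x => ext_bot x) eb); exact: (comp_idr (ext_bot b)).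
- apply: ispb_intro.
  + apply: ext_hom_ext; first exact: ispb_comm nat.
    exact: eq_trans (comp_idl j1) (eq_sym (comp_idr j1)).
  + move=> U a b ea eb; apply: ext_hom_ext.
      by apply: (ispb_ext nat); [exact: (f_equal (fun x => ext_top x) ea)
                               | exact: (f_equal (fun x => ext_top x) eb)].
    rewrite -(comp_idl (ext_bot a)) -(comp_idl (ext_bot b)).
    exact: (f_equal (fun x => ext_bot x) eb).
  + move=> U a b eab.
    have [x [x1 x2]] := ispb_lift nat (f_equal (fun x => ext_top x) eab).
    have x_comm : F ∘ x = ext_bot b ∘ ext_arr U.
      rewrite -wt; rw x2; exact: (ext_comm b).
    exists (@MkExtHom _ U EF x _ x_comm); split.
      apply: ext_hom_ext; first exact: x1.
      exact: eq_trans (eq_sym (f_equal (fun x => ext_bot x) eab)) (comp_idl (ext_bot a)).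
    by apply: ext_hom_ext; [exact: x2 | exact: (comp_idl (ext_bot b))].
Qed.

End Sufficiency.

Theorem theorem4p1 (C : SemiAbelian) (hUA : ConditionUA C) (B : C)
    (X Y Z W : PXMod B)
    (g : Hom X Z) (f : Hom X Y) (h : Hom Z W) (j : Hom Y W)
    (hf : IsRegularEpi f) (hh : IsRegularEpi h) (sq : h ∘ g = j ∘ f)
    (hdouble : IsDoubleExtension (ext_square hf hh sq))
    (Kf : PXMod B) (kf : Hom Kf X) (hkf : IsKernel f kf)
    (Kg : PXMod B) (kg : Hom Kg X) (hkg : IsKernel g kg)
    (M : PXMod B) (m : Hom M X) (hm : IsMeet kf kg m) :
  IsDoubleCentralExtension (@IsCrossedModule C B) (ext_square hf hh sq) <->
  PeifferCommutatorZero m (idm X) /\ PeifferCommutatorZero kf kg.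
Proof.
have [_ [_ [P [a1 [a2 [k [ab [k1 [k2 rk]]]]]]]]] := hdouble.
rewrite /= in a1 a2 k ab k1 k2 rk.
have [hM [mm bM]] := meet_kernel hkf hkg hm ab k1 k2.
have [hKf [bf _]] := px_kernel hkf; have [hKg [bg _]] := px_kernel hkg.
rewrite (peiffer_with_all hUA hM bM) (peiffer_of_kernels hUA hKf hKg bf bg).
split.
- move=> dc; apply: (double_central_conditions dc (isker_zero hKf) (isker_zero hKg)).
  + by rewrite comp_assoc dom_inc zero_comp.
  + by rewrite -k1 tmap_comp; rw (isker_zero hM); rewrite comp_zero.
  + by rewrite -k2 tmap_comp; rw (isker_zero hM); rewrite comp_zero.
- move=> [cm comm].
  exact: (conditions_double_central hUA hdouble ab k1 k2 rk hKf hKg hM mm cm comm).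
Qed.
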